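(* Let $\Gamma$ be an infinite connected graph with finitely many ends. If the end-periodic map $g\colon\Gamma\to\Gamma$ induces an injection on $\pi_1(\Gamma)$, then for every connected component $\Sigma$ of $\partial_+W_g$ or of $\partial_-W_g$, the inclusion $\Sigma\to W_g$ into the compactified mapping torus of $g$ is $\pi_1$-injective.
   Context: **Graphs.** A graph is a locally finite $1$-dimensional CW complex; its $0$-cells are vertices and its open $1$-cells are edges. A subgraph is a closed subset that is a union of cells. A graph map is a continuous map between graphs sending vertices to vertices and edges to edge paths (finite concatenations of oriented edges; length $0$, i.e. constant at a vertex, is allowed). An isomorphism of graphs is a homeomorphism sending edges to edges. **Ends.** Let $\Gamma$ be an infinite graph. A sequence of nonempty nested subsets $U_1\supseteq U_2\supseteq\cdots$ is a neighborhood basis for an end if there is an exhaustion $K_1\subseteq K_2\subseteq\cdots$ of $\Gamma$ by compact sets such that each $U_n$ is a connected component of $\Gamma-K_n$. An end is an equivalence class of neighborhood bases, where $\{U_n\}\sim\{V_n\}$ if for each $n$ there are $i,j$ with $U_i\subseteq V_n$ and $V_j\subseteq U_n$. The set of ends is $\mathcal{E}(\Gamma)$. A neighborhood of an end $E$ is an open set $U$ that contains the tail of every neighborhood basis for $E$ but meets a neighborhood basis of any other end in only finitely many terms. **End-periodic maps.** A graph map $g\colon\Gamma\to\Gamma$ is end-periodic if there is a neighborhood $U_E$ of each end $E$ such that $g$ restricted to the largest subgraph contained in $\bigcup_{E\in\mathcal{E}(\Gamma)}U_E$ is a homeomorphism (onto its image) sending edges to edges, and, for some $p>0$, every $U_E$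 satisfies one of: (i) $g^p(U_E)\subsetneq U_E$ and $\{g^{pn}(U_E)\}_{n\ge0}$ is a neighborhood basis for $E$ (then $E$ is attracting); or (ii) $g^{-p}(U_E)\subsetneq U_E$ and $\{g^{-pn}(U_E)\}_{n\ge0}$ is a neighborhood basis for $E$ (then $E$ is repelling). Such $U_E$ are nesting neighborhoods. $g$ permutes the ends: $g(E)$ is the end such that $g(U_E)\cap U_{g(E)}$ contains an infinite subgraph; $|E|$ is the least positive integer with $g^{|E|}(E)=E$. **Well-chosen systems.** A system $\{U_E\}$ of nesting neighborhoods is well-chosen if: (1) distinct $U_E$ have disjoint closures; (2) each $\overline{U_E}$ is a subgraph; (3) $g$ and $g^{-1}$ restrict to isomorphisms on the closures $\overline{U_E}$; (4) every $g$-orbit of ends contains a unique end $E$ such that either $E$ is attracting and $g^k(\overline{U_E})=\overline{U_{g^k(E)}}$ for $0\le k<|E|$, or $E$ is repelling and $g^{-k}(\overline{U_E})=\overline{U_{g^{-k}(E)}}$ for $0\le k<|E|$. Well-chosen systems always exist. Given one, $\Gamma_+$ and $\Gamma_-$ are the unions of the $U_E$ over attracting, respectively repelling, ends. **Mapping torus.** $Z=Z_g=\Gamma\times[0,1]/\big((x,1)\sim(g(x),0)\big)$, with suspension semiflow $\psi_g$ induced by $((x,y),t)\mapsto(x,y+t)$ for $0\le t\le 1-y$; $\Gamma$ is identified with the image of $\Gamma\times\{0\}$. $Z_+\subseteq Z$ is the mapping torus of $g|_{\Gamma_+}$, i.e. the forward orbit of $\Gamma_+$ under $\psi_g$. $Z_-\subseteq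 Z$ is the subset corresponding to the mapping torus of $g^{-1}|_{\Gamma_-}$, i.e. the union of backward flowlines of points of $\Gamma_-$; it carries a semiflow $\psi_{g^{-1}}$ with $\psi_g^t\psi_{g^{-1}}^t=\mathrm{id}_{Z_-}$ for all $t\ge0$. **Compactified mapping torus.** For $z\in Z_\pm$ put $\gamma_z=\psi_{g^{\pm1}}(z,[0,\infty))$. Let $\partial_\infty Z_\pm$ be the set of rays $\gamma_z$, $z\in Z_\pm$, modulo identifying $\gamma_w$ and $\gamma_z$ if one contains the other ($\partial_\infty Z_+$ and $\partial_\infty Z_-$ are taken disjoint). Let $W_\pm=Z_\pm\cup\partial_\infty Z_\pm$ and extend the semiflow by $\psi_{g^{\pm1}}(z,\infty)=\gamma_z$ and $\psi_{g^{\pm1}}(\gamma_z,t)=\gamma_z$. Neighborhoods in $W_\pm$ of $\gamma_z\in\partial_\infty Z_\pm$ are the sets $\psi_{g^{\pm1}}(N(z),(t,\infty])$, with $t>0$ and $N(z)$ a $Z_\pm$-neighborhood of $z$. The compactified mapping torus is $W_g=Z\cup\partial_\infty Z_+\cup\partial_\infty Z_-$, with topology generated by these neighborhoods and the open sets of $Z$. It does not depend on the choice of well-chosen system. Its positive and negative boundaries are $\partial_\pm W_g=\partial_\infty Z_\pm$; these are (possibly empty) finite graphs. *)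

(* Defs.v *)
From HB Require Import structures.
From Stdlib Require Import Relations.
From mathcomp Require Import all_boot all_order all_algebra generic_quotient.
From mathcomp Require Import all_classical all_reals topology.
From mathcomp Require Import normedtype.

Set Implicit Arguments.
Unset Strict Implicit.
Unset Printing Implicit Defensive.

Import Order.TTheory GRing.Theory Num.Theory.
Import numFieldNormedType.Exports.

Local Open Scope classical_set_scope.
Local Open Scope ring_scope.
Local Open Scope quotient_scope.

(** Quotient of a type by the equivalence relation generated by [r]. *)

Section GeneratedQuotient.
Context {X : choiceType} (r : X -> X -> Prop).

Definition gen_rel : rel X := fun x y => `[< clos_refl_sym_trans X r x y >].

Lemma gen_rel_refl : reflexive gen_rel.
Proof. by move=> x; apply/asboolP; apply: rst_refl. Qed.

Lemma gen_rel_sym : symmetric gen_rel.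
Proof. by move=> x y; apply/asboolP/asboolP; apply: rst_sym. Qed.

Lemma gen_rel_trans : transitive gen_rel.
Proof.
by move=> y x z /asboolP xy /asboolP yz; apply/asboolP; apply: rst_trans yz.
Qed.

Definition gen_equiv := EquivRel gen_rel gen_rel_refl gen_rel_sym gen_rel_trans.

End GeneratedQuotient.

(** Graphs.  Besides the usual conditions on characteristic maps, [graph_weak]
    says that [T] carries the weak topology of its cells; it entails that the
    vertex set is closed and discrete and that [T] is Hausdorff. *)

Record graph (R : realType) (T : topologicalType) := Graph {
  vertex : set T;
  edge : Type;
  chi : edge -> R -> T;
  chi_continuous : forall e, {within `[0, 1], continuous (chi e)};
  chi_ends : forall e, vertex (chi e 0) /\ vertex (chi e 1);
  chi_inj : forall e e' (s t : R), s \in `]0, 1[ -> t \in `]0, 1[ ->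
    chi e s = chi e' t -> e = e' /\ s = t;
  chi_interior : forall e (s : R), s \in `]0, 1[ -> ~ vertex (chi e s);
  graph_cover : forall x, vertex x \/
    exists e, exists2 s : R, s \in `]0, 1[ & chi e s = x;
  graph_weak : forall A : set T,
    (forall e, closed (`[0, 1] `&` chi e @^-1` A)) -> closed A;
  graph_locally_finite : forall x,
    finite_set [set e | (chi e @` `[0, 1]) x]
}.

Section Graphs.
Context {R : realType} {T : topologicalType} (G : graph R T).

Definition open_edge (e : edge G) : set T := chi e @` `]0, 1[.

(* infinitely many cells *)
Definition infinite_graph : Prop :=
  infinite_set (vertex G) \/ infinite_set [set: edge G].

Definition subgraph (S : set T) : Prop :=
  closed S /\ forall e, open_edge e `<=` S \/ open_edge e `&` S = set0.

Definition infinite_subgraph (S : set T) : Prop :=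
  subgraph S /\ (infinite_set (vertex G `&` S) \/
                 infinite_set [set e | open_edge e `<=` S]).

Definition largest_subgraph (A : set T) : set T :=
  \bigcup_(S in [set S | subgraph S /\ S `<=` A]) S.

(* [a] restricted to [c, d] runs once, in either direction, along [e] *)
Definition traverses (a : R -> T) (c d : R) (e : edge G) : Prop :=
  exists h : R -> R,
    [/\ {within `[c, d], continuous h},
        {in `[c, d] &, injective h},
        (h c = 0 /\ h d = 1) \/ (h c = 1 /\ h d = 0) &
        {in `[c, d], forall t, a t = chi e (h t)}].

Definition edge_path (a : R -> T) : Prop :=
  (exists2 v, vertex G v & {in `[0, 1], forall t, a t = v}) \/
  exists (n : nat) (s : nat -> R),
    [/\ (0 < n)%N, s 0%N = 0, s n = 1 &
        forall i, (i < n)%N -> s i < s i.+1 /\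
          exists e, traverses a (s i) (s i.+1) e].

Definition graph_map (g : T -> T) : Prop :=
  [/\ continuous g, forall v, vertex G v -> vertex G (g v) &
      forall e : edge G, edge_path (g \o chi e)].

Definition homeo_onto_image (g : T -> T) (A : set T) : Prop :=
  {within A, continuous g} /\
  exists2 h : T -> T, {within g @` A, continuous h} & {in A, cancel g h}.

Definition edges_to_edges (g : T -> T) (A : set T) : Prop :=
  forall e, open_edge e `<=` A -> exists e', g @` open_edge e = open_edge e'.

Definition graph_iso_on (g : T -> T) (A B : set T) : Prop :=
  [/\ subgraph A, subgraph B, g @` A = B, homeo_onto_image g A &
      edges_to_edges g A].

End Graphs.

(** Ends.  An end is the equivalence class, as a set of sequences, of its
    neighborhood bases. *)

Section Ends.
Context {T : topologicalType}.

Definition exhaustion (K : nat -> set T) : Prop :=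
  [/\ forall n, compact (K n), forall n, K n `<=` K n.+1 &
      \bigcup_n (K n)° = setT].

Definition nbhd_basis (B : nat -> set T) : Prop :=
  [/\ forall n, B n !=set0, forall n, B n.+1 `<=` B n &
      exists2 K, exhaustion K &
        forall n, exists2 x, (~` K n) x &
          B n = connected_component (~` K n) x].

Definition basis_equiv (B C : nat -> set T) : Prop :=
  forall n, (exists i, B i `<=` C n) /\ (exists j, C j `<=` B n).

Definition ends : set (set (nat -> set T)) :=
  [set E | exists2 B, nbhd_basis B &
             E = [set C | nbhd_basis C /\ basis_equiv B C]].

Definition end_nbhd (E : set (nat -> set T)) (A : set T) : Prop :=
  [/\ open A,
      forall B, E B -> exists N, forall n, (N <= n)%N -> B n `<=` A &
      forall E', ends E' -> E' <> E ->
        forall B, E' B -> finite_set [set n | B n `&` A !=set0]].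

End Ends.

Arguments ends : clear implicits.

(** End-periodic maps.  A system of neighborhoods is a function [U] on ends;
    [g^-n] is the preimage under the [n]-th iterate. *)

Section EndPeriodic.
Context {R : realType} {T : topologicalType} (G : graph R T) (g : T -> T).
Context (p : nat) (U : set (nat -> set T) -> set T).

Implicit Types E : set (nat -> set T).

Definition attracting E : Prop :=
  iter p g @` U E `<` U E /\ E (fun n => iter (p * n) g @` U E).

Definition repelling E : Prop :=
  iter p g @^-1` U E `<` U E /\ E (fun n => iter (p * n) g @^-1` U E).

Definition nesting_system : Prop :=
  let S := largest_subgraph G (\bigcup_(E in ends T) U E) in
  [/\ (0 < p)%N,
      forall E, ends T E -> end_nbhd E (U E),
      homeo_onto_image g S,
      edges_to_edges G g S &
      forall E, ends T E -> attracting E \/ repelling E].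

(* the permutation of the ends induced by [g] *)
Definition end_map E : set (nat -> set T) :=
  xget set0 [set E' | ends T E' /\
    exists2 S, infinite_subgraph G S & S `<=` g @` U E `&` U E'].

Definition end_period E (n : nat) : Prop :=
  [/\ (0 < n)%N, iter n end_map E = E &
      forall m, (0 < m)%N -> iter m end_map E = E -> (n <= m)%N].

Definition orbit_leader E : Prop :=
  exists2 n, end_period E n &
    (attracting E /\
     forall k, (k < n)%N ->
       iter k g @` closure (U E) = closure (U (iter k end_map E))) \/
    (repelling E /\
     forall k E', (k < n)%N -> ends T E' -> iter k end_map E' = E ->
       iter k g @^-1` closure (U E) = closure (U E')).

Definition well_chosen : Prop :=
  nesting_system /\
  [/\ forall E E', ends T E -> ends T E' -> E <> E' ->
        closure (U E) `&` closure (U E') = set0,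
      forall E, ends T E -> subgraph G (closure (U E)),
      forall E, ends T E ->
        graph_iso_on G g (closure (U E)) (g @` closure (U E)) /\
        graph_iso_on G g (g @^-1` closure (U E)) (closure (U E)) &
      forall E0, ends T E0 ->
        exists! E, (exists k, E = iter k end_map E0) /\ orbit_leader E].

Definition Gamma_plus : set T :=
  \bigcup_(E in [set E | ends T E /\ attracting E]) U E.

Definition Gamma_minus : set T :=
  \bigcup_(E in [set E | ends T E /\ repelling E]) U E.

(* Presupposed when one speaks of the mapping tori of the restrictions of [g]
   to [Gamma_plus] and of [g^-1] to [Gamma_minus]: these are self-maps. *)
Definition sides_invariant : Prop :=
  g @` Gamma_plus `<=` Gamma_plus /\ g @^-1` Gamma_minus `<=` Gamma_minus.

End EndPeriodic.

Definition end_periodic {R : realType} {T : topologicalType} (G : graph R T)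
    (g : T -> T) : Prop :=
  graph_map G g /\ exists p U, nesting_system G g p U.

(** Compactification of a space [Z] with two partial semiflows, [psip] on [Zp]
    and [psim] on [Zm], by the rays of each. *)

Section RaysAtInfinity.
Context {R : realType} {Z : topologicalType} (S : set Z) (psi : R -> Z -> Z).

Definition ray (z : Z) : set Z := [set psi t z | t in `[0, +oo[].

Definition ray_boundary : Type :=
  {eq_quot (gen_equiv (fun z w : S => ray (val z) `<=` ray (val w)))}.

HB.instance Definition _ := Quotient.on ray_boundary.

Definition ray_class (z : S) : ray_boundary := \pi_ray_boundary z.

End RaysAtInfinity.

Section Compactification.
Context {R : realType} {Z : topologicalType}.
Context (Zp : set Z) (psip : R -> Z -> Z) (Zm : set Z) (psim : R -> Z -> Z).

Inductive compactified : Type :=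
| Inner of Z
| BdPlus of ray_boundary Zp psip
| BdMinus of ray_boundary Zm psim.

HB.instance Definition _ := gen_eqMixin compactified.
HB.instance Definition _ := gen_choiceMixin compactified.

(* [A] contains [psi (N, (t, oo])] for some [t > 0] and some neighborhood
   [N] of [z] in [S]; [bd] includes the rays into the compactification *)
Definition ray_nbhd (S : set Z) (psi : R -> Z -> Z)
    (bd : ray_boundary S psi -> compactified)
    (z : S) (A : set compactified) : Prop :=
  exists2 N, within S (nbhs (val z)) N &
    exists2 t : R, 0 < t &
      forall w : S, N (val w) ->
        A (bd (ray_class psi w)) /\
        forall s, t < s -> A (Inner (psi s (val w))).

Definition compactified_open (A : set compactified) : Prop :=
  [/\ open (Inner @^-1` A),
      forall z : Zp, A (BdPlus (ray_class psip z)) -> ray_nbhd BdPlus z A &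
      forall z : Zm, A (BdMinus (ray_class psim z)) -> ray_nbhd BdMinus z A].

Lemma ray_nbhdT S psi bd z : @ray_nbhd S psi bd z setT.
Proof. by exists setT; [exact: filterT|exists 1]. Qed.

Lemma ray_nbhdI S psi bd z A B :
  @ray_nbhd S psi bd z A -> ray_nbhd bd z B -> ray_nbhd bd z (A `&` B).
Proof.
move=> [N nN [t t0 AN]] [M nM [s s0 BM]].
exists (N `&` M); first exact: filterI.
exists (Num.max t s); first by rewrite lt_max t0.
move=> w [/AN[A1 A2] /BM[B1 B2]]; split; first by split.
by move=> u; rewrite gt_max => /andP[/A2 ? /B2 ?]; split.
Qed.

Lemma ray_nbhdS S psi bd z A B : A `<=` B ->
  @ray_nbhd S psi bd z A -> ray_nbhd bd z B.
Proof.
move=> AB [N nN [t t0 AN]]; exists N => //; exists t => // w /AN[/AB ? A2].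
by split=> // u /A2 /AB.
Qed.

Lemma compactified_openT : compactified_open setT.
Proof.
by split=> [|z _|z _]; [rewrite preimage_setT; exact: openT|exact: ray_nbhdT..].
Qed.

Lemma compactified_openI A B :
  compactified_open A -> compactified_open B -> compactified_open (A `&` B).
Proof.
move=> [oA pA mA] [oB pB mB]; split.
- by rewrite preimage_setI; exact: openI.
- by move=> z [/pA ? /pB ?]; exact: ray_nbhdI.
- by move=> z [/mA ? /mB ?]; exact: ray_nbhdI.
Qed.

Lemma compactified_open_bigU (I : Type) (f : I -> set compactified) :
  (forall i, compactified_open (f i)) -> compactified_open (\bigcup_i f i).
Proof.
move=> of_; split.
- by rewrite preimage_bigcup; apply: bigcup_open => i _; have [] := of_ i.
- move=> z [i _ fi]; have [_ /(_ _ fi) h _] := of_ i.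
  by apply: ray_nbhdS h; exact: bigcup_sup.
- move=> z [i _ fi]; have [_ _ /(_ _ fi) h] := of_ i.
  by apply: ray_nbhdS h; exact: bigcup_sup.
Qed.

HB.instance Definition _ := isOpenTopological.Build compactified
  compactified_openT compactified_openI compactified_open_bigU.

End Compactification.

(** Mapping torus. *)

Definition I01 (R : realType) : Type := (`[0, 1]%classic : set R).

HB.instance Definition _ (R : realType) := Topological.on (I01 R).

Section MappingTorus.
Context (R : realType) {T : topologicalType} (g : T -> T).

Lemma zero01 : (0 : R) \in (`[0, 1]%classic : set R).
Proof. by rewrite inE /= in_itv /= lexx ler01. Qed.

(* the point of [0, 1] with value [x]; only meant for 0 <= x <= 1 *)
Definition to01 (x : R) : I01 R :=
  insubd (exist _ 0 zero01 : (`[0, 1]%classic : set R)) x.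

Definition glue (a b : T * I01 R) : Prop :=
  val a.2 = 1 /\ b = (g a.1, to01 0).

Definition mapping_torus : Type := {eq_quot (gen_equiv glue)}.

HB.instance Definition _ :=
  Topological.copy mapping_torus (quotient_topology mapping_torus).
HB.instance Definition _ := Quotient.on mapping_torus.

Definition fiber0 (x : T) : mapping_torus := \pi_mapping_torus (x, to01 0).

(* For t >= 0 the point (x, y) flows to (g^n x, y + t - n) with n the integral
   part of y + t; this respects the gluing, so the choice of the
   representative is irrelevant. *)
Definition flow (t : R) (z : mapping_torus) : mapping_torus :=
  let a := repr z in
  let s := val a.2 + t in
  \pi_mapping_torus (iter (Num.truncn s) g a.1, to01 (s - (Num.truncn s)%:R)).

Definition forward_orbit (A : set T) : set mapping_torus :=
  [set z | exists2 t : R, 0 <= t & exists2 x, A x & z = flow t (fiber0 x)].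

Definition backward_orbit (A : set T) : set mapping_torus :=
  [set z | exists2 t : R, 0 <= t & exists2 x, A x & flow t z = fiber0 x].

(* The point of [S] that flows to [z] in time [t].  It exists and is unique
   when [S] is the backward orbit of [Gamma_minus] and [z] is in [S]. *)
Definition backward_flow (S : set mapping_torus) (t : R) (z : mapping_torus) :
  mapping_torus := xget z [set w | S w /\ flow t w = z].

End MappingTorus.

Section CompactifiedMappingTorus.
Context (R : realType) {T : topologicalType} (g : T -> T).
Context (p : nat) (U : set (nat -> set T) -> set T).

Definition Z_plus : set (mapping_torus R g) :=
  forward_orbit (Gamma_plus g p U).

Definition Z_minus : set (mapping_torus R g) :=
  backward_orbit (Gamma_minus g p U).

Definition compactified_torus : Type :=
  compactified Z_plus (@flow R T g) Z_minus (backward_flow Z_minus).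

HB.instance Definition _ := Topological.on compactified_torus.

Definition boundary_plus : set compactified_torus := range (@BdPlus _ _ _ _ _ _).

Definition boundary_minus : set compactified_torus :=
  range (@BdMinus _ _ _ _ _ _).

End CompactifiedMappingTorus.

Arguments boundary_plus R {T} g p U _.
Arguments boundary_minus R {T} g p U _.

Definition component {X : topologicalType} (A S : set X) : Prop :=
  exists2 x, A x & S = connected_component A x.

(** Injectivity on fundamental groups of a map defined on a subset [A], at
    every base point in [A]. *)

Section Pi1.
Context (R : realType) {X : topologicalType}.

Definition loop_in (A : set X) (x : X) (a : R -> X) : Prop :=
  [/\ {within `[0, 1], continuous a}, {in `[0, 1], forall t, A (a t)},
      a 0 = x & a 1 = x].

(* homotopy of paths relative to their end points, inside [A] *)
Definition path_homotopic_in (A : set X) (a b : R -> X) : Prop :=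
  exists H : R * R -> X,
    [/\ {within `[0, 1] `*` `[0, 1], continuous H},
        {in `[0, 1] &, forall s t, A (H (s, t))},
        {in `[0, 1], forall t, H (0, t) = a t /\ H (1, t) = b t} &
        {in `[0, 1], forall s, H (s, 0) = a 0 /\ H (s, 1) = a 1}].

End Pi1.

Definition pi1_injective_on (R : realType) {X Y : topologicalType}
    (A : set X) (f : X -> Y) : Prop :=
  forall x (a b : R -> X), A x -> loop_in A x a -> loop_in A x b ->
    path_homotopic_in setT (f \o a) (f \o b) -> path_homotopic_in A a b.

(* Main.v *)
From HB Require Import structures.
Require Import Defs.
From Stdlib Require Import Relations.
From mathcomp Require Import all_boot all_order all_algebra generic_quotient.
From mathcomp Require Import all_classical all_reals topology.
From mathcomp Require Import normedtype.
From mathcomp Require Import lra zify.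

Set Implicit Arguments.
Unset Strict Implicit.
Unset Printing Implicit Defensive.

Import Order.TTheory GRing.Theory Num.Theory.
Import numFieldNormedType.Exports.

Local Open Scope classical_set_scope.
Local Open Scope ring_scope.

(** A loop in the boundary can be pushed along the flow into the graph, and a
    homotopy between two such loops can be pushed into the graph as well, but
    only after it has been lifted to the infinite cyclic cover of the
    compactified torus, since distinct points of a flow line have to be told
    apart.  Over the boundary, flow lines near the ends of the graph are
    embedded, so that the cover makes sense at infinity too.

    The cover is described by charts: local sections of it ([chart]), together
    with the point at which the lifted flow line crosses level 0.  Charts exist
    everywhere ([chart_exists]), at infinity because points near the ends wander
    ([end_wandering]), and they are compatible ([chart_compat]).  Hence a
    homotopy, that is a map from a square, lifts ([lifts_ex]), and flowing
    forward to a high level turns the lift into a map from the square to the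
    graph ([lift_position]).

    For the positive boundary the outcome is a homotopy in the graph between
    two paths that lie near an attracting end and lift the given loops.  The
    closure of a nesting neighborhood is a connected subgraph, onto which the
    graph retracts ([connected_subgraph_retract]), and a power of the map moves
    this closure into the neighborhood ([end_absorbs]).  The homotopy can thus
    be moved near the end ([end_push]), where it projects to the boundary
    ([plus_injective]).

    For the negative boundary the two paths near the repelling end exist only at
    a low level, and the homotopy in the graph is between their images under a
    power of the map.  Here injectivity on fundamental groups is used
    ([pi1_injective_iter]): the paths themselves are homotopic in the graph, and
    the argument ends as before, with the inverse map in place of the map
    ([minus_injective]). *)

(** * Continuity on subsets, and the topology of graphs *)

Lemma within_near {X Y : topologicalType} (A : set X) (f : X -> Y) :
  {within A, continuous f} ->
  forall x, A x -> forall B, nbhs (f x) B -> \forall y \near x, A y -> B (f y).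
Proof. by rewrite subspace_continuousP. Qed.

Lemma near_within {X Y : topologicalType} (A : set X) (f : X -> Y) :
  (forall x, A x -> forall B, nbhs (f x) B -> \forall y \near x, A y -> B (f y))
  -> {within A, continuous f}.
Proof. by rewrite subspace_continuousP. Qed.

Lemma within_comp {X Y Z : topologicalType} (A : set X) (B : set Y)
    (f : X -> Y) (h : Y -> Z) :
  {within A, continuous f} -> {within B, continuous h} ->
  (forall x, A x -> B (f x)) -> {within A, continuous (h \o f)}.
Proof.
move=> cf ch AB; apply: near_within => x Ax C nC.
have := within_near cf Ax (within_near ch (AB _ Ax) nC).
by apply: filterS => y hy Ay; apply: hy => //; exact: AB.
Qed.

Lemma within_eq {X Y : topologicalType} (A : set X) (f h : X -> Y) :
  (forall x, A x -> f x = h x) -> {within A, continuous f} ->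
  {within A, continuous h}.
Proof.
move=> fh cf; apply: near_within => x Ax B; rewrite -fh// => nB.
by have := within_near cf Ax nB; apply: filterS => y hy Ay; rewrite -fh//;
  exact: hy.
Qed.

Lemma max_cont {R : realType} {X : topologicalType} (f h : X -> R) :
  continuous f -> continuous h -> continuous (fun t => Num.max (f t) (h t)).
Proof. by move=> cf ch x; apply: (@continuous_max R X f h x);
  [exact: cf|exact: ch]. Qed.

Section GraphTopology.
Context {R : realType} {T : topologicalType} (G : graph R T).

(** The weak topology makes continuity a condition on each closed edge
    separately, so that maps can be prescribed cell by cell. *)
Lemma graph_glue {Y : topologicalType} (f0 : T -> Y) (F : edge G -> R -> Y) :
  (forall e, {within `[0, 1], continuous (F e)}) ->
  (forall e, F e 0 = f0 (chi e 0) /\ F e 1 = f0 (chi e 1)) ->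
  exists f : T -> Y, [/\ continuous f,
    (forall e (s : R), s \in `[0, 1] -> f (chi e s) = F e s) &
    forall v, vertex G v -> f v = f0 v].
Proof.
move=> Fc Fe.
pose Q x := exists es : edge G * R, (es.2 \in `]0, 1[) /\ chi es.1 es.2 = x.
pose f x := if pselect (Q x) is left h
            then let es := projT1 (cid h) in F es.1 es.2 else f0 x.
have fv v : vertex G v -> f v = f0 v.
  move=> vv; rewrite /f; case: pselect => // -[[e s] /= [s01 es]].
  by exfalso; apply: (chi_interior s01 (e := e)); rewrite es.
have fe e (s : R) : s \in `[0, 1] -> f (chi e s) = F e s.
  rewrite in_itv /= => /andP[s0 s1].
  have [->|sn0] := eqVneq s 0.
    by rewrite fv ?(Fe e).1//; exact: (chi_ends e).1.
  have [->|sn1] := eqVneq s 1.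
    by rewrite fv ?(Fe e).2//; exact: (chi_ends e).2.
  have s01 : s \in `]0, 1[ by rewrite in_itv /= !lt_neqAle s0 s1 sn1 eq_sym sn0.
  rewrite /f; case: pselect => [h|]; last by case; exists (e, s).
  case: cid => -[e' s'] /= [s'01 es'].
  by have [-> ->] := chi_inj s'01 s01 es'.
exists f; split => //; apply/continuous_closedP => A cA.
apply: graph_weak => e.
have -> : `[0, 1] `&` chi e @^-1` (f @^-1` A) = `[0, 1] `&` F e @^-1` A.
  by apply/seteqP; split => s [s01] /=; rewrite fe.
have c01 : closed (`[0, 1] : set R) by exact: interval_closed.
rewrite (closed_setSI (F e @^-1` A : set (subspace `[0, 1])) c01).
by have /continuous_closedP := Fc e; apply.
Qed.

(** Two points are separated by a real function built cell by cell: a tent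
    inside an open edge that contains one of them or, between two vertices
    or a vertex and a point of an edge, a tent around the vertex. *)
Lemma graph_hausdorff : hausdorff_space T.
Proof.
suff sep x y : x <> y -> exists2 f : T -> R, continuous f & f x != f y.
  move=> x y cxy; apply: contrapT => /sep[f cf fxy].
  have /eqP := fxy; apply; apply: (@Rhausdorff R) => A B /cf nA /cf nB.
  by have [z [Az Bz]] := cxy _ _ nA nB; exists (f z).
move=> xy; have [vx|[e [s s01 ex]]] := graph_cover G x; last first.
- pose d t := `|t - s|.
  have [m m0 mP] : exists2 m : R, 0 < m &
     [/\ m <= s, m <= 1 - s & forall t, t \in `]0, 1[ -> chi e t = y ->
       m <= d t].
    move: s01; rewrite in_itv /= => /andP[s0 s1].
    have [[t [t01 ty]]|n] := pselect (exists t, (t \in `]0, 1[) /\ chi e t = y).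
      exists (Num.min s (Num.min (1 - s) (d t))).
        rewrite !lt_min s0 subr_gt0 s1 normr_gt0 subr_eq0 /=.
        by apply: contra_notN xy => /eqP ts; rewrite -ex -ty ts.
      split; rewrite ?ge_min ?lexx ?orbT// => t' t'01 t'y.
      have [_ ->] : e = e /\ t' = t by apply: chi_inj => //; rewrite t'y.
      by rewrite !ge_min lexx !orbT.
    exists (Num.min s (1 - s)); first by rewrite lt_min s0 subr_gt0.
    by split; rewrite ?ge_min ?lexx ?orbT// => t t01 ty; case: n; exists t.
  case: mP => ms m1s mP.
  pose F (e' : edge G) : R -> R :=
    if `[< e' = e >] then fun t => Num.max 0 (m - d t) else fun=> 0.
  have Fc e' : {within `[0, 1], continuous (F e')}.
    apply: continuous_subspaceT; rewrite /F; case: asboolP => _; last first.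
      by move=> t; exact: cvg_cst.
    apply: max_cont => t; first exact: cvg_cst.
    apply: cvgB; first exact: cvg_cst.
    by apply: cvg_norm; apply: cvgB; [exact: cvg_id|exact: cvg_cst].
  move: (s01); rewrite in_itv /= => /andP[s0 s1].
  have [|f [cf fe fv]] := @graph_glue R (fun=> 0) F Fc.
    move=> e'; rewrite /F; case: asboolP => // _; rewrite /d; split;
      apply/max_idPl.
      by rewrite sub0r normrN (ger0_norm (ltW s0)) subr_le0.
    by rewrite ger0_norm ?subr_ge0 ?(ltW s1)// subr_le0.
  exists f => //; rewrite -ex fe; last first.
    by rewrite in_itv /= !ltW.
  have -> : F e s = m.
    rewrite /F; case: asboolP => // _; rewrite /d subrr normr0 subr0.
    by apply/max_idPr; exact: ltW.
  suff -> : f y = 0 by rewrite gt_eqF.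
  have [vy|[e' [t t01 ty]]] := graph_cover G y; first by rewrite fv.
  rewrite -ty fe /F; last first.
    by move: t01; rewrite !in_itv /= => /andP[? ?]; rewrite !ltW.
  case: asboolP => // e'e; apply/max_idPl; rewrite subr_le0; apply: mP => //.
  by rewrite -e'e.
- pose f0 (z : T) : R := if `[< z = x >] then 1 else 0.
  have f001 z : 0 <= f0 z <= 1.
    by rewrite /f0; case: asboolP => _; rewrite ?lexx ?ler01.
  (* the tent of height 1 at [x]: on an edge it decreases to 0 from each end
     that is [x], within the half of the edge next to this end *)
  pose F (e : edge G) (t : R) :=
    Num.max (f0 (chi e 0) * (1 - 2 * t))
      (Num.max 0 (f0 (chi e 1) * (2 * t - 1))).
  have Fc e : {within `[0, 1], continuous (F e)}.
    apply: continuous_subspaceT; rewrite /F.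
    apply: max_cont; last apply: max_cont; first last.
    + move=> t; apply: cvgM; first exact: cvg_cst.
      by apply: cvgB; [apply: cvgM; [exact: cvg_cst|exact: cvg_id]|exact:
        cvg_cst].
    + by move=> t; exact: cvg_cst.
    + move=> t; apply: cvgM; first exact: cvg_cst.
      by apply: cvgB; [exact: cvg_cst|apply: cvgM; [exact: cvg_cst|exact:
        cvg_id]].
  have [|f [cf fe fv]] := @graph_glue R f0 F Fc.
    move=> e; rewrite /F; have /andP[a0 a1] := f001 (chi e 0).
    have /andP[b0 b1] := f001 (chi e 1); split.
      rewrite mulr0 subr0 mulr1 sub0r mulrN1 [Num.max 0 _](_ : _ = 0).
        exact/max_idPl.
      by apply/max_idPl; rewrite oppr_le0.
    have -> : (1 - 2 * 1 : R) = -1 by lra.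
    have -> : (2 * 1 - 1 : R) = 1 by lra.
    rewrite mulr1 mulrN1 [Num.max 0 _](_ : _ = f0 (chi e 1));
      last exact/max_idPr.
    by apply/max_idPr; lra.
  exists f => //; rewrite fv// {1}/f0 asboolT//.
  have [vy|[e [t t01 ty]]] := graph_cover G y.
    by rewrite fv// /f0 asboolF ?oner_neq0// => /esym.
  rewrite -ty fe; last first.
    by move: t01; rewrite !in_itv /= => /andP[? ?]; rewrite !ltW.
  rewrite gt_eqF// /F !gt_max ltr01 /=.
  move: t01; rewrite in_itv /= => /andP[t0 t1].
  have /andP[a0 a1] := f001 (chi e 0).
  have /andP[b0 b1] := f001 (chi e 1).
  apply/andP; split; nra.
Qed.

(** Graphs are locally connected: whether a set is open is tested on edges,
    and a point of an edge has small intervals as neighborhoods. *)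
Lemma graph_component_open (A : set T) x :
  open A -> open (connected_component A x).
Proof.
move=> oA; rewrite -[X in open X]setCK; apply: closed_openC.
apply: graph_weak => e s0 clS.
have c01 : closed (`[0, 1] : set R) by exact: interval_closed.
have s01 : (`[0, 1]%classic : set R) s0 by apply: c01 => B /clS[s [[]]];
  exists s.
split => //= Cs0; have As0 := connected_component_sub Cs0.
have := within_near (@chi_continuous _ _ G e) s01
  (open_nbhs_nbhs (conj oA As0)).
move=> /nbhs_ballP[d d0 dA].
have [s [[s01' /= nC] ds]] := clS _ (nbhsx_ballx s0 d d0).
apply: nC; apply: connected_component_trans Cs0 _.
pose J : set R := `[Num.min s0 s, Num.max s0 s]%classic.
have J01 : J `<=` (`[0, 1]%classic : set R).
  move=> u; rewrite /J /= !in_itv /= ge_min le_max.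
  by move: s01 s01'; rewrite /= !in_itv /= => /andP[? ?] /andP[? ?]; lra.
have Jd : J `<=` ball s0 d.
  move=> u; move: ds; rewrite /J /ball /= in_itv /= ge_min le_max !ltr_distlC.
  lra.
exists (chi e @` J); last first.
  by exists s => //; rewrite /J /= in_itv /= ge_min le_max lexx !orbT.
split.
- by exists s0 => //; rewrite /J /= in_itv /= ge_min le_max lexx.
- by move=> _ [u Ju <-]; apply: dA; [exact: Jd|exact: J01].
- apply: connected_continuous_connected; first exact: segment_connected.
  exact: continuous_subspaceW J01 (@chi_continuous _ _ G e).
Qed.

End GraphTopology.

(** * Paths, and retractions of graphs onto subgraphs *)

(** Pasting of two maps along the locus [u = 1/2], for concatenations of paths
    and of homotopies in either variable. *)
Lemma glue_half {R : realType} {X Y : topologicalType} (S : set X) (u : X ->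
  R) (f1 f2 : X -> Y) :
  closed S -> continuous u ->
  {within S `&` [set x | u x <= 1 / 2], continuous f1} ->
  {within S `&` [set x | 1 / 2 <= u x], continuous f2} ->
  (forall x, S x -> u x = 1 / 2 -> f1 x = f2 x) ->
  {within S, continuous (fun x => if u x <= 1 / 2 then f1 x else f2 x)}.
Proof.
move=> cS cu c1 c2 e12.
have -> : S = (S `&` [set x | u x <= 1 / 2]) `|` (S `&` [set x | 1 / 2 <= u x]).
  rewrite -setIUr; apply/esym/setIidPl => x _ /=.
  by have [ux|/ltW ux] := leP (u x) (1 / 2); [left|right].
apply: withinU_continuous.
- apply: closedI => //; have /continuous_closedP := cu.
  by move=> /(_ [set t | t <= 1 / 2]); apply; exact: closed_le.
- apply: closedI => //; have /continuous_closedP := cu.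
  by move=> /(_ [set t | 1 / 2 <= t]); apply; exact: closed_ge.
- by apply: within_eq c1 => x [_ /= ->].
- apply: within_eq c2 => x [Sx /= ux]; case: ifP => // ux'.
  by apply/esym/e12 => //; apply/eqP; rewrite eq_le ux ux'.
Qed.

Section Paths.
Context {R : realType} {X : topologicalType}.

Lemma itv01 (t : R) : (`[0, 1]%classic : set R) t <-> 0 <= t <= 1.
Proof. by rewrite /= in_itv /=. Qed.

Definition joined (C : set X) (x y : X) : Prop := exists a : R -> X,
  [/\ {within `[0, 1], continuous a}, forall t, 0 <= t <= 1 -> C (a t),
      a 0 = x & a 1 = y].

Definition path_cat (a b : R -> X) : R -> X :=
  fun t => if t <= 1 / 2 then a (2 * t) else b (2 * t - 1).

Lemma affine_cont (p q : R) : continuous (fun t : R => p * t + q).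
Proof.
move=> t; apply: cvgD; last exact: cvg_cst.
by apply: cvgM; [exact: cvg_cst|exact: cvg_id].
Qed.

Lemma path_affine (a : R -> X) (p q : R) (S : set R) :
  {within `[0, 1], continuous a} ->
  (forall t, S t -> 0 <= p * t + q <= 1) ->
  {within S, continuous (fun t => a (p * t + q))}.
Proof.
move=> ca Spq.
have : {within S, continuous (a \o (fun t : R => p * t + q))}; last by [].
refine (@within_comp _ _ _ S (`[0, 1]%classic : set R) (fun t : R => p * t + q)
  a _ ca _).
- by apply: continuous_subspaceT; exact: affine_cont.
- by move=> t /Spq pq; apply/itv01.
Qed.

Lemma closed01 : closed (`[0, 1]%classic : set R).
Proof. exact: interval_closed. Qed.

Lemma path_cat_cont (a b : R -> X) :
  {within `[0, 1], continuous a} -> {within `[0, 1], continuous b} ->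
  a 1 = b 0 -> {within `[0, 1], continuous (path_cat a b)}.
Proof.
move=> ca cb ab; rewrite /path_cat.
refine (@glue_half R R X _ (fun t : R => t) (fun t => a (2 * t))
  (fun t => b (2 * t - 1)) closed01 _ _ _ _) => [t|||t /itv01 t01 ->].
- exact: cvg_id.
- have -> : (fun t => a (2 * t)) = (fun t => a (2 * t + 0)).
    by apply/funext => t; rewrite addr0.
  by apply: path_affine => // t [/itv01/andP[t0 t1] /= t2]; lra.
- by apply: path_affine => // t [/itv01/andP[t0 t1] /= t2]; lra.
- have -> : (2 * (1 / 2) : R) = 1 by lra.
  by rewrite subrr.
Qed.

Lemma path_cat0 a b : path_cat a b 0 = a 0.
Proof. by rewrite /path_cat mulr0 ifT//; lra. Qed.

Lemma path_cat1 a b : path_cat a b 1 = b 1.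
Proof.
rewrite /path_cat ifF; first by congr b; lra.
by apply/negbTE; rewrite -ltNge; lra.
Qed.

Lemma joined_refl (C : set X) x : C x -> joined C x x.
Proof.
by move=> Cx; exists (fun=> x); split => //; apply: continuous_subspaceT => t;
  exact: cvg_cst.
Qed.

Lemma joined_sym (C : set X) x y : joined C x y -> joined C y x.
Proof.
move=> [a [ca Ca a0 a1]]; exists (fun t => a (-1 * t + 1)); split.
- by apply: path_affine => // t /itv01/andP[t0 t1]; lra.
- by move=> t t01; apply: Ca; lra.
- by rewrite mulr0 add0r.
- by rewrite mulr1 addNr.
Qed.

Lemma joined_trans (C : set X) y x z : joined C x y -> joined C y z ->
  joined C x z.
Proof.
move=> [a [ca Ca a0 a1]] [b [cb Cb b0 b1]]; exists (path_cat a b); split.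
- by apply: path_cat_cont => //; rewrite a1 b0.
- move=> t t01; rewrite /path_cat; case: leP => t2; first by apply: Ca; lra.
  by apply: Cb; lra.
- by rewrite path_cat0.
- by rewrite path_cat1.
Qed.

Lemma joined_sub (a : R -> X) (C : set X) (s t : R) :
  {within `[0, 1], continuous a} ->
  (forall u, 0 <= u <= 1 -> C (a u)) -> 0 <= s <= 1 -> 0 <= t <= 1 ->
  joined C (a s) (a t).
Proof.
move=> ca Ca s01 t01; exists (fun u => a ((t - s) * u + s)).
have sub u : 0 <= u <= 1 -> 0 <= (t - s) * u + s <= 1.
  by move=> /andP[u0 u1]; move: s01 t01 => /andP[s0 s1] /andP[t0 t1];
    apply/andP; split; nra.
split.
- by apply: path_affine => // u /itv01; exact: sub.
- by move=> u /sub; exact: Ca.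
- by rewrite mulr0 add0r.
- by rewrite mulr1 subrK.
Qed.

End Paths.

Section Retraction.
Context {R : realType} {T : topologicalType} (G : graph R T).

(** Sets of end points of an edge are finite, hence closed in the edge. *)
Lemma graph_closed_cells (A : set T) :
  (forall e, (forall s : R, 0 <= s <= 1 -> A (chi e s)) \/
             (forall s : R, 0 < s < 1 -> ~ A (chi (g := G) e s))) -> closed A.
Proof.
move=> H; apply: (graph_weak (g := G)) => e; have [eA|eA] := H e.
  rewrite (_ : _ `&` _ = `[0, 1]%classic); first exact: interval_closed.
  by apply/seteqP; split => [s []//|s s01]; split => //=; apply: eA;
    apply/itv01.
apply: (accessible_finite_set_closed (T := R)).1.
  by apply: hausdorff_accessible; exact: Rhausdorff.
apply: (@sub_finite_set _ _ [set 0; 1]); last exact: finite_set2.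
move=> s [/itv01/andP[s0 s1] /= As].
have [->|sn0] := eqVneq s 0; first by left.
have [->|sn1] := eqVneq s 1; first by right.
by case: (eA s) => //; rewrite !lt_neqAle s0 s1 sn1 eq_sym sn0.
Qed.

Lemma subgraph_edge (C : set T) e : subgraph G C ->
  (forall s : R, 0 <= s <= 1 -> C (chi e s)) \/
  (forall s : R, 0 < s < 1 -> ~ C (chi (g := G) e s)).
Proof.
move=> [cC /(_ e)[eC|eC]]; last first.
  right=> s s01 Cs; have : (open_edge e `&` C) (chi e s).
    by split => //; exists s => //=; rewrite in_itv.
  by rewrite eC.
left=> s0 s001; apply: cC => B /(within_near (@chi_continuous _ _ G e) (x :=
  s0)).
have s001' : (`[0, 1]%classic : set R) s0 by apply/itv01.
move=> /(_ s001')/nbhs_ballP[d /= d0 dB].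
pose m := Num.min (d / 2) (1 / 2).
have m0 : 0 < m by rewrite lt_min divr_gt0//=; lra.
have md : m < d by rewrite gt_min; apply/orP; left; lra.
have m1 : m <= 1 / 2 by rewrite ge_min lexx orbT.
pose s := if s0 <= 1 / 2 then s0 + m / 2 else s0 - m / 2.
have [s01 ds] : 0 < s < 1 /\ `|s0 - s| < d.
  by rewrite /s ltr_distlC; case: ifP; move: s001; lra.
exists (chi e s); split; first by apply: eC; exists s => //=; rewrite in_itv.
by apply: dB => //; apply/itv01; move: s01; lra.
Qed.

(** The points of [C] that are joined to [x] form a union of closed cells, and
    so do those that are not: both sets are closed, and one of them is [C]. *)
Lemma connected_subgraph_joined (C : set T) x y : subgraph G C -> connected C ->
  C x -> C y -> joined (R := R) C x y.
Proof.
move=> sC cC Cx Cy.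
suff E : C = [set y | C y /\ joined (R := R) C x y].
  by have := Cy; rewrite {1}E; case.
(* [P] is True or False, for the points joined to [x] and for the others *)
have cells (P : Prop) : let A := [set y | C y /\ (joined (R := R) C x y <-> P)]
  in
    closed A.
  move=> A; apply: graph_closed_cells => e.
  have [eC|eC] := subgraph_edge e sC; last first.
    by right=> s /eC nC [/nC].
  have [[s s01 As]|nA] := pselect (exists2 s : R, 0 <= s <= 1 & A (chi e s)).
    left=> t t01; split; first exact: eC.
    have st : joined (R := R) C (chi e s) (chi e t).
      exact: (joined_sub (@chi_continuous _ _ G e) eC s01 t01).
    by case: As => _ <-; split => h; [apply: joined_trans h (joined_sym st)|
                                      apply: joined_trans h st].
  right=> s s01 As; apply: nA; exists s => //; move: s01; lra.
apply/esym/cC.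
- by exists x; split => //; exact: joined_refl.
- exists (~` [set y | C y /\ (joined (R := R) C x y <-> False)]).
    by apply: closed_openC; exact: cells.
  apply/seteqP; split => [z [Cz jz]|z [Cz nz]].
    by split => // -[_ [+ _]]; apply.
  split => //; apply: contrapT => nj; apply: nz; split => //.
- exists [set y | C y /\ (joined (R := R) C x y <-> True)]; first exact: cells.
  by apply/seteqP; split => [z [Cz jz]|z [Cz [_ [_ /(_ I)]]]].
Qed.

(** Everything outside a connected subgraph can be pushed into it: vertices to
    a base vertex, and edges to paths of the subgraph between the images of
    their ends. *)
Lemma connected_subgraph_retract (C : set T) : subgraph G C -> connected C ->
  C !=set0 -> exists r : T -> T,
    [/\ continuous r, forall x, C (r x) & forall x, C x -> r x = x].
Proof.
move=> sC cC [v0 Cv0].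
pose f0 (x : T) := if `[< C x >] then x else v0.
have Cf0 x : C (f0 x) by rewrite /f0; case: asboolP.
have Fex e : exists a : R -> T, [/\ {within `[0, 1], continuous a},
    forall t, 0 <= t <= 1 -> C (a t), a 0 = f0 (chi e 0), a 1 = f0 (chi e 1) &
    (forall t, 0 < t < 1 -> C (chi (g := G) e t)) -> a = chi e].
  have [eC|eC] := subgraph_edge e sC.
    exists (chi e); split => //; first exact: chi_continuous.
    - by rewrite /f0 asboolT//; apply: eC; rewrite lexx ler01.
    - by rewrite /f0 asboolT//; apply: eC; rewrite lexx ler01.
  have [a [ca Ca a0 a1]] := connected_subgraph_joined sC cC (Cf0 (chi e 0))
    (Cf0 (chi e 1)).
  have h : 0 < (1 / 2 : R) < 1 by lra.
  by exists a; split => // /(_ _ h) /eC; case.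
pose F e := projT1 (cid (Fex e)).
have FP e := projT2 (cid (Fex e)).
have [||r [cr re rv]] := @graph_glue R T G T f0 F.
- by move=> e; case: (FP e).
- by move=> e; case: (FP e).
have cov x : vertex G x \/ exists e, exists2 s : R, 0 < s < 1 & chi (g := G) e s
  = x.
  have [|[e [s s01 <-]]] := graph_cover G x; [by left|right].
  by exists e, s => //; move: s01; rewrite in_itv.
have r01 (s : R) : 0 < s < 1 -> s \in `[0, 1] by rewrite in_itv /=; lra.
exists r; split => // x.
- have [vx|[e [s s01 <-]]] := cov x; first by rewrite rv.
  by rewrite re ?r01//; have [_ + _ _ _] := FP e; apply; lra.
- have [vx|[e [s s01 <-]]] := cov x; first by move=> Cx;
  rewrite rv// /f0 asboolT.
  move=> Ces; rewrite re ?r01//; have [_ _ _ _ FE] := FP e.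
  rewrite /F FE// => t t01; have [eC|/(_ _ s01)//] := subgraph_edge e sC.
  by apply: eC; lra.
Qed.

End Retraction.

(** * Homotopies of paths *)

Section Homotopies.
Context {R : realType}.

Local Notation I2 := (`[0, 1]%classic `*` `[0, 1]%classic : set (R * R)).

Lemma sq01 (v : R * R) : I2 v <-> 0 <= v.1 <= 1 /\ 0 <= v.2 <= 1.
Proof. by split=> -[/itv01 ? /itv01 ?]. Qed.

Context {X : topologicalType}.
Implicit Types (A : set X) (a b c : R -> X).

Lemma fst_cont : continuous (fst : R * R -> R).
Proof. by move=> v; exact: cvg_fst. Qed.

Lemma snd_cont : continuous (snd : R * R -> R).
Proof. by move=> v; exact: cvg_snd. Qed.

Lemma closed_sq : closed I2.
Proof.
apply: closedI.
  exact: (closed_comp (fun x _ => @fst_cont x) closed01).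
exact: (closed_comp (fun x _ => @snd_cont x) closed01).
Qed.

Lemma sq_comp {Y : topologicalType} (S : set Y) (H : R * R -> X) (u1 u2 : Y ->
  R) :
  {within I2, continuous H} -> continuous u1 -> continuous u2 ->
  (forall x, S x -> 0 <= u1 x <= 1 /\ 0 <= u2 x <= 1) ->
  {within S, continuous (fun x => H (u1 x, u2 x))}.
Proof.
move=> cH c1 c2 u01.
have : {within S, continuous (H \o (fun x => (u1 x, u2 x)))}; last by [].
refine (@within_comp _ _ _ S I2 (fun x => (u1 x, u2 x)) H _ cH _).
- apply: continuous_subspaceT => x.
  by apply: (@cvg_pair _ _ _ _ (nbhs (u1 x)) (nbhs (u2 x)));
    [exact: c1|exact: c2].
- by move=> x /u01 ?; apply/sq01.
Qed.

Lemma itv_comp {Y : topologicalType} (S : set Y) a (u : Y -> R) :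
  {within `[0, 1], continuous a} -> continuous u ->
  (forall x, S x -> 0 <= u x <= 1) ->
  {within S, continuous (fun x => a (u x))}.
Proof.
move=> ca cu u01.
have : {within S, continuous (a \o u)}; last by [].
refine (@within_comp _ _ _ S (`[0, 1]%classic : set R) u a _ ca _).
- exact: continuous_subspaceT.
- by move=> x /u01 ?; apply/itv01.
Qed.

Lemma affine_comp {Y : topologicalType} (u : Y -> R) (p q : R) :
  continuous u -> continuous (fun y => p * u y + q).
Proof.
move=> cu; have : continuous ((fun t : R => p * t + q) \o u); last by [].
by move=> y; apply: continuous_comp; [exact: cu|exact: affine_cont].
Qed.

Lemma mem01 (P : R -> Prop) :
  {in `[0, 1], forall t, P t} <-> (forall t, 0 <= t <= 1 -> P t).
Proof.
split=> h t; first by move=> t01; apply: h; rewrite in_itv.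
by rewrite in_itv /=; exact: h.
Qed.

Lemma homotopicP A a b : path_homotopic_in A a b <->
  exists H : R * R -> X, [/\ {within I2, continuous H},
    forall s t, 0 <= s <= 1 -> 0 <= t <= 1 -> A (H (s, t)),
    forall t, 0 <= t <= 1 -> H (0, t) = a t /\ H (1, t) = b t &
    forall s, 0 <= s <= 1 -> H (s, 0) = a 0 /\ H (s, 1) = a 1].
Proof.
split=> -[H [cH AH Hab Hs]]; exists H; split => //.
Qed.

Let z01 : 0 <= (0 : R) <= 1. Proof. by rewrite lexx ler01. Qed.
Let o01 : 0 <= (1 : R) <= 1. Proof. by rewrite lexx ler01. Qed.

Lemma homotopic_ext A a b a' b' : path_homotopic_in A a b ->
  (forall t, 0 <= t <= 1 -> a t = a' t) -> (forall t, 0 <= t <= 1 -> b t = b' t)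
    ->
  path_homotopic_in A a' b'.
Proof.
move=> /homotopicP[H [cH AH Hab Hs]] aa' bb'; apply/homotopicP; exists H;
  split => //.
- by move=> t t01; rewrite -aa'// -bb'//; exact: Hab.
- by move=> s s01; rewrite -!aa'//; exact: Hs.
Qed.

Lemma homotopic_sym A a b : path_homotopic_in A a b -> path_homotopic_in A b a.
Proof.
move=> /homotopicP[H [cH AH Hab Hs]]; apply/homotopicP.
exists (fun v => H (-1 * v.1 + 1, v.2)); split => /=.
- apply: sq_comp => //; [apply: affine_comp; exact: fst_cont|exact: snd_cont|].
  by move=> v /sq01[? ?]; lra.
- by move=> s t s01 t01; apply: AH => //; lra.
- move=> t t01; rewrite mulr0 add0r mulr1 addNr.
  by have [? ?] := Hab t t01.
- move=> s s01; have s'01 : 0 <= -1 * s + 1 <= 1 by lra.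
  have [-> ->] := Hs _ s'01.
  by have [<- <-] := Hab 0 z01; have [<- <-] := Hab 1 o01;
     have [-> ->] := Hs 0 z01; have [-> ->] := Hs 1 o01.
Qed.

Lemma homotopic_trans A b a c : path_homotopic_in A a b ->
  path_homotopic_in A b c ->
  path_homotopic_in A a c.
Proof.
move=> /homotopicP[H [cH AH Hab Hs]] /homotopicP[K [cK AK Kbc Ks]].
have ab0 : b 0 = a 0.
  by have [_ <-] := Hab 0 z01; have [-> _] := Hs 1 o01.
have ab1 : b 1 = a 1.
  by have [_ <-] := Hab 1 o01; have [_ ->] := Hs 1 o01.
apply/homotopicP.
exists (fun v => if v.1 <= 1 / 2 then H (2 * v.1 + 0, v.2) else K (2 * v.1 + -1,
  v.2)).
split => /=.
- refine (@glue_half R _ X _ fst (fun v => H (2 * v.1 + 0, v.2))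
     (fun v => K (2 * v.1 + -1, v.2)) closed_sq fst_cont _ _ _).
  + apply: sq_comp => //; [apply: affine_comp; exact: fst_cont|exact:
    snd_cont|].
    by move=> v [/sq01[? ?] /= ?]; lra.
  + apply: sq_comp => //; [apply: affine_comp; exact: fst_cont|exact:
    snd_cont|].
    by move=> v [/sq01[? ?] /= ?]; lra.
  + move=> v /sq01[_ v2] ->.
    have -> : 2 * (1 / 2) + 0 = 1 :> R by lra.
    have -> : 2 * (1 / 2) + -1 = 0 :> R by lra.
    by have [_ ->] := Hab _ v2; have [-> _] := Kbc _ v2.
- move=> s t s01 t01; case: leP => h; first by apply: AH => //; lra.
  by apply: AK => //; lra.
- move=> t t01; rewrite ifT; last lra.
  rewrite ifF; last by apply/negbTE; rewrite -ltNge; lra.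
  have -> : 2 * 0 + 0 = 0 :> R by lra.
  have -> : 2 * 1 + -1 = 1 :> R by lra.
  by have [? _] := Hab _ t01; have [_ ?] := Kbc _ t01.
- move=> s s01; case: leP => h.
    by apply: Hs; lra.
  by rewrite -ab0 -ab1; apply: Ks; lra.
Qed.

Lemma homotopic_reparam A a (u0 u1 : R -> R) :
  {within `[0, 1], continuous a} -> (forall t, 0 <= t <= 1 -> A (a t)) ->
  continuous u0 -> continuous u1 ->
  (forall t, 0 <= t <= 1 -> 0 <= u0 t <= 1 /\ 0 <= u1 t <= 1) ->
  u0 0 = u1 0 -> u0 1 = u1 1 ->
  path_homotopic_in A (fun t => a (u0 t)) (fun t => a (u1 t)).
Proof.
move=> ca Aa c0 c1 u01 e0 e1; apply/homotopicP.
exists (fun v => a (u0 v.2 + v.1 * (u1 v.2 - u0 v.2))).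
have sub s t : 0 <= s <= 1 -> 0 <= t <= 1 -> 0 <= u0 t + s * (u1 t - u0 t) <= 1.
  move=> /andP[s0 s1] /u01[/andP[? ?] /andP[? ?]]; apply/andP; split; nra.
split => /=.
- apply: itv_comp => //; last by move=> v /sq01[? ?]; exact: sub.
  have c (u : R -> R) : continuous u -> continuous (fun v : R * R => u v.2).
    move=> cu v; have := @continuous_comp _ _ _ (snd : R * R -> R) u v.
    by apply; [exact: snd_cont|exact: cu].
  move=> v; apply: cvgD; first exact: (c _ c0).
  apply: cvgM; first exact: fst_cont.
  by apply: cvgB; [exact: (c _ c1)|exact: (c _ c0)].
- by move=> s t s01 t01; apply: Aa; exact: sub.
- by move=> t t01; rewrite mul0r addr0 mul1r addrC subrK.
- by move=> s s01; rewrite e0 e1 !subrr mulr0 !addr0.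
Qed.

Lemma homotopic_cat A a b c : path_homotopic_in A a b ->
  {within `[0, 1], continuous c} -> (forall t, 0 <= t <= 1 -> A (c t)) ->
  a 1 = c 0 -> path_homotopic_in A (path_cat a c) (path_cat b c).
Proof.
move=> /homotopicP[H [cH AH Hab Hs]] cc Ac ac; apply/homotopicP.
exists (fun v => if v.2 <= 1 / 2 then H (v.1, 2 * v.2 + 0) else c
  (2 * v.2 + -1)).
split => /=.
- refine (@glue_half R _ X _ snd (fun v => H (v.1, 2 * v.2 + 0))
     (fun v => c (2 * v.2 + -1)) closed_sq snd_cont _ _ _).
  + apply: sq_comp => //; [exact: fst_cont|apply: affine_comp; exact:
    snd_cont|].
    by move=> v [/sq01[? ?] /= ?]; lra.
  + apply: itv_comp => //; first by apply: affine_comp; exact: snd_cont.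
    by move=> v [/sq01[? ?] /= ?]; lra.
  + move=> v /sq01[v1 _] ->.
    have -> : 2 * (1 / 2) + 0 = 1 :> R by lra.
    have -> : 2 * (1 / 2) + -1 = 0 :> R by lra.
    by have [_ ->] := Hs _ v1.
- move=> s t s01 t01; case: leP => h; first by apply: AH => //; lra.
  by apply: Ac; lra.
- move=> t t01; rewrite /path_cat addr0; case: leP => h => //.
  by apply: Hab; lra.
- move=> s s01; rewrite path_cat0 path_cat1 ifT; last lra.
  rewrite ifF; last by apply/negbTE; rewrite -ltNge; lra.
  have -> : 2 * 0 + 0 = 0 :> R by lra.
  have -> : 2 * 1 + -1 = 1 :> R by lra.
  by have [-> _] := Hs _ s01.
Qed.

(** Going along [b] backwards and then forwards can be undone: both sides
    reparametrize the concatenation of [a] with the reverse of [b]. *)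
Lemma homotopic_detour A a b :
  {within `[0, 1], continuous a} -> {within `[0, 1], continuous b} ->
  (forall t, 0 <= t <= 1 -> A (a t) /\ A (b t)) -> a 1 = b 1 ->
  path_homotopic_in A a (path_cat (path_cat a (fun t => b (-1 * t + 1))) b).
Proof.
move=> ca cb Aab ab1; pose c t := b (-1 * t + 1).
have cc : {within `[0, 1], continuous c}.
  by apply: path_affine => // t /itv01; lra.
have ac : a 1 = c 0 by rewrite /c mulr0 add0r.
(* the second one runs along [a] and [c], and then back along [c] *)
have := @homotopic_reparam A (path_cat a c) (fun t => (1 / 2) * t + 0)
  (fun t => Num.min (2 * t + 0) (-1 * t + 3 / 2)).
move=> /(_ (path_cat_cont ca cc ac)) h.
apply: (homotopic_ext (h _ _ _ _ _ _)).
- move=> t t01; rewrite /path_cat; case: leP => t2.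
    by have [|] := Aab (2 * t); first lra.
  by have [|] := Aab (-1 * (2 * t - 1) + 1); first lra.
- by apply: affine_cont.
- move=> t; apply: (@continuous_min R R (fun t => 2 * t + 0) (fun t =>
  -1 * t + 3 / 2)).
    exact: affine_cont.
  exact: affine_cont.
- by move=> t t01; split; first lra; rewrite ge_min le_min; lra.
- by rewrite !mulr0 !addr0 add0r; apply/esym/min_idPl; lra.
- have -> : -1 * 1 + 3 / 2 = 1 / 2 * 1 + 0 :> R by lra.
  by apply/esym/min_idPr; lra.
- move=> t t01; rewrite /path_cat addr0 ifT; last lra.
  by congr a; lra.
- move=> t t01; rewrite [in RHS]/path_cat; case: leP => t2.
    by congr path_cat; rewrite addr0; apply/min_idPl; lra.
  rewrite (_ : Num.min _ _ = -1 * t + 3 / 2); last by apply/min_idPr; lra.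
  rewrite /path_cat /c; case: leP => t3; last by congr b; lra.
  have -> : t = 1 by lra.
  have -> : 2 * (-1 * 1 + 3 / 2) = 1 :> R by lra.
  by rewrite ab1; congr b; lra.
Qed.

End Homotopies.

(** Two paths become loops when they are followed by the reverse of the second
    one, and this detour can be cancelled afterwards. *)
Lemma pi1_injective_paths {R : realType} {X Y : topologicalType} (f : X -> Y)
    (a b : R -> X) :
  continuous f -> pi1_injective_on R [set: X] f ->
  {within `[0, 1], continuous a} -> {within `[0, 1], continuous b} ->
  a 0 = b 0 -> a 1 = b 1 ->
  path_homotopic_in [set: Y] (f \o a) (f \o b) -> path_homotopic_in [set: X] a
    b.
Proof.
move=> cf f1 ca cb ab0 ab1 fab.
pose c t := b (-1 * t + 1).
have cc : {within `[0, 1], continuous c}.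
  by apply: path_affine => // t /itv01; lra.
have ac : a 1 = c 0 by rewrite /c mulr0 add0r.
have bc : b 1 = c 0 by rewrite -ab1.
have c1 : c 1 = b 0 by rewrite /c mulr1 addNr.
have h : path_homotopic_in [set: X] (path_cat a c) (path_cat b c).
  apply: (f1 (b 0)) => //.
  - split => //; [exact: path_cat_cont|by rewrite path_cat0|by rewrite
    path_cat1].
  - split => //; [exact: path_cat_cont|by rewrite path_cat0|by rewrite
    path_cat1].
  have := homotopic_cat (c := f \o c) fab _ (fun _ _ => I).
  move=> /(_ _ _)/homotopic_ext; apply.
  - apply: (within_comp (B := setT) cc) => //.
    exact: continuous_subspaceT.
  - by rewrite /= ac.
  - by move=> t _; rewrite /path_cat /=; case: ifP.
  - by move=> t _; rewrite /path_cat /=; case: ifP.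
have {}h : path_homotopic_in [set: X] (path_cat (path_cat a c) b)
    (path_cat (path_cat b c) b).
  by apply: homotopic_cat => //; rewrite path_cat1.
apply: (homotopic_trans (homotopic_detour ca cb _ _)) => //.
apply: (homotopic_trans h); apply: homotopic_sym.
exact: homotopic_detour.
Qed.

Lemma pi1_injective_iter {R : realType} {X : topologicalType} (f : X -> X) n
    (a b : R -> X) :
  continuous f -> pi1_injective_on R [set: X] f ->
  {within `[0, 1], continuous a} -> {within `[0, 1], continuous b} ->
  a 0 = b 0 -> a 1 = b 1 ->
  path_homotopic_in [set: X] (iter n f \o a) (iter n f \o b) ->
  path_homotopic_in [set: X] a b.
Proof.
move=> cf f1; elim: n a b => // n IH a b ca cb ab0 ab1 h.
have cfa (d : R -> X) : {within `[0, 1], continuous d} ->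
    {within `[0, 1], continuous (f \o d)}.
  move=> cd; apply: (within_comp (B := setT) cd) => //.
  exact: continuous_subspaceT.
apply: (pi1_injective_paths cf f1) => //.
apply: IH; [exact: cfa|exact: cfa|by rewrite /= ab0|by rewrite /= ab1|].
by apply: (homotopic_ext h) => t _; rewrite /comp iterSr.
Qed.

(** * Dynamics near the ends *)

Lemma connected_in_one {T : topologicalType} {I : Type} (J : set I)
    (U : I -> set T) (B : set T) j x :
  (forall i, J i -> open (U i)) ->
  (forall i j, J i -> J j -> U i `&` U j !=set0 -> i = j) ->
  connected B -> B `<=` \bigcup_(i in J) U i -> J j -> B x -> U j x ->
    B `<=` U j.
Proof.
move=> oU dU cB BU Jj Bx Ujx.
suff <- : B `&` U j = B by apply: subIsetr.
apply: cB.
- by exists x.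
- by exists (U j) => //; exact: oU.
- exists (~` \bigcup_(i in [set i | J i /\ i <> j]) U i).
    by apply: open_closedC; apply: bigcup_open => i [/oU].
  apply/seteqP; split => y [By h]; split => //.
    by move=> [i [Ji ij] Uiy]; apply: ij; apply: dU => //; exists y.
  have [i Ji Uiy] := BU _ By; have [<-//|ij] := pselect (i = j).
  by case: h; exists i.
Qed.

Section EndDynamics.
Context {T : topologicalType} {I : Type} (J : set I) (U : I -> set T)
  (f : T -> T) (p : nat).
Let A := \bigcup_(i in J) U i.

Hypothesis hT : hausdorff_space T.
Hypothesis comp_open : forall (O : set T) x, open O ->
  open (connected_component O x).
Hypothesis oU : forall i, J i -> open (U i).
Hypothesis dU : forall i j, J i -> J j -> U i `&` U j !=set0 -> i = j.
Hypothesis fA : forall x, A x -> A (f x).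
Hypothesis fc : forall i, J i -> {within closure (U i), continuous f}.
Hypothesis p0 : (0 < p)%N.
Hypothesis basis : forall i, J i -> nbhd_basis (fun n => iter (p * n) f @` U i).

Lemma end_connected i : J i -> connected (U i).
Proof.
move=> /basis[_ _ [K _ /(_ 0%N)[x _]]]; rewrite muln0 image_id => ->.
exact: component_connected.
Qed.

Lemma end_nonempty i : J i -> U i !=set0.
Proof. by move=> /basis[/(_ 0%N) + _ _]; rewrite muln0 image_id. Qed.

Lemma image_closure i (h : T -> T) : {within closure (U i), continuous h} ->
  h @` closure (U i) `<=` closure (h @` U i).
Proof.
move=> ch _ [x cx <-] B nB.
have [y [Uy /(_ (subset_closure Uy)) By]] := cx _ (within_near ch cx nB).
by exists (h y); split => //; exists y.
Qed.

Lemma end_iter n i : J i -> exists2 j, J j &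
  [/\ iter n f @` U i `<=` U j, iter n f @` closure (U i) `<=` closure (U j) &
      {within closure (U i), continuous (iter n f)}].
Proof.
move=> Ji; elim: n => [|n [j Jj [UU cUU cn]]].
  exists i => //; split; rewrite ?image_id//.
  by apply: continuous_subspaceT => x; exact: cvg_id.
have cfj : connected (f @` U j).
  apply: connected_continuous_connected; first exact: end_connected.
  by apply: continuous_subspaceW (fc Jj); exact: subset_closure.
have [x Ujx] := end_nonempty Jj.
have [k Jk Ukfx] : A (f x) by apply: fA; exists j.
have fUk : f @` U j `<=` U k.
  apply: (connected_in_one oU dU cfj _ Jk _ Ukfx); last by exists x.
  by move=> _ [y Uy <-]; apply: fA; exists j.
exists k => //; split.
- by move=> _ [y Uy <-]; apply: fUk; exists (iter n f y) => //; apply: UU;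
  exists y.
- move=> _ [y cUy <-]; apply: (closureS fUk); apply: image_closure; first exact:
  fc.
  by exists (iter n f y) => //; apply: cUU; exists y.
- have : {within closure (U i), continuous (f \o iter n f)}; last by [].
  apply: (within_comp cn (fc Jj)) => y cUy.
  by apply: cUU; exists y.
Qed.

Lemma basis_le i m n : J i -> (m <= n)%N ->
  iter (p * n) f @` U i `<=` iter (p * m) f @` U i.
Proof.
move=> /basis[_ dec _] /subnK <-; elim: (n - m)%N => // k IH.
by apply: subset_trans IH; rewrite addSn; exact: dec.
Qed.

Lemma exhaustion_compact K (C : set T) : exhaustion K -> compact C ->
  exists m, C `<=` (K m)°.
Proof.
move=> [_ Kinc Kcov] /compact_near_coveringP cC.
have Kle m n : (m <= n)%N -> K m `<=` K n.
  by move=> /subnK <-; elim: (n - m)%N => // k IH; apply: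
    subset_trans IH (Kinc _).
have [] := cC nat \oo (fun m x => (K m)° x) _; last first.
  by move=> m _ /(_ m (leqnn m)) h; exists m.
move=> x _; have [m _ Kmx] : (\bigcup_n (K n)°) x by rewrite Kcov.
exists ((K m)°, [set n | (m <= n)%N]) => /=.
  by split; [exact: open_nbhs_nbhs (conj (open_interior _) Kmx)|exists m].
by move=> [y n] /= [Kmy /Kle mn]; exact: interiorS mn _ Kmy.
Qed.

(** The frontier of a nesting neighborhood lies in the first compact set of an
    exhaustion, because components of open sets are open; the images of the
    neighborhood under high powers of [f] avoid that compact set. *)
Lemma end_absorbs i : J i -> exists2 m, iter m f @` closure (U i) `<=` U i &
  {within closure (U i), continuous (iter m f)}.
Proof.
move=> Ji; have [_ _ [K eK KP]] := basis Ji.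
have [cK _ _] := eK.
have [x0 Kx0 U0E] := KP 0%N; rewrite muln0 image_id in U0E.
have K0cl n : closed (K n) by apply: compact_closed.
have clU x : closure (U i) x -> ~ K 0%N x -> U i x.
  move=> cUx nKx; have oC := comp_open x (closed_openC (K0cl 0%N)).
  have [|y [Uy Cy]] := cUx (connected_component (~` K 0%N) x).
    by apply: open_nbhs_nbhs; split => //; exact: connected_component_refl.
  rewrite U0E in Uy *; apply: connected_component_trans Uy _.
  exact: connected_component_sym.
have [m K0m] := exhaustion_compact eK (cK 0%N).
have [j Jj [_ _ cm]] := end_iter (p * m) Ji.
exists (p * m)%N => // y ymem.
have clB := image_closure cm ymem.
apply: clU.
  apply: closureS clB; rewrite -[X in _ `<=` X](image_id (U i)).
  by have := basis_le Ji (leq0n m); rewrite muln0.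
move=> /K0m Kmy; have [z [Bz Kz]] :=
  clB _ (open_nbhs_nbhs (conj (open_interior _) Kmy)).
have [x1 _ BmE] := KP m; rewrite BmE in Bz.
by have := connected_component_sub Bz; apply; exact: interior_subset Kz.
Qed.

(** Points near an end wander, because the orbit of a neighborhood of [y]
    eventually leaves a compact neighborhood of [y]; the finitely many
    remaining times are dealt with by the Hausdorff property, as [y] is not
    periodic. *)
Lemma end_wandering y : A y -> exists2 V, nbhs y V &
  forall x n, V x -> (0 < n)%N -> ~ V (iter n f x).
Proof.
move=> [i Ji Uy]; have [_ _ [K eK KP]] := basis Ji.
have [cK _ Kcov] := eK.
have [m _ Kmy] : (\bigcup_n (K n)°) y by rewrite Kcov.
have BK x : (iter (p * m) f @` U i) x -> ~ K m x.
  by have [x1 _ ->] := KP m; move=> /connected_component_sub.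
have nU : nbhs y (U i) by apply: open_nbhs_nbhs; split => //; exact: oU.
have cf n : {for y, continuous (iter n f)}.
  have [j Jj [_ _ cn]] := end_iter n Ji.
  move=> B nB; have := within_near cn (subset_closure Uy) nB.
  by apply: filterS2 nU => x Ux; apply; exact: subset_closure.
have mv n : (0 < n)%N -> iter n f y <> y.
  move=> n0 ny; have nky k : iter (n * k) f y = y.
    by elim: k => [|k IH]; rewrite ?muln0// mulnS iterD IH.
  apply: (BK y); last exact: interior_subset Kmy.
  apply: (@basis_le i m (n * m)%N Ji); first by rewrite leq_pmull.
  by exists y => //; rewrite mulnCA -[RHS](nky (p * m)%N).
have small M : exists2 V, nbhs y V &
    forall x n, V x -> (0 < n < M)%N -> ~ V (iter n f x).
  elim: M => [|M [V nV VP]]; first by exists setT => [|x n _];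
    [exact: filterT|lia].
  have [->|M0] := posnP M; first by exists setT => [|x n _];
    [exact: filterT|lia].
  have [O1 [O2 [n1 n2 dO]]] : exists O1 O2, [/\ nbhs y O1, nbhs (iter M f y) O2
    &
      O1 `&` O2 = set0].
    have /eqP := mv M M0; rewrite eq_sym => ne.
    have := hT; rewrite open_hausdorff =>
      /(_ _ _ ne)[[O1 O2] /= [y1 y2] [o1 o2 /eqP d]].
    by exists O1, O2; split => //; apply: open_nbhs_nbhs; split => //;
      rewrite -in_setE.
  exists (V `&` (O1 `&` (iter M f @^-1` O2))).
    by apply: filterI => //; apply: filterI => //; exact: cf.
  move=> x n [Vx [O1x O2x]] /andP[n0]; rewrite ltnS leq_eqVlt =>
    /orP[/eqP->|nM].
    by move=> [_ [O1M _]]; have : (O1 `&` O2) (iter M f x) by []; rewrite dO.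
  by move=> [Vn _]; apply: (VP x n) => //; rewrite n0.
have [V nV VP] := small (p * m)%N.
exists (V `&` (U i `&` (K m)°)).
  apply: filterI => //; apply: filterI => //.
  by apply: open_nbhs_nbhs; split => //; exact: open_interior.
move=> x n [Vx [Ux Kx]] n0 [Vn [Un Kn]].
have [nm|mn] := ltnP n (p * m); first by apply: (VP x n) => //; rewrite n0.
apply: (BK (iter n f x)); last exact: interior_subset Kn.
(* with [n = p j + r], the [r]-th power maps [U i] into itself, as it maps one
   of its points there; hence the [n]-th one maps it into the image under the
   power [p j] *)
have E := divn_eq n p.
have mj : (m <= n %/ p)%N by rewrite leq_divRL// mulnC.
apply: (basis_le Ji mj).
have [k Jk [rU _ _]] := end_iter (n %% p) Ji.
have ki : k = i.
  apply: dU => //; exists (iter n f x); split => //.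
  rewrite E addnC iterD; apply: rU; exists (iter (n %/ p * p) f x) => //.
  have := basis_le Ji (leq0n (n %/ p)); rewrite muln0 image_id; apply.
  by exists x => //; rewrite mulnC.
exists (iter (n %% p) f x); first by rewrite -ki; apply: rU; exists x.
by rewrite -iterD mulnC -E.
Qed.

(** Homotopies between paths near the ends are squeezed into the ends: retract
    them to the closure of a neighborhood, and let the dynamics absorb it. *)
Lemma end_push {R : realType} (G : graph R T) (a b : R -> T) :
  (forall i, J i -> subgraph G (closure (U i))) ->
  {within `[0, 1], continuous a} -> {within `[0, 1], continuous b} ->
  (forall t, 0 <= t <= 1 -> A (a t) /\ A (b t)) ->
  path_homotopic_in [set: T] a b ->
  exists (m : nat) (K : R * R -> T), [/\
    {within `[0, 1] `*` `[0, 1], continuous K},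
    forall s t, 0 <= s <= 1 -> 0 <= t <= 1 -> A (K (s, t)),
    forall t, 0 <= t <= 1 -> K (0, t) = iter m f (a t) /\
      K (1, t) = iter m f (b t) &
    forall s, 0 <= s <= 1 -> K (s, 0) = iter m f (a 0) /\
      K (s, 1) = iter m f (a 1)].
Proof.
move=> sU ca cb Aab /homotopicP[h [ch _ hab hs]].
have z01 : 0 <= (0 : R) <= 1 by rewrite lexx ler01.
have o01 : 0 <= (1 : R) <= 1 by rewrite lexx ler01.
have [[i Ji Uia0] _] := Aab _ z01.
have inU (c : R -> T) : {within `[0, 1], continuous c} ->
    (forall t, 0 <= t <= 1 -> A (c t)) -> U i (c 0) ->
    forall t, 0 <= t <= 1 -> U i (c t).
  move=> cc Ac Uc0 t t01.
  apply: (connected_in_one oU dU (B := c @` `[0, 1]%classic) _ _ Ji _ Uc0).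
  - apply: connected_continuous_connected => //; exact: segment_connected.
  - by move=> _ [u /itv01 u01 <-]; exact: Ac.
  - by exists 0 => //; apply/itv01.
  - by exists t => //; apply/itv01.
have Ua := inU a ca (fun t t01 => (Aab t t01).1) Uia0.
have b0 : b 0 = a 0 by have [_ <-] := hab _ z01; have [-> _] := hs _ o01.
have Ub t : 0 <= t <= 1 -> U i (b t).
  by apply: inU => //; [move=> u /Aab[]|rewrite b0].
have [r [cr Cr rC]] : exists r : T -> T, [/\ continuous r,
    forall x, closure (U i) (r x) & forall x, closure (U i) x -> r x = x].
  apply: (connected_subgraph_retract (sU i Ji)).
    by apply: connected_closure; exact: end_connected.
  by exists (a 0); exact: subset_closure.
have rU x : U i x -> r x = x by move=> Ux; apply: rC; exact: subset_closure.
have [m mU cm] := end_absorbs Ji.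
exists m, (fun v => iter m f (r (h v))); split.
- have crh : {within `[0, 1] `*` `[0, 1], continuous (r \o h)}.
    by apply: (within_comp (B := setT) ch) => //; exact: continuous_subspaceT.
  have : {within `[0, 1] `*` `[0, 1], continuous (iter m f \o (r \o h))};
    last by [].
  by apply: (within_comp crh cm) => v _; exact: Cr.
- by move=> s t _ _; exists i => //; apply: mU; exists (r (h (s, t))).
- by move=> t t01; have [-> ->] := hab _ t01; rewrite !rU//;
  [exact: Ub|exact: Ua].
- by move=> s s01; have [-> ->] := hs _ s01; rewrite !rU//; exact: Ua.
Qed.

End EndDynamics.

(** * Coordinates on the mapping torus *)

Section TorusCoordinates.
Context (R : realType) {T : topologicalType} (g : T -> T).
Local Notation Z := (mapping_torus R g).
Local Open Scope quotient_scope.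

Definition torus_pt (x : T) (t : R) : Z := \pi_Z (x, to01 t).

Definition low_rep (a : T * I01 R) : T * R :=
  if val a.2 == 1 then (g a.1, 0) else (a.1, val a.2).

Definition base (z : Z) : T := (low_rep (repr z)).1.
Definition height (z : Z) : R := (low_rep (repr z)).2.

Definition line (x : T) (t : R) : Z :=
  torus_pt (iter (Num.truncn t) g x) (t - (Num.truncn t)%:R).

Lemma val_to01 (t : R) : 0 <= t <= 1 -> val (to01 t) = t.
Proof. by move=> t01; rewrite /to01 insubdK// inE /= in_itv. Qed.

Lemma to01_val (u : I01 R) : to01 (val u) = u.
Proof. by rewrite /to01 /insubd valK. Qed.

Lemma I01_itv (u : I01 R) : 0 <= val u <= 1.
Proof. by have := valP u; rewrite inE /= in_itv. Qed.

(** Every class of the gluing has exactly one member with height in [0, 1), so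
    that base point and height are functions on the torus. *)
Lemma low_rep_glue a b : gen_rel (@Defs.glue R T g) a b ->
  low_rep a = low_rep b.
Proof.
move=> /asboolP; elim => [{}a {}b [a1 ->]|//|{}a {}b _ -> //|{}a c {}b _ ->
  _ //].
rewrite /low_rep a1 eqxx /= val_to01 ?lexx ?ler01//.
by rewrite eq_sym oner_eq0.
Qed.

Let eqT := gen_equiv (@Defs.glue R T g).

Lemma torus_eqP (a b : T * I01 R) :
  \pi_Z a = \pi_Z b <-> gen_rel (@Defs.glue R T g) a b.
Proof.
split; first by move/(@eqmodP _ eqT a b).
by move=> ab; apply/(@eqmodP _ eqT a b).
Qed.

Lemma low_rep_repr (x : T) t : low_rep (repr (torus_pt x t)) = low_rep
  (x, to01 t).
Proof. by apply: low_rep_glue; apply/torus_eqP; rewrite reprK. Qed.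

Lemma torus_pt1 x : torus_pt x 1 = torus_pt (g x) 0.
Proof.
apply/torus_eqP/asboolP; apply: rst_step; split => //=.
by rewrite val_to01// ler01 lexx.
Qed.

Lemma torus_eta z : z = torus_pt (base z) (height z).
Proof.
rewrite -[LHS]reprK /base /height /low_rep; case: eqP => [e|_] /=.
  by rewrite -torus_pt1 /torus_pt -e to01_val -surjective_pairing.
by rewrite /torus_pt to01_val -surjective_pairing.
Qed.

Lemma height_itv z : 0 <= height z < 1.
Proof.
rewrite /height /low_rep; case: eqP => [_|/eqP n1] /=;
  first by rewrite lexx ltr01.
by have /andP[u0 u1] := I01_itv (repr z).2; rewrite u0 lt_neqAle n1.
Qed.

Lemma base_torus_pt x t : 0 <= t < 1 -> base (torus_pt x t) = x.
Proof.
move=> /andP[t0 t1]; have t01 : 0 <= t <= 1 by rewrite t0 ltW.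
by rewrite /base low_rep_repr// /low_rep /= val_to01// lt_eqF.
Qed.

Lemma height_torus_pt x t : 0 <= t < 1 -> height (torus_pt x t) = t.
Proof.
move=> /andP[t0 t1]; have t01 : 0 <= t <= 1 by rewrite t0 ltW.
by rewrite /height low_rep_repr// /low_rep /= val_to01// lt_eqF.
Qed.

Lemma nat_frac (t : R) : 0 <= t -> exists n s, 0 <= s < 1 /\ t = n%:R + s.
Proof.
move=> /truncn_itv/andP[t0 t1]; exists (Num.truncn t), (t - (Num.truncn t)%:R).
by split; [rewrite -natr1 in t1; lra|rewrite addrC subrK].
Qed.

Lemma line_lt x n s : 0 <= s < 1 -> line x (n%:R + s) = torus_pt (iter n g x) s.
Proof.
move=> s01; rewrite /line (@truncn_def _ _ n); last by rewrite -natr1; lra.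
by rewrite addrAC subrr add0r.
Qed.

Lemma line_torus_pt x n s : 0 <= s <= 1 -> line x (n%:R + s) = torus_pt
  (iter n g x) s.
Proof.
move=> /andP[s0]; rewrite le_eqVlt => /predU1P[->|s1]; last by apply: line_lt;
  rewrite s0.
by rewrite torus_pt1 natr1 -[X in line x X]addr0 line_lt ?lexx ?ltr01.
Qed.

Lemma line_nat x n : line x n%:R = fiber0 R g (iter n g x).
Proof. by rewrite -[n%:R]addr0 line_torus_pt// lexx ler01. Qed.

Lemma line0 x : line x 0 = fiber0 R g x.
Proof. exact: (line_nat x 0). Qed.

Lemma line_iter x n t : 0 <= t -> line (iter n g x) t = line x (n%:R + t).
Proof.
move=> /nat_frac[m [s [s01 ->]]]; rewrite addrA -natrD !line_lt//.
by rewrite -iterD addnC.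
Qed.

Lemma line_base_height z : z = line (base z) (height z).
Proof.
by rewrite -[height z]add0r -[0]/(0%:R) line_lt ?height_itv//; exact: torus_eta.
Qed.

Lemma base_line x n s : 0 <= s < 1 -> base (line x (n%:R + s)) = iter n g x.
Proof. by move=> s01; rewrite line_lt// base_torus_pt. Qed.

Lemma height_line x n s : 0 <= s < 1 -> height (line x (n%:R + s)) = s.
Proof. by move=> s01; rewrite line_lt// height_torus_pt. Qed.

Lemma base_fiber0 x : base (fiber0 R g x) = x.
Proof. by rewrite base_torus_pt// lexx ltr01. Qed.

Lemma flow_base_height (t : R) (z : Z) : 0 <= t ->
  flow t z = line (base z) (height z + t).
Proof.
move=> t0; rewrite /flow /base /height /low_rep; case: eqP => [->|//] /=.
rewrite add0r.
have [n [s [s01 E]]] := nat_frac t0.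
have -> : 1 + t = n.+1%:R + s by rewrite E -natr1; lra.
rewrite E line_lt// (@truncn_def _ _ n.+1); last by rewrite -[n.+2%:R]natr1;
  lra.
by rewrite iterSr addrAC subrr add0r.
Qed.

Lemma flow_line x (t s : R) : 0 <= t -> 0 <= s -> flow s (line x t) = line x
  (t + s).
Proof.
move=> /nat_frac[n [u [u01 ->]]] s0; rewrite flow_base_height// base_line//
  height_line//.
by rewrite line_iter ?addrA//; lra.
Qed.

Lemma flow_flow (t s : R) (z : Z) : 0 <= t -> 0 <= s ->
  flow s (flow t z) = flow (t + s) z.
Proof.
move=> t0 s0; have /andP[? ?] := height_itv z.
rewrite (flow_base_height z t0) flow_line ?addr_ge0// (flow_base_height z)
  ?addr_ge0//.
by rewrite addrA.
Qed.

Lemma flow0 (z : Z) : flow 0 z = z.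
Proof. by rewrite flow_base_height// addr0 -line_base_height. Qed.

Lemma flow_fiber0 x (t : R) : 0 <= t -> flow t (fiber0 R g x) = line x t.
Proof. by move=> t0; rewrite -line0 flow_line// add0r. Qed.

Lemma flow_torus_pt x (t s : R) : 0 <= t <= 1 -> 0 <= s ->
  flow s (torus_pt x t) = line x (t + s).
Proof.
move=> t01 s0; rewrite -[torus_pt x t](line_torus_pt x 0 t01) add0r flow_line//.
by case/andP: t01.
Qed.

Lemma line_inj x y t s : 0 <= t -> 0 <= s -> line x t = line y s ->
  exists n m u, [/\ 0 <= u < 1, t = n%:R + u, s = m%:R + u & iter n g x = iter m
    g y].
Proof.
move=> /nat_frac[n [u [u01 ->]]] /nat_frac[m [v [v01 ->]]] e.
exists n, m, u; have uv : v = u by rewrite -(height_line x n u01) e height_line.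
rewrite {v}uv in v01 e *; split => //.
by rewrite -(base_line x n u01) e base_line.
Qed.

Lemma line_fiber0 x y t : 0 <= t -> line x t = fiber0 R g y ->
  exists2 n, t = n%:R & iter n g x = y.
Proof.
move=> t0; rewrite -line0 => /(line_inj t0 (lexx 0))[n [m [u [u01 -> m0 e]]]].
have u0 : u = 0 by have := ler0n R m; lra.
have /eqP : m%:R = 0 :> R by lra.
rewrite pnatr_eq0 => /eqP m00.
by exists n; rewrite ?u0 ?addr0// e m00.
Qed.

(** Heights 0 and 1 need no separate treatment: a neighborhood of a point at
    height 0 is found by applying the hypothesis to all of its
    representatives. *)
Lemma torus_open (O : set Z) :
  (forall x t, 0 <= t <= 1 -> O (torus_pt x t) ->
    exists N e, [/\ nbhs x N, 0 < e &
    forall x' t', N x' -> 0 <= t' <= 1 -> `|t - t'| < e -> O (torus_pt x' t')])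
      ->
  open O.
Proof.
move=> H; have : open (\pi_Z @^-1` O : set (T * I01 R)); last by [].
rewrite openE => -[x u] /= Oxu; have u01 := I01_itv u.
have [|N [e [nN e0 NP]]] := H x (val u) u01; first by rewrite /torus_pt
  to01_val.
exists (N, (val : I01 R -> R) @^-1` (ball (val u) e)).
  split => //=; have := @initial_continuous _ _ (val : I01 R -> R) u; apply.
  exact: nbhsx_ballx.
move=> [x' u'] [/= Nx' be]; have := NP x' (val u') Nx' (I01_itv u') be.
by rewrite /torus_pt to01_val.
Qed.

Lemma pi_cont : continuous (fun a : T * I01 R => \pi_Z a).
Proof. exact: pi_continuous. Qed.

Lemma torus_pt_cont x (t : R) (O : set Z) : 0 <= t <= 1 ->
  nbhs (torus_pt x t) O ->
  exists N e, [/\ nbhs x N, 0 < e &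
    forall x' t', N x' -> 0 <= t' <= 1 -> `|t - t'| < e -> O (torus_pt x' t')].
Proof.
move=> t01 /pi_cont[[N M] /= [nN]]; rewrite /nbhs /= =>
  -[B [[C oC CB] Bt BM]] NP.
have Ct : C t by rewrite -(val_to01 t01); rewrite -CB in Bt.
have : nbhs t C by exact: open_nbhs_nbhs.
move=> /nbhs_ballP[e /= e0 eC]; exists N, e; split => // x' t' Nx' t'01 tt'.
apply: (NP (x', to01 t')); split => //=; apply: BM; rewrite -CB /=.
by rewrite [set_val _]val_to01//; exact: eC.
Qed.

Lemma fiber0_cont : continuous (fiber0 R g).
Proof.
move=> x O nO; have z01 : 0 <= (0 : R) <= 1 by rewrite lexx ler01.
have [N [e [nN e0 NP]]] := torus_pt_cont z01 nO.
by apply: filterS nN => x' Nx'; apply: NP => //; rewrite subrr normr0.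
Qed.

End TorusCoordinates.

(** * The semiflow near the ends *)

Lemma iter_cont {T : topologicalType} (f : T -> T) n :
  continuous f -> continuous (iter n f).
Proof.
move=> cf; elim: n => [|n IH] x; first exact: cvg_id.
have : {for x, continuous (f \o iter n f)}; last by [].
by apply: continuous_comp; [exact: IH|exact: cf].
Qed.

(** What the mapping torus needs to know of the neighborhoods [Ap] of the
    attracting ends and [Am] of the repelling ends.  The map [ginv] inverts [g]
    over [Ap `|` Am] only.  Wandering neighborhoods make flow lines near
    infinity embedded lines. *)
Record sides {T : topologicalType} (g ginv : T -> T) (Ap Am : set T) : Prop :=
  Sides {
  side_cont : continuous g;
  side_openp : open Ap;
  side_openm : open Am;
  side_fwd : forall x, Ap x -> Ap (g x);
  side_bwd : forall x, Am (g x) -> Am x;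
  side_gK : forall x, (Ap `|` Am) (g x) -> ginv (g x) = x;
  side_Kg : forall y, (Ap `|` Am) y -> g (ginv y) = y;
  side_icont : forall y, (Ap `|` Am) y -> {for y, continuous ginv};
  side_wander : forall y, (Ap `|` Am) y -> exists2 V, nbhs y V &
    forall x n, V x -> (0 < n)%N -> ~ V (iter n g x) }.

Section SidesLemmas.
Context {T : topologicalType} (g ginv : T -> T) (Ap Am : set T).
Hypothesis H : sides g ginv Ap Am.

Lemma side_iter_inj n x y :
  (forall k, (0 < k <= n)%N -> (Ap `|` Am) (iter k g x)) ->
  iter n g x = iter n g y -> x = y.
Proof.
elim: n => [//|n IH] An /= e; apply: IH.
  by move=> k /andP[k0 kn]; apply: An; rewrite k0 leqW.
have A1 : (Ap `|` Am) (g (iter n g x)) by apply: (An n.+1); rewrite leqnn.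
by rewrite -(side_gK H A1) e (side_gK H)// -e.
Qed.

Lemma iter_fwd n x : Ap x -> Ap (iter n g x).
Proof. by move=> Ax; elim: n => //= n; exact: (side_fwd H). Qed.

Lemma iter_bwd n x : Am (iter n g x) -> Am x.
Proof. by elim: n => //= n IH /(side_bwd H). Qed.

Lemma iter_bwd_le k n x : (k <= n)%N -> Am (iter n g x) -> Am (iter k g x).
Proof. by move=> /subnK <-; rewrite iterD; exact: iter_bwd. Qed.

Lemma ginv_bwd x : Am x -> Am (ginv x).
Proof. by move=> Ax; apply: (side_bwd H); rewrite (side_Kg H)//; right. Qed.

Lemma iter_ginv_bwd n x : Am x -> Am (iter n ginv x).
Proof. by move=> Ax; elim: n => //= n; exact: ginv_bwd. Qed.

Lemma iter_g_ginv n x : Am x -> iter n g (iter n ginv x) = x.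
Proof.
move=> Ax; elim: n => // n IH; rewrite iterSr [iter n.+1 ginv x]/=
  (side_Kg H)//.
by right; exact: iter_ginv_bwd.
Qed.

(** Over the neighborhoods of the ends [g] has a continuous inverse, which makes
    it an open map there. *)
Lemma img_open n (V : set T) : open V ->
  (forall x k, V x -> (0 < k <= n)%N -> (Ap `|` Am) (iter k g x)) ->
  open (iter n g @` V).
Proof.
move=> oV; elim: n => [|n IH] VA; first by rewrite image_id.
have oA : open (Ap `|` Am) by apply: openU; [exact: side_openp H|exact:
  side_openm H].
have oI : open (iter n g @` V).
  by apply: IH => x k Vx /andP[k0 kn]; apply: VA; rewrite ?k0 ?leqW.
rewrite (_ : _ @` _ = (Ap `|` Am) `&` ginv @^-1` (iter n g @` V)).
  rewrite openE => y [Ay iy]; apply: filterI; first exact: open_nbhs_nbhs.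
  by apply: (side_icont H Ay); exact: open_nbhs_nbhs.
apply/seteqP; split => [_ [x Vx <-]|y [Ay [x Vx xy]]].
  have An : (Ap `|` Am) (iter n.+1 g x) by apply: VA => //; rewrite leqnn.
  by split => //=; exists x => //; rewrite (side_gK H).
by exists x => //=; rewrite xy (side_Kg H).
Qed.

Lemma side_wander_open y : (Ap `|` Am) y -> exists V, [/\ open V, V y &
  forall x n, V x -> (0 < n)%N -> ~ V (iter n g x)].
Proof.
move=> /(side_wander H)[V nV VP]; exists V°; split.
- exact: open_interior.
- exact: nV.
- move=> x n /interior_subset Vx n0 /interior_subset; exact: VP.
Qed.

End SidesLemmas.

(** The ray classes of a semiflow: two rays end at the same point when they
    eventually coincide. *)
Section RayClasses.
Context {R : realType} {Z : topologicalType} (S : set Z) (psi : R -> Z -> Z).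
Hypothesis psiS : forall t z, 0 <= t -> S z -> S (psi t z).
Hypothesis psiD : forall t s z, 0 <= t -> 0 <= s -> S z ->
  psi s (psi t z) = psi (t + s) z.
Hypothesis psi0 : forall z, S z -> psi 0 z = z.

Let eqR := gen_equiv (fun z w : S => ray psi (val z) `<=` ray psi (val w)).

Lemma ray_classP (z w : S) : ray_class psi z = ray_class psi w <->
  exists a b, [/\ 0 <= a, 0 <= b & psi a (val z) = psi b (val w)].
Proof.
have SP (u : S) : S (val u) by have := valP u; rewrite inE.
split.
  move/(@eqmodP _ eqR z w)/asboolP.
  elim => {z w} [z w zw|z|z w _ [a [b [a0 b0 e]]]|z w v _ [a [b [a0 b0 e]]] _
    [c [d [c0 d0 f]]]].
  - have [|t /= t0 e] := zw (val z).
      exists 0; last exact: psi0 (SP z).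
      by rewrite /= in_itv /= lexx.
    exists 0, t; split => //; first by move: t0; rewrite in_itv /= andbT.
    exact: etrans (psi0 (SP z)) (esym e).
  - by exists 0, 0.
  - by exists b, a.
  - exists (a + c), (d + b); rewrite !addr_ge0//; split => //.
    by rewrite -(psiD a0 c0 (SP _)) e (psiD b0 c0 (SP _)) addrC
         -(psiD c0 b0 (SP _)) f (psiD d0 b0 (SP _)).
have cls (u v : S) t : 0 <= t -> val v = psi t (val u) ->
  ray_class psi u = ray_class psi v.
  move=> t0 e; apply/(@eqmodP _ eqR u v)/asboolP; apply: rst_sym; apply:
    rst_step.
  move=> _ [s s0 <-]; rewrite /= in_itv /= andbT in s0.
  rewrite e (psiD t0 s0 (SP _)); exists (t + s) => //.
  by rewrite /= in_itv /= andbT addr_ge0.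
move=> [a [b [a0 b0 e]]].
have Su : S (psi a (val z)) by exact: psiS a0 (SP _).
pose u : S := SigSub (mem_set Su).
rewrite (cls z u a)// (cls w u b)//.
Qed.

End RayClasses.

Section TorusEnds.
Context (R : realType) {T : topologicalType} (g ginv : T -> T) (Ap Am : set T).
Hypothesis H : sides g ginv Ap Am.
Local Notation Z := (mapping_torus R g).

Definition forward_side : set Z := forward_orbit Ap.
Definition backward_side : set Z := backward_orbit Am.
Definition back_flow := backward_flow backward_side.

Lemma forward_sideE z : forward_side z <-> Ap (base z).
Proof.
split=> [[t t0 [x Ax ->]]|Az].
  rewrite flow_fiber0//; have [n [s [s01 ->]]] := nat_frac t0.
  by rewrite base_line//; exact: iter_fwd H _ _ Ax.
have /andP[? ?] := height_itv z; exists (height z) => //; exists (base z) => //.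
by rewrite flow_fiber0// -line_base_height.
Qed.

Lemma forward_side_flow t z : 0 <= t -> forward_side z ->
  forward_side (flow t z).
Proof.
move=> t0 [s s0 [x Ax ->]]; exists (s + t); rewrite ?addr_ge0//; exists x => //.
by rewrite flow_flow.
Qed.

Lemma backward_side_flow t z : 0 <= t -> backward_side (flow t z) ->
  backward_side z.
Proof.
move=> t0 [s s0 [x Ax e]]; exists (t + s); rewrite ?addr_ge0//; exists x => //.
by rewrite -flow_flow.
Qed.

Lemma backward_side_fiber0 x : Am x -> backward_side (fiber0 R g x).
Proof. by move=> Ax; exists 0 => //; exists x => //; rewrite flow0. Qed.

Lemma backward_side_base z : backward_side z -> Am (base z).
Proof.
have /andP[s0 s1] := height_itv z.
move=> [t t0 [x Ax]]; rewrite flow_base_height//.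
move=> /(line_fiber0 (addr_ge0 s0 t0))[n _ nx].
by apply: (iter_bwd H (n := n)); rewrite nx.
Qed.

(** Backward flow lines are unique where they exist: heights agree modulo 1, and
    [g] is injective over [Am]. *)
Lemma backward_side_flow_inj t w w' : 0 <= t -> backward_side (flow t w) ->
  flow t w = flow t w' -> w = w'.
Proof.
move=> t0 Zw e; have /andP[a0 a1] := height_itv w; have /andP[b0 b1] :=
  height_itv w'.
have Ap1 := backward_side_base Zw; move: e Ap1; rewrite !flow_base_height// =>
  e.
have [n [m [u [u01 E1 E2 E3]]]] := line_inj (addr_ge0 a0 t0) (addr_ge0 b0 t0) e.
have nm : n = m.
  have h1 : n%:R < m%:R + 1 :> R by lra.
  have h2 : m%:R < n%:R + 1 :> R by lra.
  by move: h1 h2; rewrite !natr1 !ltr_nat; lia.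
subst m; rewrite E1 base_line// => An.
have pp : base w = base w'.
  apply: (side_iter_inj H (n := n)) => // k /andP[_ kn]; right.
  exact: iter_bwd_le H _ _ _ kn An.
have tt : height w = height w' by lra.
by rewrite (line_base_height w) pp tt -line_base_height.
Qed.

Lemma back_flow_ex t z : 0 <= t -> backward_side z -> exists2 w, backward_side w
  & flow t w = z.
Proof.
move=> t0 Zz; have Az := backward_side_base Zz; have /andP[s0 s1] :=
  height_itv z.
(* go back by [n] full turns, further than needed, and then forward *)
pose n := (Num.truncn t).+1.
have tn : t < n%:R by have /andP[] := truncn_itv t0.
have h : 0 <= n%:R + height z - t by lra.
have [k [s [s01 E]]] := nat_frac h.
have kn : (k <= n)%N.
  have : k%:R < n%:R + 1 :> R by lra.
  by rewrite natr1 ltr_nat; lia.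
have E2 : s + t = (n - k)%:R + height z by rewrite natrB//; lra.
pose w := torus_pt g (iter (n - k) ginv (base z)) s.
have Ew : flow t w = z.
  rewrite flow_torus_pt//; last lra.
  by rewrite E2 line_lt ?height_itv// (iter_g_ginv H)// -torus_eta.
by exists w => //; apply: (backward_side_flow t0); rewrite Ew.
Qed.

Lemma back_flowP t z : 0 <= t -> backward_side z ->
  backward_side (back_flow t z) /\ flow t (back_flow t z) = z.
Proof.
move=> t0 Zz; have [w Zw wz] := back_flow_ex t0 Zz.
exact: (@xgetPex _ z [set w | backward_side w /\ flow t w = z]
  (ex_intro _ w (conj Zw wz))).
Qed.

Lemma back_flow_uniq t w : 0 <= t -> backward_side (flow t w) ->
  back_flow t (flow t w) = w.
Proof.
move=> t0 Zz; have [Zb e] := back_flowP t0 Zz.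
by apply: (backward_side_flow_inj t0); rewrite e.
Qed.

Lemma back_flow_back_flow t s z : 0 <= t -> 0 <= s -> backward_side z ->
  back_flow s (back_flow t z) = back_flow (t + s) z.
Proof.
move=> t0 s0 Zz; have [Z1 e1] := back_flowP t0 Zz; have [Z2 e2] :=
  back_flowP s0 Z1.
have E : flow (t + s) (back_flow s (back_flow t z)) = z by rewrite addrC
  -flow_flow// e2.
by rewrite -[in RHS]E back_flow_uniq ?addr_ge0// E.
Qed.

Lemma back_flow0 z : backward_side z -> back_flow 0 z = z.
Proof. by move=> Zz; rewrite -{1}(flow0 z) back_flow_uniq// flow0. Qed.

Local Notation W := (compactified forward_side (@flow R T g) backward_side
  back_flow).

(** Ray classes, as total functions on the torus. *)
Definition plus_class (z : Z) : W :=
  if insub z is Some u then BdPlus _ _ (ray_class (@flow R T g) u) else Inner _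
    _ _ _ z.

Definition minus_class (z : Z) : W :=
  if insub z is Some u then BdMinus _ _ (ray_class back_flow u) else Inner _ _ _
    _ z.

End TorusEnds.

(** * The infinite cyclic cover of the compactified torus *)

Section TorusCharts.
Context (R : realType) {T : topologicalType} (g ginv : T -> T) (Ap Am : set T).
Hypothesis H : sides g ginv Ap Am.
Local Notation Z := (mapping_torus R g).
Local Notation forward_side := (@forward_side R T g Ap).
Local Notation backward_side := (@backward_side R T g Am).
Local Notation back_flow := (@back_flow R T g Am).
Local Notation W := (compactified forward_side (@flow R T g) backward_side
  back_flow).
Local Notation plus_class := (@plus_class R T g Ap Am).
Local Notation minus_class := (@minus_class R T g Ap Am).
Local Notation Inner := (@Inner R Z forward_side (@flow R T g) backward_side
  back_flow).
Local Notation BdPlus := (@BdPlus R Z forward_side (@flow R T g) backward_side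
  back_flow).
Local Notation BdMinus := (@BdMinus R Z forward_side (@flow R T g) backward_side
  back_flow).

Lemma sub_val (S : set Z) (u : S) : S (val u).
Proof. by have := valP u; rewrite inE. Qed.

Lemma plus_classE z : forward_side z -> exists2 u : forward_side,
  val u = z & plus_class z = BdPlus (ray_class (@flow R T g) u).
Proof.
move=> Zz; rewrite /plus_class; case: insubP => [u _ <-|]; first by exists u.
by rewrite mem_set.
Qed.

Lemma minus_classE z : backward_side z -> exists2 u : backward_side,
  val u = z & minus_class z = BdMinus (ray_class back_flow u).
Proof.
move=> Zz; rewrite /minus_class; case: insubP => [u _ <-|]; first by exists u.
by rewrite mem_set.
Qed.

Lemma plus_class_val (u : forward_side) : BdPlus (ray_class (@flow R T g) u) =
  plus_class (val u).
Proof. by rewrite /plus_class valK. Qed.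

Lemma minus_class_val (u : backward_side) : BdMinus (ray_class back_flow u) =
  minus_class (val u).
Proof. by rewrite /minus_class valK. Qed.

Lemma BdPlus_repr c : BdPlus c = plus_class (val (repr c)).
Proof. by rewrite -plus_class_val /ray_class reprK. Qed.

Lemma BdMinus_repr c : BdMinus c = minus_class (val (repr c)).
Proof. by rewrite -minus_class_val /ray_class reprK. Qed.

Lemma plus_class_eq z z' : forward_side z -> forward_side z' ->
  plus_class z = plus_class z' <->
  exists a b, [/\ 0 <= a, 0 <= b & flow a z = flow b z'].
Proof.
move=> /plus_classE[u <- ->] /plus_classE[v <- ->].
rewrite -(ray_classP (@forward_side_flow R T g Ap) _ _ u v).
- by split=> [[]|->].
- by move=> t s w t0 s0 _; exact: flow_flow.
- by move=> w _; exact: flow0.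
Qed.

Lemma minus_class_eq z z' : backward_side z -> backward_side z' ->
  minus_class z = minus_class z' <->
  exists a b, [/\ 0 <= a, 0 <= b & back_flow a z = back_flow b z'].
Proof.
move=> /minus_classE[u <- ->] /minus_classE[v <- ->].
rewrite -(ray_classP _ _ _ u v).
- by split=> [[]|->].
- by move=> t w t0 Zw; case: (back_flowP H t0 Zw).
- by move=> t s w t0 s0 Zw; exact: back_flow_back_flow H _ _ _ t0 s0 Zw.
- exact: back_flow0 H.
Qed.

Definition plus_end (y : T) : W := plus_class (fiber0 R g y).
Definition minus_end (y : T) : W := minus_class (fiber0 R g y).

Lemma forward_side_fiber0 y : Ap y -> forward_side (fiber0 R g y).
Proof. by move=> Ay; apply/(forward_sideE H); rewrite base_fiber0. Qed.

Lemma plus_class_base z : forward_side z -> plus_class z = plus_end (base z).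
Proof.
move=> Zz; have Az := (forward_sideE H z).1 Zz; have /andP[s0 _] :=
  height_itv z.
apply/(plus_class_eq Zz (forward_side_fiber0 Az)); exists 0, (height z);
  split => //.
by rewrite flow0 flow_fiber0// -line_base_height.
Qed.

Lemma minus_class_base z : backward_side z -> minus_class z = minus_end
  (base z).
Proof.
move=> Zz; have Az := backward_side_base H Zz; have /andP[s0 _] := height_itv z.
have Zf : backward_side (fiber0 R g (base z)) by apply: backward_side_fiber0.
apply/(minus_class_eq Zz Zf); exists (height z), 0; split => //.
have E : flow (height z) (fiber0 R g (base z)) = z by rewrite flow_fiber0//
  -line_base_height.
by rewrite (back_flow0 H)// -[X in back_flow _ X]E (back_flow_uniq H)// E.
Qed.

Lemma plus_end_flow y y' n m : Ap y -> Ap y' -> iter n g y = iter m g y' ->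
  plus_end y = plus_end y'.
Proof.
move=> Ay Ay' e;
  apply/(plus_class_eq (forward_side_fiber0 Ay) (forward_side_fiber0 Ay')).
by exists n%:R, m%:R; rewrite !flow_fiber0// !line_nat e.
Qed.

Lemma minus_end_flow y y' n : Am y -> Am y' -> y' = iter n g y ->
  minus_end y = minus_end y'.
Proof.
move=> Ay Ay' e; apply/(minus_class_eq (backward_side_fiber0 R g Ay)
  (backward_side_fiber0 R g Ay')).
have E : flow n%:R (fiber0 R g y) = fiber0 R g y' by rewrite flow_fiber0//
  line_nat e.
exists 0, n%:R; split => //; rewrite (back_flow0 H); last exact:
  backward_side_fiber0.
by rewrite -E (back_flow_uniq H)// E; exact: backward_side_fiber0.
Qed.

Lemma plus_end_eq y y' : Ap y -> Ap y' -> plus_end y = plus_end y' ->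
  exists k, y' = iter k g y \/ y = iter k g y'.
Proof.
move=> Ay Ay' /(plus_class_eq (forward_side_fiber0 Ay)
  (forward_side_fiber0 Ay'))[a [b [a0 b0]]].
rewrite !flow_fiber0// => /(line_inj a0 b0)[n [m [_ [_ _ _ e]]]].
have inj k x x' : Ap x -> iter k g x = iter k g x' -> x = x'.
  move=> Ax; apply: (side_iter_inj H) => i _; left; exact: iter_fwd H _ _ Ax.
have [nm|/ltnW mn] := leqP n m.
  exists (m - n)%N; right; apply: (inj n) => //.
  by rewrite -iterD subnKC.
exists (n - m)%N; left; apply: (inj m) => //.
by rewrite -iterD subnKC// e.
Qed.

Lemma minus_end_eq y y' : Am y -> Am y' -> minus_end y = minus_end y' ->
  exists k, y' = iter k g y \/ y = iter k g y'.
Proof.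
move=> Ay Ay' /(minus_class_eq (backward_side_fiber0 R g Ay)
  (backward_side_fiber0 R g Ay'))[a [b [a0 b0 e]]].
have [Z1 e1] := back_flowP H a0 (backward_side_fiber0 R g Ay).
have [_ e2] := back_flowP H b0 (backward_side_fiber0 R g Ay').
rewrite e in e1 Z1; set u := back_flow b _ in e1 e2 Z1.
have key (c d : R) x x' : 0 <= d -> d <= c -> flow c u = fiber0 R g x ->
    flow d u = fiber0 R g x' -> exists k, x = iter k g x'.
  move=> d0 dc ex ex'; have cd : 0 <= c - d by rewrite subr_ge0.
  have : flow (c - d) (fiber0 R g x') = fiber0 R g x.
    by rewrite -ex' flow_flow// addrC subrK.
  rewrite flow_fiber0// => /(line_fiber0 cd)[n _ <-]; by exists n.
have [ab|/ltW ba] := leP a b.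
  by have [k ->] := key _ _ _ _ a0 ab e2 e1; exists k; left.
by have [k ->] := key _ _ _ _ b0 ba e1 e2; exists k; right.
Qed.

(** The base point of a representative of [w]; at infinity, the ray of [w] is
    that of the point of the fiber over it. *)
Definition base_rep (w : W) : T := match w with
  | Defs.Inner z => base z
  | Defs.BdPlus c => base (val (repr c))
  | Defs.BdMinus c => base (val (repr c))
  end.

Definition side_at (w : W) : set T := if w is Defs.BdMinus _ then Am else Ap.
Definition at_infinity (w : W) : bool := if w is Defs.Inner _ then false else
  true.

Lemma at_infinityP w : at_infinity w -> (side_at w = Ap /\ Ap (base_rep w) /\
  plus_end (base_rep w) = w) \/
  (side_at w = Am /\ Am (base_rep w) /\ minus_end (base_rep w) = w).
Proof.
case: w => //= c _; [left|right]; split => //.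
  have Zc := sub_val (repr c); split; first exact/(forward_sideE H).
  by rewrite -plus_class_base// -BdPlus_repr.
have Zc := sub_val (repr c); split; first exact: backward_side_base H _ Zc.
by rewrite -minus_class_base// -BdMinus_repr.
Qed.

Lemma plus_end_bd y : Ap y -> at_infinity (plus_end y) /\
  side_at (plus_end y) = Ap.
Proof. by move=> Ay; rewrite /plus_end; have [u _ ->] :=
  plus_classE (forward_side_fiber0 Ay). Qed.

Lemma minus_end_bd y : Am y -> at_infinity (minus_end y) /\
  side_at (minus_end y) = Am.
Proof. by move=> Ay; rewrite /minus_end; have [u _ ->] :=
  minus_classE (backward_side_fiber0 R g Ay). Qed.

Lemma plus_end_rep y : Ap y -> Ap (base_rep (plus_end y)) /\
  plus_end (base_rep (plus_end y)) = plus_end y.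
Proof.
move=> Ay; rewrite /plus_end; have [u _ ->] :=
  plus_classE (forward_side_fiber0 Ay) => /=.
have Zc := sub_val (repr (ray_class (@flow R T g) u)); split;
  first exact/(forward_sideE H).
by rewrite -[plus_class (fiber0 _ _ _)]/(plus_end _) -plus_class_base//
  -BdPlus_repr.
Qed.

Lemma minus_end_rep y : Am y -> Am (base_rep (minus_end y)) /\
  minus_end (base_rep (minus_end y)) = minus_end y.
Proof.
move=> Ay; rewrite /minus_end; have [u _ ->] :=
  minus_classE (backward_side_fiber0 R g Ay) => /=.
have Zc := sub_val (repr (ray_class back_flow u)); split; first exact:
  backward_side_base H _ Zc.
by rewrite -[minus_class (fiber0 _ _ _)]/(minus_end _) -minus_class_base//
  -BdMinus_repr.
Qed.

(** The infinite cyclic cover of the compactified torus consists of the pairs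
    of a point [w] and an integer [th], the level of [base_rep w] in the cover.
    [has_level w th y] says that the flow line through such a point
    crosses level 0 at [y].
    Flowing forward to level 0 is always possible; flowing back is meaningful
    only near the ends, where [g] is invertible. *)
Definition has_level (w : W) (th : int) (y : T) : Prop := match th with
  | Posz n => base_rep w = iter n g y /\ ((0 < n)%N -> side_at w y)
  | Negz n => y = iter n.+1 g (base_rep w)
  end.

Lemma side_at_sub w : side_at w `<=` Ap `|` Am.
Proof. by case: w => *; [left|left|right]. Qed.

Lemma side_at_iter w n y : base_rep w = iter n g y -> side_at w y ->
  forall k, (k <= n)%N -> side_at w (iter k g y).
Proof.
case: w => [z|c|c] /= e Ay k kn; [exact: iter_fwd H _ _ Ay|exact:
  iter_fwd H _ _ Ay|].
by apply: iter_bwd_le H _ _ _ kn _; rewrite -e; exact: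
  backward_side_base H _ (sub_val _).
Qed.

Lemma has_level_uniq w th y y' : has_level w th y -> has_level w th y' ->
  y = y'.
Proof.
case: th => [n [e s] [e' _]|n -> ->//].
have [n0|n0] := posnP n; first by move: e e'; rewrite n0 /= => <- <-.
apply: (side_iter_inj H (n := n)); last by rewrite -e -e'.
by move=> k /andP[_ kn]; apply: (@side_at_sub w); apply:
  (side_at_iter e (s n0)).
Qed.

Lemma has_level_shift w th y : has_level w th y -> has_level w (th - 1) (g y).
Proof.
case: th => [[|n]|n]; rewrite /has_level.
- by move=> [/= -> _].
- move=> [e s]; have -> : n.+1%:Z - 1 = n%:Z by lia.
  rewrite e iterSr; split => // n0.
  exact: (side_at_iter e (s isT) (k := 1%N) isT).
- have -> : Negz n - 1 = Negz n.+1 by lia.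
  by move=> ->.
Qed.

Lemma has_level_iter w th y k : has_level w th y ->
  has_level w (th - k%:Z) (iter k g y).
Proof.
move=> h; elim: k => [|k IH]; first by rewrite subr0.
have -> : th - k.+1%:Z = th - k%:Z - 1 by lia.
exact: has_level_shift.
Qed.

Lemma has_level_diff w th th' y y' : has_level w th y -> has_level w th' y' ->
  th' <= th ->
  y' = iter `|th - th'|%N g y.
Proof.
move=> h h' le; apply: (has_level_uniq h').
have {1}-> : th' = th - `|th - th'|%N%:Z by lia.
exact: has_level_iter.
Qed.

Lemma has_level_lev_uniq w th th' y : (Ap `|` Am) y -> has_level w th y ->
  has_level w th' y -> th = th'.
Proof.
wlog le : th th' / th' <= th.
  move=> hw Ay h h'; have [le|/ltW le] := leP th' th; first exact: hw.
  by apply/esym; apply: hw.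
move=> Ay h h'; have e := has_level_diff h h' le.
have [/eqP d0|d0] := posnP `|th - th'|%N; first by lia.
have [V nV VP] := side_wander H Ay.
by case: (VP y _ (nbhs_singleton nV) d0); rewrite -e; exact: nbhs_singleton.
Qed.

Lemma has_level_bwd w th y : side_at w = Am -> Am y -> has_level w th y ->
  has_level w (th + 1) (ginv y).
Proof.
move=> sw Ay; have Aiy := ginv_bwd H Ay.
have gi : g (ginv y) = y by rewrite (side_Kg H)//; right.
case: th => [n|n]; rewrite /has_level.
- move=> [e _]; have -> : n%:Z + 1 = n.+1%:Z by lia.
  by rewrite iterSr gi sw.
- move=> e; have gn : ginv y = iter n g (base_rep w).
    by rewrite e /= (side_gK H)//; right;
      rewrite -[g _]/(iter n.+1 g (base_rep w)) -e.
  case: n e gn => [|n] e gn; last first.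
    by have -> : Negz n.+1 + 1 = Negz n by lia.
  have -> : Negz 0 + 1 = 0%:Z by lia.
  by rewrite gn.
Qed.

(** A continuous local section of the cover over [O], with its crossings of
    level 0.  At inner points continuity of the section is that of the real
    level, the sum of the integer level and the height.  At infinity it is
    expressed by the continuity of the crossings, which are near the end. *)
Record chart (O : set W) (lev : W -> int) (crd : W -> T) : Prop := Chart {
  chart_open : open O;
  chart_level : forall w, O w -> has_level w (lev w) (crd w);
  chart_cont : forall w, O w -> {for w, continuous crd};
  chart_lev : forall z, O (Inner z) ->
    {for z, continuous (fun z => (lev (Inner z))%:~R + height z : R)};
  chart_bd : forall w, O w -> at_infinity w -> side_at w (crd w) }.

Lemma open_Inner (O : set Z) : open O -> open (Inner @` O).
Proof.
move=> oO; have : compactified_open (Inner @` O); last by [].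
split; last 2 first.
- by move=> z [].
- by move=> z [].
by rewrite (_ : _ @^-1` _ = O)//; apply/seteqP; split =>
  [z [_ /= ? [<-]]|z Oz] //; exists z.
Qed.

Lemma near_Inner z (P : set W) : (\forall z' \near z, P (Inner z')) ->
  nbhs (Inner z) P.
Proof.
move=> nP; pose O : set Z := ((fun z' => P (Inner z')) : set Z)°.
apply: (@filterS _ _ _ (Inner @` O)).
  by move=> _ [z' Oz' <-]; exact: (interior_subset Oz').
apply: open_nbhs_nbhs; split; first exact: (open_Inner (open_interior _)).
by exists z.
Qed.

(** Two charts differ by a locally constant shift.  At inner points the shift
    is continuous; at infinity, a varying shift would make a point return to a
    wandering neighborhood. *)
Lemma chart_compat O lev crd O' lev' crd' w0 :
  chart O lev crd -> chart O' lev' crd' -> O w0 -> O' w0 ->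
  \forall w \near w0, lev w - lev' w = lev w0 - lev' w0.
Proof.
wlog le : O O' lev lev' crd crd' / lev' w0 <= lev w0.
  move=> hw C C' Ow Ow'; have [le|/ltW le] := leP (lev' w0) (lev w0);
    first exact: hw le C C' Ow Ow'.
  have := hw _ _ _ _ _ _ le C' C Ow' Ow.
  by apply: filterS => w; lia.
move=> C C' Ow Ow'.
have nO : nbhs w0 O by apply: open_nbhs_nbhs; split => //; exact: chart_open C.
have nO' : nbhs w0 O' by apply: open_nbhs_nbhs; split => //; exact:
  chart_open C'.
have [bw0|] := boolP (at_infinity w0).
- have Ac' : (Ap `|` Am) (crd' w0) by apply: (@side_at_sub w0); exact:
  chart_bd C' _ Ow' bw0.
  have [V nV VP] := side_wander H Ac'.
  set k := `|lev w0 - lev' w0|%N.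
  have e0 : crd' w0 = iter k g (crd w0).
    by apply: (@has_level_diff w0) => //; [exact: chart_level C _ Ow|exact:
      chart_level C' _ Ow'].
  have n1 : \forall w \near w0, V (crd' w) by exact: (chart_cont C' Ow' nV).
  have n2 : \forall w \near w0, V (iter k g (crd w)).
    have ck := @iter_cont _ _ k (side_cont H) (crd w0).
    have nk : nbhs (crd w0) (iter k g @^-1` V) by apply: ck; rewrite -e0.
    exact: (chart_cont C Ow nk).
  near=> w.
  have Vw' : V (crd' w) by near: w.
  have Vw : V (iter k g (crd w)) by near: w.
  have t1 : has_level w (lev w) (crd w) by apply: (chart_level C); near: w.
  have t2 : has_level w (lev' w) (crd' w) by apply: (chart_level C'); near: w.
  have [lw|/ltW lw] := leP (lev' w) (lev w).
    have e := has_level_diff t1 t2 lw; set j := `|_|%N in e.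
    have [kj|jk|kj] := ltngtP k j; last by move: kj le lw; rewrite /k /j; lia.
      exfalso; apply: (VP _ (j - k)%N Vw); first by rewrite subn_gt0.
      by rewrite -iterD (subnK (ltnW kj)) -e.
    exfalso; apply: (VP _ (k - j)%N Vw'); first by rewrite subn_gt0.
    by rewrite e -iterD (subnK (ltnW jk)).
  have e := has_level_diff t2 t1 lw; set j := `|_|%N in e.
  have [kj0|kj0] := posnP (k + j)%N; first by move: kj0 le lw; rewrite /k /j;
    lia.
  exfalso; apply: (VP _ (k + j)%N Vw' kj0).
  by rewrite iterD -e.
- case: w0 le Ow Ow' nO nO' => // z0 le Ow Ow' nO nO' _.
  suff : \forall z \near z0, lev (Inner z) - lev' (Inner z) = lev (Inner z0) -
    lev' (Inner z0).
    exact: (@near_Inner z0 (fun w => lev w - lev' w = lev (Inner z0) - lev'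
      (Inner z0))).
  have half : 0 < (1 / 2 : R) by lra.
  have n1 : nbhs z0 [set z | `|(lev (Inner z0))%:~R + height z0 -
      ((lev (Inner z))%:~R + height z)| < 1 / 2 :> R].
    exact: (chart_lev C Ow (nbhsx_ballx _ _ half)).
  have n2 : nbhs z0 [set z | `|(lev' (Inner z0))%:~R + height z0 -
      ((lev' (Inner z))%:~R + height z)| < 1 / 2 :> R].
    exact: (chart_lev C' Ow' (nbhsx_ballx _ _ half)).
  apply: filterS2 n1 n2 => z /= h h'.
  have d : `|(lev (Inner z0) - lev' (Inner z0) -
    (lev (Inner z) - lev' (Inner z)))%:~R| < 1 :> R.
    move: h h'; rewrite !intrD !rmorphN /= !ltr_norml;
      rewrite !intrD !rmorphN /=; lra.
  rewrite -intr_norm -[1]/(1%:~R) ltr_int in d; lia.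
Unshelve. all: by end_near.
Qed.

End TorusCharts.

(** * Local sections at inner points *)

Section ChartExistence.
Context (R : realType) {T : topologicalType} (g ginv : T -> T) (Ap Am : set T).
Hypothesis H : sides g ginv Ap Am.
Local Notation Z := (mapping_torus R g).
Local Notation forward_side := (@forward_side R T g Ap).
Local Notation backward_side := (@backward_side R T g Am).
Local Notation back_flow := (@back_flow R T g Am).
Local Notation Inner := (@Inner R Z forward_side (@flow R T g) backward_side
  back_flow).


Local Notation base_rep := (@base_rep R T g Ap Am).
Local Notation side_at := (@side_at R T g Ap Am).
Local Notation has_level := (@has_level R T g Ap Am).
Local Notation chart := (@chart R T g Ap Am).

(** Points flowing out of [V] during the times in [B].  Continuity of the flow
    does not suffice here: points that merge into a flow line from [V] have to
    be excluded, by injectivity of [g] near the ends. *)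
Lemma open_out (V : set T) (B : set R) : open V -> open B ->
  (forall t, B t -> 0 < t) ->
  (forall y t k, V y -> B t -> (0 < k)%N -> k%:R <= t ->
    (Ap `|` Am) (iter k g y)) ->
  open [set z : Z | exists y t, [/\ V y, B t & z = line g y t]].
Proof.
move=> oV oB B0 VA; apply: torus_open => x t t01 /= [y [s [Vy Bs e]]].
have s0 := B0 s Bs.
have [n [y1 [Vy1 xy Bn]]] : exists n y, [/\ V y, x = iter n g y & B (n%:R + t)].
  have [n [u [u01 E]]] := nat_frac (ltW s0).
  move: e; rewrite E line_lt//; move: (t01) => /andP[t0].
  rewrite le_eqVlt => /predU1P[t1|t1] e; last first.
    exists n, y; have t01' : 0 <= t < 1 by rewrite t0.
    have <- : x = iter n g y by rewrite -(base_torus_pt g x t01') e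
      base_torus_pt.
    have -> : t = u by rewrite -(height_torus_pt g x t01') e height_torus_pt.
    by rewrite -E.
  rewrite t1 torus_pt1 in e; have z01 : 0 <= (0 : R) < 1 by rewrite lexx ltr01.
  have u0 : u = 0 by rewrite -(height_torus_pt g (iter n g y) u01) -e
    height_torus_pt.
  have gx : g x = iter n g y by rewrite -(base_torus_pt g (iter n g y) u01) -e
    base_torus_pt.
  case: n E gx {e} => [|n] E gx; first by move: s0; rewrite E u0 addr0 ltxx.
  exists n, y; split => //; last by rewrite t1 natr1 -[_%:R]addr0 -u0 -E.
  have An : (Ap `|` Am) (iter n.+1 g y).
    by apply: (VA y s) => //; rewrite E u0 addr0.
  by rewrite -[LHS](side_gK H) gx// (side_gK H).
have := open_nbhs_nbhs (conj oB Bn) => /nbhs_ballP[d /= d0 dB].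
exists (iter n g @` V), d; split => //.
  apply: open_nbhs_nbhs; split; last by exists y1.
  apply: (img_open H oV) => y' k Vy' /andP[k0 kn].
  apply: (VA y' (n%:R + t)) => //.
  have : k%:R <= n%:R :> R by rewrite ler_nat.
  by move: t01 => /andP[]; lra.
move=> _ t' [y' Vy' <-] t'01 tt'; exists y', (n%:R + t'); split => //.
  by apply: dB; rewrite /ball /= opprD addrACA subrr add0r.
by rewrite line_torus_pt.
Qed.

Lemma open_in (V : set T) (B : set R) : open V -> open B ->
  (forall t, B t -> 0 < t) ->
  open [set z : Z | exists t y, [/\ V y, B t & flow t z = fiber0 R g y]].
Proof.
move=> oV oB B0; apply: torus_open => x t t01 /= [s [y [Vy Bs e]]].
have s0 := B0 s Bs; move: e; rewrite flow_torus_pt ?(ltW s0)// => e.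
have ts0 : 0 <= t + s by move: t01 => /andP[]; lra.
have [n E nx] := line_fiber0 ts0 e.
have Bn : B (n%:R - t) by rewrite -E addrC addKr.
have := open_nbhs_nbhs (conj oB Bn) => /nbhs_ballP[d /= d0 dB].
exists (iter n g @^-1` V), d; split => //.
  by apply: (iter_cont (n := n) (side_cont H)); rewrite nx; exact:
    open_nbhs_nbhs.
move=> x' t' /= Vx' t'01 tt'.
have Bt' : B (n%:R - t').
  apply: dB; rewrite /ball /= distrC.
  by have -> : n%:R - t' - (n%:R - t) = t - t' by lra.
exists (n%:R - t'), (iter n g x'); split => //.
rewrite flow_torus_pt ?(ltW (B0 _ Bt'))//.
by rewrite addrC subrK line_nat.
Qed.

(** Away from height [s] the torus is a product.  Its points are pushed forward
    to the next fiber at height 0 when they are below [s], and to the second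
    next one when they are above, which makes the result continuous across
    height 0. *)
Section Sheets.
Variable s : R.
Hypothesis s01 : 0 < s < 1.

Let count (t : R) : nat := if t < s then 1%N else 2%N.
Let crdz (z : Z) : T := iter (count (height z)) g (base z).
Let levz (z : Z) : int := - (count (height z))%:Z.

Lemma sheet_open (B : set T) (C : set R) : open B -> open C ->
  open [set z :
    Z | [/\ height z != s, B (crdz z) & C ((levz z)%:~R + height z)]].
Proof.
move=> oB oC; apply: torus_open => x t t01.
have F (x' : T) (t' : R) : 0 <= t' <= 1 -> t' != s ->
    [/\ height (torus_pt g x' t') != s, crdz (torus_pt g x' t') = iter
      (count t') g x' &
        (levz (torus_pt g x' t'))%:~R + height (torus_pt g x' t') = -
          (count t')%:R + t'].
  move=> /andP[t0]; rewrite le_eqVlt => /predU1P[t1|t1] ts.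
    have z01 : 0 <= (0 : R) < 1 by rewrite lexx ltr01.
    rewrite t1 torus_pt1 /crdz /levz base_torus_pt// height_torus_pt// /count.
    have s0 : 0 < s by case/andP: s01.
    rewrite s0.
    have -> : (1 < s) = false by apply/negbTE; rewrite -leNgt ltW//; case/andP:
      s01.
    split => //; first by rewrite eq_sym gt_eqF//; lra.
    by rewrite rmorphN /= -pmulrn; lra.
  have t01' : 0 <= t' < 1 by rewrite t0.
  rewrite /crdz /levz base_torus_pt// height_torus_pt//; split => //.
  by rewrite rmorphN /= -pmulrn.
move=> /= [ts]; have {}ts : t != s.
  apply: contra ts => /eqP ->; rewrite height_torus_pt//; move: s01; lra.
have [_ -> ->] := F x t t01 ts => Bx Ct.
have := open_nbhs_nbhs (conj oC Ct) => /nbhs_ballP[d /= d0 dC].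
exists (iter (count t) g @^-1` B), (Num.min d `|t - s|); split.
- by apply: (iter_cont (n := count t) (side_cont H)); exact: open_nbhs_nbhs.
- by rewrite lt_min d0 normr_gt0 subr_eq0.
move=> x' t' /= Bx' t'01; rewrite lt_min => /andP[tt' tts].
have cc : count t' = count t.
  have ne : t != s by [].
  rewrite /count; have [ls|ls] := ltP t s.
    rewrite (_ : (t' < s) = true)//.
    move: tts; rewrite [`|t - s|]ltr0_norm ?subr_lt0// ltr_norml; lra.
  rewrite (_ : (t' < s) = false)//; apply/negbTE; rewrite -leNgt.
  move: tts; rewrite [`|t - s|]ger0_norm ?subr_ge0// ltr_norml; lra.
have t's : t' != s by apply: contraTneq tts => ->; rewrite ltxx.
have [t1 -> ->] := F x' t' t'01 t's; rewrite cc; split => //.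
by apply: dC; rewrite /ball /= opprD addrACA subrr add0r.
Qed.

Lemma sheet_chart : exists lev crd,
  chart (Inner @` [set z | height z != s]) lev crd.
Proof.
exists (fun w => if w is Defs.Inner z then levz z else 0).
exists (fun w => if w is Defs.Inner z then crdz z else base_rep w).
have open1 : open [set z : Z | height z != s].
  rewrite (_ : mkset _ = [set z : Z | [/\ height z != s, setT (crdz z) &
    setT ((levz z)%:~R + height z)]]).
    by apply: sheet_open; exact: openT.
  by apply/seteqP; split => [z zs|z []].
split.
- exact: open_Inner.
- move=> _ [z _ <-]; have z0 : has_level (Inner z) 0 (base_rep (Inner z)) by
  split.
  by have := has_level_iter H (count (height z)) z0; rewrite sub0r.
- move=> _ [z zs <-] /= B; rewrite nbhsE => -[B' [oB' B'z] BB'].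
  have n : nbhs z [set z :
    Z | [/\ height z != s, B' (crdz z) & setT ((levz z)%:~R + height z : R)]].
    by apply: open_nbhs_nbhs; split; first exact: sheet_open oB' openT.
  by apply: near_Inner; apply: filterS n => z' [_ Bz' _]; exact: BB'.
- move=> z [z' zs [<-]] B; rewrite nbhsE => -[B' [oB' B'z] BB'].
  have n : nbhs z' [set z :
    Z | [/\ height z != s, setT (crdz z) & B' ((levz z)%:~R + height z : R)]].
    by apply: open_nbhs_nbhs; split; first exact: sheet_open openT oB'.
  by apply: filterS n => z'' [_ _ Bz']; exact: BB'.
- by move=> _ [z zs <-].
Qed.

End Sheets.

Lemma has_level_rel w y k : (base_rep w = iter k g y /\ side_at w y) \/ y = iter
  k g (base_rep w) ->
  exists th, has_level w th y.
Proof.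
move=> [[e s]|e]; first by exists k%:Z.
case: k e => [|k] e; first by exists 0%:Z.
by exists (Negz k).
Qed.

End ChartExistence.

(** * Local sections at infinity *)

Section EndCharts.
Context (R : realType) {T : topologicalType} (g ginv : T -> T) (Ap Am : set T).
Hypothesis H : sides g ginv Ap Am.
Local Notation Z := (mapping_torus R g).
Local Notation forward_side := (@forward_side R T g Ap).
Local Notation backward_side := (@backward_side R T g Am).
Local Notation back_flow := (@back_flow R T g Am).
Local Notation W := (compactified forward_side (@flow R T g) backward_side
  back_flow).
Local Notation Inner := (@Inner R Z forward_side (@flow R T g) backward_side
  back_flow).
Local Notation BdPlus := (@BdPlus R Z forward_side (@flow R T g) backward_side
  back_flow).
Local Notation BdMinus := (@BdMinus R Z forward_side (@flow R T g) backward_side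
  back_flow).


Local Notation plus_end := (@plus_end R T g Ap Am).
Local Notation minus_end := (@minus_end R T g Ap Am).
Local Notation base_rep := (@base_rep R T g Ap Am).
Local Notation side_at := (@side_at R T g Ap Am).
Local Notation at_infinity := (@at_infinity R T g Ap Am).
Local Notation has_level := (@has_level R T g Ap Am).
Local Notation chart := (@chart R T g Ap Am).

Lemma open_pos : open [set t : R | 0 < t].
Proof. exact: open_gt. Qed.

Lemma open_upto (b : R) : open [set t : R | 0 < t < b].
Proof.
rewrite (_ : mkset _ = [set t | 0 < t] `&` [set t | t < b]).
  by apply: openI; [exact: open_pos|exact: open_lt].
by apply/seteqP; split => t /= => [/andP[]|[-> ->]].
Qed.

(** Charts at infinity: the flow lines through a wandering open set [V] near
    the ends are parametrized by [V] and by the time [t] that they take from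
    [V], which is also the real level. *)
Section Builder.
Variables (V : set T) (onI : Z -> T -> R -> Prop) (q : T -> W).
Let on (w : W) (y : T) := (exists z t, w = Inner z /\ onI z y t) \/ w = q y.

Hypothesis oV : open V.
Hypothesis V_A : V `<=` Ap `|` Am.
Hypothesis V_wander : forall x n, V x -> (0 < n)%N -> ~ V (iter n g x).
Hypothesis onI_level : forall z y t, V y -> onI z y t ->
  exists2 th, has_level (Inner z) th y & th%:~R + height z = t.
Hypothesis q_level : forall y, V y -> exists th, has_level (q y) th y.
Hypothesis q_bd : forall y, V y -> at_infinity (q y) /\ side_at (q y) y.
Hypothesis open_on : forall V' : set T, open V' -> V' `<=` V ->
  open [set w | exists2 y, V' y & on w y].
Hypothesis open_onI : forall C : set R, open C ->
  open [set z | exists y t, [/\ V y, C t & onI z y t]].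

Lemma end_chart : exists lev crd, chart [set w | exists2 y, V y & on w y] lev
  crd.
Proof.
have on_level w y : V y -> on w y -> exists th, has_level w th y.
  move=> Vy [[z [t [-> h]]]|->]; last exact: q_level.
  by have [th ? _] := onI_level Vy h; exists th.
have on_uniq w y y' : V y -> V y' -> on w y -> on w y' -> y = y'.
  move=> Vy Vy' /(on_level _ _ Vy)[th h] /(on_level _ _ Vy')[th' h'].
  wlog le : th th' y y' Vy Vy' h h' / th' <= th.
    move=> hw; have [le|/ltW le] := leP th' th; first exact: (hw th th').
    by apply/esym; exact: (hw th' th).
  have e := has_level_diff H h h' le; have [n0|n0] := posnP `|th - th'|%N.
    by rewrite e n0.
  by case: (V_wander Vy n0); rewrite -e.
pose crd w := xget (base_rep w) [set y | V y /\ on w y].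
pose lev w := xget 0 [set th | has_level w th (crd w)].
have crdE w y : V y -> on w y -> crd w = y.
  move=> Vy oy; have [Vc oc] : V (crd w) /\ on w (crd w).
    exact: (@xgetPex _ (base_rep w) [set y | V y /\ on w y]
      (ex_intro _ y (conj Vy oy))).
  exact: on_uniq oc oy.
have levE w y th : V y -> on w y -> has_level w th y -> lev w = th.
  move=> Vy oy h; have cE := crdE _ _ Vy oy.
  have h' : has_level w (lev w) (crd w).
    apply: (@xgetPex _ 0 [set th | has_level w th (crd w)]).
    by exists th; rewrite /= cE.
  rewrite cE in h'; exact: (has_level_lev_uniq H (V_A Vy) h' h).
exists lev, crd; split.
- exact: open_on.
- move=> w [y Vy oy]; have [th h] := on_level _ _ Vy oy.
  by rewrite (levE _ _ _ Vy oy h) (crdE _ _ Vy oy).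
- move=> w [y Vy oy] B; rewrite (crdE _ _ Vy oy) nbhsE => -[B' [oB' B'y] BB'].
  have n : nbhs w [set w | exists2 y, (V `&` B') y & on w y].
    have oS := open_on (openI oV oB') (fun x h => h.1).
    by apply: open_nbhs_nbhs; split; [exact: oS|exists y].
  apply: filterS n => w' [y' [Vy' By'] oy'] /=.
  by rewrite (crdE _ _ Vy' oy'); exact: BB'.
- move=> z [y Vy oy] B.
  have key z' y' t : V y' -> onI z' y' t -> (lev (Inner z'))%:~R + height z' =
    t.
    move=> Vy' h; have [th tr <-] := onI_level Vy' h.
    by rewrite (levE _ _ _ Vy' _ tr)//; left; exists z', t.
  have [[z1 [t [[<-] h]]]|e] := oy; last first.
    by have [] := q_bd Vy; rewrite -e.
  rewrite (key _ _ _ Vy h) nbhsE => -[B' [oB' B't] BB'].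
  have n : nbhs z [set z | exists y t, [/\ V y, B' t & onI z y t]].
    by apply: open_nbhs_nbhs; split; [exact: open_onI|exists y, t].
  apply: filterS n => z' [y' [t' [Vy' Bt' h']]] /=.
  by rewrite (key _ _ _ Vy' h'); exact: BB'.
- move=> w [y Vy oy]; rewrite (crdE _ _ Vy oy); case: oy =>
  [[z [t [-> _]]]|->] // _.
  by have [] := q_bd Vy.
Qed.

End Builder.

Lemma ray_nbhd_of_open (S : set Z) psi bd (z : S) (N : set Z) (t : R) (P :
  set W) :
  open N -> N (val z) -> 0 < t ->
  (forall w : S, N (val w) -> P (bd (ray_class psi w)) /\
     forall s, t < s -> P (Inner (psi s (val w)))) ->
  @ray_nbhd R Z forward_side (@flow R T g) backward_side back_flow S psi bd z P.
Proof.
move=> oN Nz t0 HN; exists N; last by exists t.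
rewrite /within /=; have n := open_nbhs_nbhs (conj oN Nz).
by apply: filterS n => w Nw _.
Qed.

Section Plus.
Variable V : set T.
Hypothesis oV : open V.
Hypothesis VA : V `<=` Ap.

Let onI (z : Z) (y : T) (t : R) := 0 < t /\ z = line g y t.

(** At infinity: a ray that meets [V] does so after a bounded time, up to moving
    [V] along the flow, and so do the nearby ones. *)
Lemma plus_open :
  open [set w | exists2 y, V y &
    (exists z t, w = Inner z /\ onI z y t) \/ w = plus_end y].
Proof.
set S := mkset _.
have Sqp y w : V y -> w = plus_end y -> S w by move=> Vy ->; exists y => //;
  right.
have SI y t : V y -> 0 < t -> S (Inner (line g y t)).
  by move=> Vy t0; exists y => //; left; exists (line g y t), t.
have : compactified_open S; last by [].
split.
- have -> : Inner @^-1` S = [set z | exists y t,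
  [/\ V y, 0 < t & z = line g y t]].
    apply/seteqP; split =>
      [z [y Vy [[_ [t [[<-] [t0 e]]]]|e]]|z [y [t [Vy t0 ->]]]].
    + by exists y, t.
    + by have [] := plus_end_bd R H (VA Vy); rewrite -e.
    + exact: SI.
  refine (open_out H (B := [set t : R | 0 < t]) oV open_pos _ _) => //.
  by move=> y t k Vy _ _ _; left; apply: (iter_fwd H); exact: VA.
- move=> z -[y Vy [[zz [t [e _]]]|]]; first by [].
  have Zz := sub_val z; have Az := (forward_sideE H _).1 Zz; have Ay := VA Vy.
  rewrite plus_class_val (plus_class_base H Zz) => /(plus_end_eq H Az Ay)[k hk].
  (* [0 < i] makes the time from [z] to the [i]-th crossing positive *)
  have [i [j [i0 e]]] : exists i j, (0 < i)%N /\ iter i g (base (val z)) = iter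
    j g y.
    by case: hk => ->; [exists k.+1, 1%N|exists 1%N, k.+1].
  have oj : open (iter j g @` V).
    apply: (img_open H) => // x l Vx _; left; apply: (iter_fwd H); exact: VA.
  pose N := [set w : Z | exists t y, [/\ (iter j g @` V) y,
    0 < t < i.+1%:R & flow t w = fiber0 R g y]].
  have oN : open N by apply: (open_in H oj (@open_upto i.+1%:R)) => t /andP[].
  have /andP[s0 s1] := height_itv (val z).
  have i1 : 1 <= i%:R :> R by rewrite ler1n.
  refine (@ray_nbhd_of_open forward_side (@flow R T g) BdPlus z N i.+1%:R S _ _
    _ _) => //.
  + exists (i%:R - height (val z)), (iter j g y); split; first by exists y.
      by rewrite /= -natr1; lra.
    rewrite flow_base_height; last lra.
    by rewrite addrC subrK line_nat e.
  + move=> w [t [_ [[y' Vy' <-] /= /andP[t0 ti]]]] fw.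
    split.
      apply: (Sqp y') => //; rewrite plus_class_val.
      apply/(plus_class_eq Am (sub_val w) (forward_side_fiber0 R H (VA Vy'))).
      by exists t, j%:R; rewrite fw flow_fiber0// line_nat (ltW t0).
    move=> s si; have -> : flow s (val w) = line g y' (j%:R + (s - t)).
      have -> : s = t + (s - t) by lra.
      rewrite -flow_flow ?(ltW t0)//; last lra.
      rewrite fw flow_fiber0 ?line_iter//; last 2 first.
      * lra.
      * lra.
      by congr line; lra.
    by apply: SI => //; have := ler0n R j; lra.
- move=> z [y Vy [[zz [t [e _]]]|e]]; first by [].
  have [b s] := plus_end_bd R H (VA Vy).
  by move: e; rewrite /plus_end; have [u _ ->] :=
    plus_classE Am (forward_side_fiber0 R H (VA Vy)).
Qed.

End Plus.

Lemma plus_chart (V : set T) : open V -> V `<=` Ap ->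
  (forall x n, V x -> (0 < n)%N -> ~ V (iter n g x)) ->
  exists O lev crd, [/\ chart O lev crd & forall y, V y -> O (plus_end y)].
Proof.
move=> oV VA Vw; pose onI (z : Z) (y : T) (t : R) := 0 < t /\ z = line g y t.
exists [set w | exists2 y, V y & (exists z t, w = Inner z /\ onI z y t) \/ w =
  plus_end y].
have [||||||lev [crd C]] := @end_chart V onI plus_end oV _ Vw.
- by move=> x /VA; left.
- move=> z y t Vy [t0 ->]; have [n [s [s01 ->]]] := nat_frac (ltW t0).
  exists n%:Z; last by rewrite height_line// -pmulrn.
  by split => [|_]; [exact: base_line|exact: VA].
- move=> y Vy; have [b sE] := plus_end_bd R H (VA _ Vy).
  have [Ar qr] := plus_end_rep R H (VA _ Vy).
  have [k hk] := plus_end_eq H Ar (VA _ Vy) qr; apply: (has_level_rel (k := k)).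
  by case: hk => e; [right|left; rewrite sE; split => //; exact: VA].
- by move=> y Vy; have [b ->] := plus_end_bd R H (VA _ Vy); split => //; exact:
  VA.
- by move=> V' oV' VV'; apply: plus_open => // x /VV'/VA.
- move=> C oC.
  have -> : [set z | exists y t, [/\ V y, C t & onI z y t]] =
      [set z | exists y t, [/\ V y, (C `&` [set t | 0 < t]) t & z = line g y
        t]].
    apply/seteqP; split=> z [y [t]]; last by move=> [Vy [Ct t0] ->];
      exists y, t.
    by move=> [Vy Ct [t0 ->]]; exists y, t.
  apply: (open_out H oV (openI oC open_pos)) => [t []//|y t k Vy _ _ _].
  by left; apply: (iter_fwd H); exact: VA.
exists lev, crd; split => // y Vy; exists y => //; by right.
Qed.

Section Minus.
Variable V : set T.
Hypothesis oV : open V.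
Hypothesis VA : V `<=` Am.

Let onI (z : Z) (y : T) (t : R) := t < 0 /\ flow (- t) z = fiber0 R g y.

(** At infinity: a backward ray that meets [V] does so after a bounded time, up
    to moving [V] back along the flow.  The points of the torus on nearby
    backward rays form an open set because they are reached from [Am] without
    leaving it. *)
Lemma minus_open :
  open [set w | exists2 y, V y &
    (exists z t, w = Inner z /\ onI z y t) \/ w = minus_end y].
Proof.
set S := mkset _.
have Sqm y w : V y -> w = minus_end y -> S w by move=> Vy ->; exists y => //;
  right.
have SI z y t : V y -> 0 < t -> flow t z = fiber0 R g y -> S (Inner z).
  move=> Vy t0 e; exists y => //; left; exists z, (- t).
  by rewrite /onI opprK oppr_lt0.
have : compactified_open S; last by [].
split.
- have -> : Inner @^-1` S = [set z | exists t y,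
  [/\ V y, 0 < t & flow t z = fiber0 R g y]].
    apply/seteqP; split =>
      [z [y Vy [[_ [t [[<-] [t0 e]]]]|e]]|z [t [y [Vy t0 e]]]].
    + by exists (- t), y; rewrite oppr_gt0.
    + by have [] := minus_end_bd R g Ap (VA Vy); rewrite -e.
    + exact: SI e.
  exact: (open_in H (B := [set t | 0 < t]) oV open_pos).
- move=> z [y Vy [[zz [t [e _]]]|e]]; first by [].
  have [b s] := minus_end_bd R g Ap (VA Vy).
  by move: e; rewrite /minus_end; have [u _ ->] :=
    minus_classE Ap (backward_side_fiber0 R g (VA Vy)).
- move=> z -[y Vy [[zz [t [e _]]]|]]; first by [].
  have Zz := sub_val z; have Az := backward_side_base H Zz; have Ay := VA Vy.
  rewrite minus_class_val (minus_class_base H Zz) =>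
    /(minus_end_eq H Az Ay)[k hk].
  have [i [j [u [i0 Au e ey]]]] : exists i j u, [/\ (0 < i)%N, Am u,
      base (val z) = iter i g u & y = iter j g u].
    case: hk => e.
      exists 1%N, k.+1, (ginv (base (val z))); split => //; first exact:
        (ginv_bwd H).
        by rewrite /= (side_Kg H)//; right.
      by rewrite iterSr (side_Kg H)//; right.
    exists k.+1, 1%N, (ginv y); split => //; first exact: (ginv_bwd H).
      by rewrite iterSr (side_Kg H)//; right.
    by rewrite /= (side_Kg H)//; right.
  (* the points that flow into [V], and stay in [Am] until they pass near [z] *)
  pose V' := iter i g @^-1` Am `&` iter j g @^-1` V.
  have oV' : open V'.
    have oc n (D : set T) : open D -> open (iter n g @^-1` D).
      by have /continuousP := @iter_cont _ _ n (side_cont H); exact.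
    by apply: openI; apply: oc => //; exact: side_openm H.
  pose N := [set w : Z | exists u t, [/\ V' u, 0 < t < i.+1%:R & w = line g u
    t]].
  have oN : open N.
    apply: (open_out H oV' (@open_upto i.+1%:R)) =>
      [t /andP[]//|u' t l [Au' _]].
    move=> /= /andP[t0 ti] l0 lt; right.
    apply: (iter_bwd_le H (n := i)) => //.
    by rewrite -ltnS -(ltr_nat R); lra.
  have /andP[s0 s1] := height_itv (val z).
  have i1 : 1 <= i%:R :> R by rewrite ler1n.
  refine (@ray_nbhd_of_open backward_side back_flow BdMinus z N i.+1%:R S _ _ _
    _) => //.
  + exists u, (i%:R + height (val z)); split; first by split;
    rewrite /= -?e// -ey.
      by rewrite /= -natr1; lra.
    by rewrite line_lt ?height_itv// -e -torus_eta.
  + move=> w [u' [t [[/= Au' Vu'] /= /andP[t0 ti]]]] wu.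
    have Au0 := iter_bwd H Au'.
    have wt : flow t (fiber0 R g u') = val w by rewrite flow_fiber0 ?(ltW t0).
    have bw : back_flow t (val w) = fiber0 R g u'.
      by rewrite -wt (back_flow_uniq H) ?(ltW t0)// wt; exact: sub_val.
    have Zj : backward_side (fiber0 R g (iter j g u')) by apply:
      backward_side_fiber0; exact: VA.
    have fj : flow j%:R (fiber0 R g u') = fiber0 R g (iter j g u').
      by rewrite flow_fiber0// line_nat.
    split.
      apply: (Sqm (iter j g u')) => //; rewrite minus_class_val.
      apply/(minus_class_eq H (sub_val w) Zj); exists t, j%:R; split;
        rewrite ?(ltW t0)//.
      by rewrite bw -fj (back_flow_uniq H)// fj.
    move=> s si; have st : 0 <= s - t by lra.
    have [Zb fb] := back_flowP H st (backward_side_fiber0 R g Au0).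
    have -> : back_flow s (val w) = back_flow (s - t) (fiber0 R g u').
      rewrite -bw (back_flow_back_flow H) ?(ltW t0)//; last exact: sub_val.
      by congr (back_flow _ _); lra.
    apply: (@SI _ (iter j g u') (s - t + j%:R)) => //; first by have :=
      ler0n R j; lra.
    by rewrite -flow_flow// fb.
Qed.

End Minus.

Lemma minus_chart (V : set T) : open V -> V `<=` Am ->
  (forall x n, V x -> (0 < n)%N -> ~ V (iter n g x)) ->
  exists O lev crd, [/\ chart O lev crd & forall y, V y -> O (minus_end y)].
Proof.
move=> oV VA Vw.
pose onI (z : Z) (y : T) (t : R) := t < 0 /\ flow (- t) z = fiber0 R g y.
exists [set w | exists2 y, V y & (exists z t, w = Inner z /\ onI z y t) \/ w =
  minus_end y].
have [||||||lev [crd C]] := @end_chart V onI minus_end oV _ Vw.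
- by move=> x /VA; right.
- move=> z y t Vy [t0 e]; have /andP[s0 s1] := height_itv z.
  rewrite flow_base_height in e; last lra.
  have h0 : 0 <= height z - t by lra.
  have [n E ny] := line_fiber0 h0 e.
  have [th tr] : exists th, has_level (Inner z) th y /\ th = - n%:Z.
    case: n {E} ny => [|n] ny; first by exists 0; do 2!split.
    by exists (Negz n); split; rewrite ?NegzE//= -ny.
  exists th; first by case: tr.
  by case: tr => _ ->; rewrite rmorphN /= -pmulrn; lra.
- move=> y Vy; have [b sE] := minus_end_bd R g Ap (VA _ Vy).
  have [Ar qr] := minus_end_rep R H (VA _ Vy).
  have [k hk] := minus_end_eq H Ar (VA _ Vy) qr; apply:
    (has_level_rel (k := k)).
  by case: hk => e; [right|left; rewrite sE; split => //; exact: VA].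
- by move=> y Vy; have [b ->] := minus_end_bd R g Ap (VA _ Vy); split => //;
  exact: VA.
- by move=> V' oV' VV'; apply: minus_open => // x /VV'/VA.
- move=> C oC.
  have oB : open ((-%R @^-1` C) `&` [set t : R | 0 < t]).
    apply: openI; last exact: open_pos.
    by apply: open_comp oC => x _; exact: opp_continuous.
  have -> : [set z | exists y t, [/\ V y, C t & onI z y t]] =
      [set z | exists t y, [/\ V y, ((-%R @^-1` C) `&` [set t | 0 < t]) t &
         flow t z = fiber0 R g y]].
    apply/seteqP; split=> z.
      by move=> [y [t [Vy Ct [t0 e]]]]; exists (- t), y; split;
        rewrite /= ?opprK ?oppr_gt0.
    by move=> [t [y [Vy [Ct t0] e]]]; exists y, (- t);
      rewrite /onI opprK oppr_lt0.
  by apply: (open_in H oV oB) => t [].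
by exists lev, crd; split => // y Vy; exists y => //; right.
Qed.

Lemma chart_exists w : exists O lev crd, chart O lev crd /\ O w.
Proof.
have [bw|] := boolP (at_infinity w).
  have [[_ [Ar <-]]|[_ [Ar <-]]] := at_infinityP H bw.
    have [V [oV Vr Vw]] := side_wander_open H (or_introl Ar).
    have oV' : open (V `&` Ap) by apply: openI => //; exact: side_openp H.
    have Vw' x n : (V `&` Ap) x -> (0 < n)%N -> ~ (V `&` Ap) (iter n g x).
      by move=> [Vx _] n0 [/(Vw _ _ Vx n0)].
    have [O [lev [crd [C OV]]]] := plus_chart oV' (fun _ h => h.2) Vw'.
    by exists O, lev, crd; split => //; exact: OV.
  have [V [oV Vr Vw]] := side_wander_open H (or_intror Ar).
  have oV' : open (V `&` Am) by apply: openI => //; exact: side_openm H.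
  have Vw' x n : (V `&` Am) x -> (0 < n)%N -> ~ (V `&` Am) (iter n g x).
    by move=> [Vx _] n0 [/(Vw _ _ Vx n0)].
  have [O [lev [crd [C OV]]]] := minus_chart oV' (fun _ h => h.2) Vw'.
  by exists O, lev, crd; split => //; exact: OV.
case: w => // z _.
(* two sheets suffice for the inner points *)
have [s [s01 zs]] : exists s : R, 0 < s < 1 /\ height z != s.
  have [e|e] := eqVneq (height z) (1 / 2); last by exists (1 / 2); split => //;
    lra.
  by exists (1 / 3); split; [lra|rewrite e; apply/eqP; lra].
have [lev [crd C]] := sheet_chart H s01.
by exists (Inner @` [set z | height z != s]), lev, crd; split => //; exists z.
Qed.


End EndCharts.

(** * Lifts of squares to the cyclic cover *)

Lemma locally_constant {X : topologicalType} {Y : Type} (D : set X) (phi : X ->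
  Y) :
  connected D -> (forall x, D x -> \forall y \near x, D y -> phi y = phi x) ->
  forall x y, D x -> D y -> phi y = phi x.
Proof.
move=> cD loc x y Dx Dy.
suff E : [set z | D z /\ phi z = phi x] = D.
  by have [] : [set z | D z /\ phi z = phi x] y by rewrite E.
apply: cD.
- by exists x.
- exists [set z | D z -> phi z = phi x]°; first exact: open_interior.
  apply/seteqP; split => [z [Dz e]|z [Dz /interior_subset/(_ Dz)]] //; split =>
    //.
  by apply: filterS (loc z Dz) => z' h Dz'; rewrite h.
- exists (~` [set z | D z -> phi z <> phi x]°).
    exact: open_closedC (open_interior _).
  apply/seteqP; split => [z [Dz e]|z [Dz nz]]; split => //.
    by move=> /interior_subset/(_ Dz).
  apply: contrapT => ne; apply: nz.
  by apply: filterS (loc z Dz) => z' h Dz'; rewrite h.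
Qed.

(** The points up to which the property holds form an open and closed set. *)
Lemma interval_glue {R : realType} (Q : R -> R -> Prop) :
  (forall a b c, 0 <= a -> a <= b -> b <= c -> c <= 1 -> Q a b -> Q b c ->
    Q a c) ->
  (forall x, 0 <= x <= 1 -> exists2 e, 0 < e & forall a b, 0 <= a -> a <= b ->
    b <= 1 ->
     `|x - a| < e -> `|x - b| < e -> Q a b) ->
  Q 0 1.
Proof.
move=> glue loc.
pose phi (x : R) : Prop := forall y, 0 <= y <= x -> Q 0 y.
have phi0 : phi 0.
  move=> y y0; have -> : y = 0 by lra.
  have [|e e0 H] := loc 0; first by rewrite lexx ler01.
  by apply: H; rewrite ?lexx ?ler01 ?subrr ?normr0.
suff : phi 1 by apply; rewrite ler01 lexx.
suff -> : phi 1 = phi 0 by [].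
apply: (@locally_constant _ _ (`[0, 1]%classic : set R)).
- exact: segment_connected.
- move=> x /itv01 x01; have [e e0 H] := loc x x01.
  have n : nbhs x [set y | `|x - y| < e] by exact: (nbhsx_ballx x e e0).
  apply: filterS n => y /= xy /itv01 y01.
  apply/propext; split => h z zy.
  + have [zy'|yz] := leP z y; first by apply: h; lra.
    apply: (glue 0 y z) => //; try lra.
      by apply: h; lra.
    apply: H => //; try lra.
    by rewrite ger0_norm; move: xy; rewrite ltr_norml; lra.
  + have [zx|xz] := leP z x; first by apply: h; lra.
    apply: (glue 0 x z) => //; try lra.
      by apply: h; lra.
    apply: H => //; try lra.
      by rewrite subrr normr0.
    by move: xy; rewrite !ltr_norml; lra.
- by apply/itv01; rewrite lexx ler01.
- by apply/itv01; rewrite lexx ler01.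
Qed.

Section Lifting.
Context (R : realType) {T : topologicalType} (g ginv : T -> T) (Ap Am : set T).
Hypothesis H : sides g ginv Ap Am.
Local Notation Z := (mapping_torus R g).
Local Notation forward_side := (@forward_side R T g Ap).
Local Notation backward_side := (@backward_side R T g Am).
Local Notation back_flow := (@back_flow R T g Am).
Local Notation W := (compactified forward_side (@flow R T g) backward_side
  back_flow).


Local Notation base_rep := (@base_rep R T g Ap Am).
Local Notation has_level := (@has_level R T g Ap Am).
Local Notation chart := (@chart R T g Ap Am).

Local Notation I2 := (`[0, 1]%classic `*` `[0, 1]%classic : set (R * R)).

Variable F : R * R -> W.
Hypothesis cF : {within I2, continuous F}.

(** The lifts of [F] to the infinite cyclic cover: locally they are given by
    the levels of charts, up to shifts.  The bound on the shifts replaces an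
    appeal to compactness later on. *)
Definition lifts (P : set (R * R)) (th : R * R -> int) : Prop :=
  exists M : nat, forall v0, P v0 -> exists O lev crd (k : int),
    [/\ chart O lev crd, O (F v0), (`|k| <= M)%N &
        \forall v \near v0, P v -> th v = lev (F v) + k].

Lemma chart_compat_lift O lev crd O' lev' crd' v0 :
  chart O lev crd -> chart O' lev' crd' -> I2 v0 -> O (F v0) -> O' (F v0) ->
  \forall v \near v0, I2 v -> lev (F v) - lev' (F v) = lev (F v0) - lev' (F v0).
Proof.
move=> C C' Iv Ov Ov'.
exact: (within_near cF Iv (chart_compat H C C' Ov Ov')).
Qed.

(** Two lifts differ by a deck transformation, since charts are compatible. *)
Lemma lifts_uniq P Q th th' : P `<=` I2 -> Q `<=` I2 -> connected (P `&` Q) ->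
  lifts P th -> lifts Q th' ->
  exists k : int, forall v, P v -> Q v -> th v = th' v + k.
Proof.
move=> PI QI cPQ [M HP] [M' HQ].
have [[v1 [Pv1 Qv1]]|nPQ] := pselect ((P `&` Q) !=set0); last first.
  by exists 0 => v Pv Qv; case: nPQ; exists v.
exists (th v1 - th' v1) => v Pv Qv.
suff -> : th v1 - th' v1 = th v - th' v by lia.
apply: (@locally_constant _ _ (P `&` Q) (fun v => th v - th' v)) => //.
move=> v0 [Pv0 Qv0].
have [O [lev [crd [k [C Ov _ n1]]]]] := HP _ Pv0.
have [O' [lev' [crd' [k' [C' Ov' _ n2]]]]] := HQ _ Qv0.
have n3 := chart_compat_lift C C' (PI _ Pv0) Ov Ov'.
have e1 := nbhs_singleton n1 Pv0; have e2 := nbhs_singleton n2 Qv0.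
near=> v2 => -[Pv2 Qv2].
have E1 : th v2 = lev (F v2) + k by move: Pv2; near: v2.
have E2 : th' v2 = lev' (F v2) + k' by move: Qv2; near: v2.
have E3 : lev (F v2) - lev' (F v2) = lev (F v0) - lev' (F v0).
  by have := PI _ Pv2; near: v2.
by rewrite E1 E2 e1 e2; lia.
Unshelve. all: by end_near.
Qed.

Lemma lifts_glue P Q th th' : P `<=` I2 -> Q `<=` I2 -> closed P -> closed Q ->
  connected (P `&` Q) -> lifts P th -> lifts Q th' ->
  exists th'', lifts (P `|` Q) th''.
Proof.
move=> PI QI cP cQ cPQ lP lQ.
have [k0 Hk0] := lifts_uniq PI QI cPQ lP lQ.
have [M HP] := lP; have [M' HQ] := lQ.
exists (fun v => if `[< P v >] then th v else th' v + k0).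
exists (M + M' + `|k0|)%N => v0 PQv0.
have far (D : set (R * R)) : closed D -> ~ D v0 -> \forall v \near v0, ~ D v.
  by move=> cD nD; exact: (open_nbhs_nbhs (conj (closed_openC cD) nD)).
have [Pv0|nPv0] := pselect (P v0).
- have [O [lev [crd [k [C Ov kM n1]]]]] := HP _ Pv0.
  exists O, lev, crd, k; split => //; first by lia.
  have [Qv0|nQv0] := pselect (Q v0); last first.
    apply: filterS2 n1 (far _ cQ nQv0) => v h nQv [Pv|//].
    by rewrite asboolT// h.
  have [O' [lev' [crd' [k' [C' Ov' _ n2]]]]] := HQ _ Qv0.
  have n3 := chart_compat_lift C C' (PI _ Pv0) Ov Ov'.
  have e1 := nbhs_singleton n1 Pv0; have e2 := nbhs_singleton n2 Qv0.
  have e3 := Hk0 _ Pv0 Qv0.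
  apply: filterS3 n1 n2 n3 => v h1 h2 h3 PQv.
  have [Pv|nPv] := pselect (P v); first by rewrite asboolT// h1.
  have Qv : Q v by case: PQv.
  have := h3 (QI _ Qv); rewrite asboolF// h2//; lia.
- have Qv0 : Q v0 by case: PQv0.
  have [O [lev [crd [k [C Ov kM n1]]]]] := HQ _ Qv0.
  exists O, lev, crd, (k + k0); split => //; first by lia.
  apply: filterS2 n1 (far _ cP nPv0) => v h nPv [//|Qv].
  by rewrite asboolF// h// addrA.
Qed.

Definition rect (a b c d : R) : set (R * R) :=
  [set v | a <= v.1 <= b /\ c <= v.2 <= d].

Lemma rect_closed a b c d : closed (rect a b c d).
Proof.
rewrite (_ : rect a b c d = fst @^-1` `[a, b]%classic `&` snd @^-1`
  `[c, d]%classic).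
  apply: closedI.
    by apply: closed_comp => [x _|]; [exact: fst_cont|exact: interval_closed].
  by apply: closed_comp => [x _|]; [exact: snd_cont|exact: interval_closed].
by apply/seteqP; split => v /=; rewrite !in_itv.
Qed.

Lemma rect_connected a b c d : a = b \/ c = d -> connected (rect a b c d).
Proof.
have img (f : R -> R * R) (x y : R) : continuous f ->
  connected (f @` `[x, y]%classic).
  move=> cf; apply: connected_continuous_connected; first exact:
    segment_connected.
  exact: continuous_subspaceT.
move=> [->|->].
- rewrite (_ : rect b b c d = (fun t => (b, t)) @` `[c, d]%classic).
    apply: img => t; apply: (@cvg_pair _ _ _ _ (nbhs b) (nbhs t)); first exact:
      cvg_cst.
    exact: cvg_id.
  apply/seteqP; split => [[x y] [/= xb cd]|_ [t /= + <-]].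
    by exists y; rewrite /= ?in_itv//; congr pair; lra.
  by rewrite in_itv /rect /= lexx.
- rewrite (_ : rect a b d d = (fun t => (t, d)) @` `[a, b]%classic).
    apply: img => t; apply: (@cvg_pair _ _ _ _ (nbhs t) (nbhs d)); first exact:
      cvg_id.
    exact: cvg_cst.
  apply/seteqP; split => [[x y] [/= xb cd]|_ [t /= + <-]].
    by exists x; rewrite /= ?in_itv//; congr pair; lra.
  by rewrite in_itv /rect /= lexx.
Qed.

(** Small rectangles lift because they lie in a chart; lifts on adjacent
    rectangles agree, after a shift, on the common side, which is connected. *)
Lemma lifts_ex : exists th, lifts I2 th.
Proof.
suff [th] : exists th, lifts (rect 0 1 0 1) th.
  by exists th; rewrite (_ : I2 = rect 0 1 0 1)//; apply/seteqP; split =>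
    v /sq01.
apply: (@interval_glue R (fun a b => exists th, lifts (rect a b 0 1) th)).
- move=> a b c a0 ab bc c1 [th hth] [th' hth'].
  have -> : rect a c 0 1 = rect a b 0 1 `|` rect b c 0 1.
    apply/seteqP; split => [v [v1 v2]|v [[v1 v2]|[v1 v2]]]; rewrite /rect /=;
      try by split; lra.
    by have [h|h] := leP v.1 b; [left|right]; split; lra.
  apply: (lifts_glue _ _ _ _ _ hth hth').
  + by move=> v [? ?]; apply/sq01; lra.
  + by move=> v [? ?]; apply/sq01; lra.
  + exact: rect_closed.
  + exact: rect_closed.
  + rewrite (_ : _ `&` _ = rect b b 0 1); first by apply: rect_connected; left.
    by apply/seteqP; split => [v [[? ?] [? ?]]|v [? ?]]; do ?split; rewrite /=;
      lra.
move=> x x01.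
suff [e e0 He] : exists2 e, 0 < e & forall a b, 0 <= a -> a <= b -> b <= 1 ->
    `|x - a| < e -> `|x - b| < e -> exists th, lifts (rect a b 0 1) th.
  by exists e.
apply: (@interval_glue R (fun c d => exists2 e, 0 < e & forall a b, 0 <= a ->
  a <= b ->
    b <= 1 -> `|x - a| < e -> `|x - b| < e -> exists th, lifts (rect a b c d)
      th)).
- move=> c d f c0 cd df f1 [e e0 He] [e' e'0 He'].
  exists (Num.min e e'); first by rewrite lt_min e0.
  move=> a b a0 ab b1; rewrite !lt_min => /andP[xa xa'] /andP[xb xb'].
  have [th hth] := He a b a0 ab b1 xa xb.
  have [th' hth'] := He' a b a0 ab b1 xa' xb'.
  have -> : rect a b c f = rect a b c d `|` rect a b d f.
    apply/seteqP; split => [v [v1 v2]|v [[v1 v2]|[v1 v2]]]; rewrite /rect /=;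
      try by split; lra.
    by have [h|h] := leP v.2 d; [left|right]; split; lra.
  apply: (lifts_glue _ _ _ _ _ hth hth').
  + by move=> v [? ?]; apply/sq01; lra.
  + by move=> v [? ?]; apply/sq01; lra.
  + exact: rect_closed.
  + exact: rect_closed.
  + rewrite (_ : _ `&` _ = rect a b d d); first by apply: rect_connected; right.
    by apply/seteqP; split => [v [[? ?] [? ?]]|v [? ?]]; do ?split; rewrite /=;
      lra.
- move=> y y01; have Ixy : I2 (x, y) by apply/sq01.
  have [O [lev [crd [C Oxy]]]] := chart_exists H (F (x, y)).
  have := within_near cF Ixy (open_nbhs_nbhs (conj (chart_open C) Oxy)).
  move=> /nbhs_ballP[e /= e0 eO]; exists e => // c d c0 cd d1 yc yd.
  exists e => // a b a0 ab b1 xa xb.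
  exists (fun v => lev (F v)); exists 0%N => v0 [v1 v2].
  exists O, lev, crd, 0; split => //; last by apply:
    (@filterE _ _ (nbhs_filter v0)) => v _; rewrite addr0.
  apply: eO; last by apply/sq01; lra.
  by split; rewrite /ball /=; move: xa xb yc yd; rewrite !ltr_norml; lra.
Qed.

(** Pushed forward to a level [N] that exceeds all shifts, a lift becomes a
    continuous map into the graph. *)
Lemma lift_position : exists (th : R * R -> int) (N : nat) (h : R * R -> T),
  [/\ {within I2, continuous h},
      forall v, I2 v -> has_level (F v) (th v - N%:Z) (h v) &
      forall v0, I2 v0 -> exists O lev crd (k : int),
        [/\ chart O lev crd, O (F v0),
        (`|k| <= N)%N & \forall v \near v0, I2 v -> th v = lev (F v) + k]].
Proof.
have [th [N HN]] := lifts_ex.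
pose h v := xget (base_rep (F v)) [set y | has_level (F v) (th v - N%:Z) y].
have hE v y : has_level (F v) (th v - N%:Z) y -> h v = y.
  move=> t; apply: (has_level_uniq H _ t).
  by apply: (@xgetPex _ (base_rep (F v)) [set y | has_level (F v) (th v - N%:Z)
    y]); exists y.
have key (O : set W) lev crd (k : int) v : chart O lev crd -> O (F v) ->
  (`|k| <= N)%N ->
    th v = lev (F v) + k -> has_level (F v) (th v - N%:Z)
      (iter `|N%:Z - k|%N g (crd (F v))).
  move=> C Ov kN ->; have -> : lev (F v) + k - N%:Z = lev (F v) - `|N%:Z -
    k|%N%:Z by lia.
  exact: (has_level_iter H _ (chart_level C Ov)).
exists th, N, h; split => //.
- apply: near_within => v0 Iv0 B nB.
  have [O [lev [crd [k [C Ov kN n1]]]]] := HN _ Iv0.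
  have K0 := key _ _ _ _ _ C Ov kN (nbhs_singleton n1 Iv0).
  have n2 := within_near cF Iv0 (open_nbhs_nbhs (conj (chart_open C) Ov)).
  have n3 : \forall v \near v0, I2 v -> B (iter `|N%:Z - k|%N g (crd (F v))).
    have ck := @iter_cont _ _ `|N%:Z - k|%N (side_cont H) (crd (F v0)).
    rewrite (hE _ _ K0) in nB.
    exact: (within_near cF Iv0 (chart_cont C Ov (ck _ nB))).
  apply: filterS3 n1 n2 n3 => v h1 h2 h3 Iv.
  by rewrite (hE _ _ (key _ _ _ _ _ C (h2 Iv) kN (h1 Iv))); exact: h3.
- move=> v Iv; have [O [lev [crd [k [C Ov kN n1]]]]] := HN _ Iv.
  have K := key _ _ _ _ _ C Ov kN (nbhs_singleton n1 Iv).
  by rewrite (hE _ _ K).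
Qed.

End Lifting.

(** * Injectivity of the boundary on fundamental groups *)

Lemma path_component {R : realType} {X : topologicalType} (B : set X) (c : R ->
  X) (t : R) :
  {within `[0, 1], continuous c} -> (forall u, 0 <= u <= 1 -> B (c u)) ->
  0 <= t <= 1 -> connected_component B (c 0) (c t).
Proof.
move=> cc Bc t01; exists (c @` `[0, 1]%classic).
  split.
  - by exists 0 => //; apply/itv01; rewrite lexx ler01.
  - by move=> _ [u /itv01 u01 <-]; exact: Bc.
  - by apply: connected_continuous_connected => //; exact: segment_connected.
by exists t => //; apply/itv01.
Qed.

Lemma homotopy_to_component {R : realType} {X Y : topologicalType} (A : set X)
    (B S : set Y) (q : X -> Y) (a b : R -> Y) (K : R * R -> X) :
  component B S -> (forall x, A x -> {for x, continuous q}) ->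
  (forall x, A x -> B (q x)) -> S (a 0) ->
  {within `[0, 1] `*` `[0, 1], continuous K} ->
  (forall s t, 0 <= s <= 1 -> 0 <= t <= 1 -> A (K (s, t))) ->
  (forall t, 0 <= t <= 1 -> q (K (0, t)) = a t /\ q (K (1, t)) = b t) ->
  (forall s, 0 <= s <= 1 -> q (K (s, 0)) = a 0 /\ q (K (s, 1)) = a 1) ->
  path_homotopic_in S a b.
Proof.
move=> [x0 Bx0 SE] cq qB Sa0 cK AK Kab Ks; apply/homotopicP; exists (q \o K).
have z01 : 0 <= (0 : R) <= 1 by rewrite lexx ler01.
have cqK : {within `[0, 1] `*` `[0, 1], continuous (q \o K)}.
  apply: near_within => -[s t] /sq01[/= s01 t01] N nN.
  have st : (`[0, 1]%classic `*` `[0, 1]%classic : set (R * R)) (s, t) by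
    exact/sq01.
  exact: (within_near cK st (cq _ (AK _ _ s01 t01) _ nN)).
split => // s t s01 t01.
rewrite SE in Sa0 *; apply: connected_component_trans Sa0 _.
have [<- _] := Kab _ z01.
have := @path_component R Y B (fun u => (q \o K) (s * u + 0, t * u + 0)) 1.
rewrite !mulr0 !addr0 !mulr1; apply; last by lra.
- apply: (sq_comp cqK); [exact: affine_cont|exact: affine_cont|].
  move=> u /itv01/andP[u0 u1]; move: s01 t01 => /andP[s0 s1] /andP[t0 t1].
  by split; apply/andP; split; nra.
- move=> u /andP[u0 u1]; apply: qB; apply: AK; move: s01 t01 =>
  /andP[s0 s1] /andP[t0 t1];
    by apply/andP; split; nra.
Qed.

Section BoundaryInjective.
Context (R : realType) {T : topologicalType} (g ginv : T -> T) (Ap Am : set T).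
Hypothesis H : sides g ginv Ap Am.
Local Notation Z := (mapping_torus R g).
Local Notation forward_side := (@forward_side R T g Ap).
Local Notation backward_side := (@backward_side R T g Am).
Local Notation back_flow := (@back_flow R T g Am).
Local Notation W := (compactified forward_side (@flow R T g) backward_side
  back_flow).
Local Notation BdPlus := (@BdPlus R Z forward_side (@flow R T g) backward_side
  back_flow).
Local Notation BdMinus := (@BdMinus R Z forward_side (@flow R T g) backward_side
  back_flow).


Local Notation plus_end := (@plus_end R T g Ap Am).
Local Notation minus_end := (@minus_end R T g Ap Am).
Local Notation base_rep := (@base_rep R T g Ap Am).
Local Notation side_at := (@side_at R T g Ap Am).
Local Notation has_level := (@has_level R T g Ap Am).
Local Notation chart := (@chart R T g Ap Am).

Local Notation I2 := (`[0, 1]%classic `*` `[0, 1]%classic : set (R * R)).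

(** Only the part at infinity of a neighborhood of a ray class matters. *)
Lemma plus_end_cont y : Ap y -> {for y, continuous plus_end}.
Proof.
move=> Ay B; rewrite nbhsE => -[O [oO Oy] OB].
have [u uy E] := plus_classE Am (forward_side_fiber0 R H Ay).
have : compactified_open O by [].
move=> [_ Op _]; have Ou : O (BdPlus (ray_class (@flow R T g) u)) by rewrite -E.
have [N nN [t t0 HN]] := Op u Ou.
rewrite uy /within /= in nN.
have nA : nbhs y Ap by apply: open_nbhs_nbhs; split => //; exact: side_openp H.
have nN' : nbhs y (fun y' => forward_side (fiber0 R g y') -> N (fiber0 R g y')).
  exact: (@fiber0_cont R T g y _ nN).
apply: filterS2 nN' nA => y' Ny' Ay' /=; apply: OB.
have Zy' := forward_side_fiber0 R H Ay'; have [u' uy' E'] := plus_classE Am Zy'.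
rewrite [plus_end _]E'; have [|//] := HN u'; rewrite uy'; exact: Ny'.
Qed.

Lemma minus_end_cont y : Am y -> {for y, continuous minus_end}.
Proof.
move=> Ay B; rewrite nbhsE => -[O [oO Oy] OB].
have [u uy E] := minus_classE Ap (backward_side_fiber0 R g Ay).
have : compactified_open O by [].
move=> [_ _ Om]; have Ou : O (BdMinus (ray_class back_flow u)) by rewrite -E.
have [N nN [t t0 HN]] := Om u Ou.
rewrite uy /within /= in nN.
have nA : nbhs y Am by apply: open_nbhs_nbhs; split => //; exact: side_openm H.
have nN' : nbhs y (fun y' => backward_side (fiber0 R g y') ->
  N (fiber0 R g y')).
  exact: (@fiber0_cont R T g y _ nN).
apply: filterS2 nN' nA => y' Ny' Ay' /=; apply: OB.
have Zy' := backward_side_fiber0 R g Ay'; have [u' uy' E'] :=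
  minus_classE Ap Zy'.
rewrite [minus_end _]E'; have [|//] := HN u'; rewrite uy'; exact: Ny'.
Qed.

Lemma plus_end_range y : Ap y -> range BdPlus (plus_end y).
Proof. by move=> Ay; have [u _ E] :=
  plus_classE Am (forward_side_fiber0 R H Ay); rewrite [plus_end _]E;
  exists (ray_class (@flow R T g) u). Qed.

Lemma minus_end_range y : Am y -> range BdMinus (minus_end y).
Proof. by move=> Ay; have [u _ E] :=
  minus_classE Ap (backward_side_fiber0 R g Ay); rewrite [minus_end _]E;
  exists (ray_class back_flow u). Qed.

Lemma has_level_plus w th y : range BdPlus w -> has_level w th y -> Ap y /\
  plus_end y = w.
Proof.
move=> [c _ <-]; have Zc := sub_val (repr c); have Ar :=
  (forward_sideE H _).1 Zc.
have qr : plus_end (base (val (repr c))) = BdPlus c.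
  by rewrite -(plus_class_base H Zc) -BdPlus_repr.
case: th => [n [/= e s]|n /= e].
  have Ay : Ap y by case: n e s => [|n] /= e s; [rewrite -e|exact: s].
  by split => //; rewrite -qr; apply: (plus_end_flow R H (n := n) (m := 0%N)).
have Ay : Ap y by rewrite e; exact: (iter_fwd H n.+1).
by split => //; rewrite -qr; apply: (plus_end_flow R H (n := 0%N) (m := n.+1)).
Qed.

(** On the negative boundary only positions at low levels stay near the end. *)
Lemma has_level_minus w th y : range BdMinus w -> Am y -> has_level w th y ->
  minus_end y = w.
Proof.
move=> [c _ <-] Ay; have Zc := sub_val (repr c); have Ar :=
  backward_side_base H Zc.
have qr : minus_end (base (val (repr c))) = BdMinus c.
  by rewrite -(minus_class_base H Zc) -BdMinus_repr.
case: th => [n [/= e s]|n /= e]; rewrite -qr.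
  exact: (minus_end_flow R H (n := n)).
by apply/esym; apply: (minus_end_flow R H (n := n.+1)).
Qed.

Lemma has_level_bwd_iter w th y n : side_at w = Am -> Am y ->
  has_level w th y ->
  has_level w (th + n%:Z) (iter n ginv y).
Proof.
move=> sw Ay h; elim: n => [|n IH]; first by rewrite addr0.
have -> : th + n.+1%:Z = th + n%:Z + 1 by lia.
by apply: (has_level_bwd H) => //; exact: (iter_ginv_bwd H).
Qed.

Lemma iter_ginv_cont n y : Am y -> {for y, continuous (iter n ginv)}.
Proof.
move=> Ay; elim: n => [|n IH]; first exact: cvg_id.
have : {for y, continuous (ginv \o iter n ginv)}; last by [].
apply: continuous_comp; first exact: IH.
by apply: (side_icont H); right; exact: (iter_ginv_bwd H).
Qed.

Let z01 : 0 <= (0 : R) <= 1. Proof. by rewrite lexx ler01. Qed.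
Let o01 : 0 <= (1 : R) <= 1. Proof. by rewrite lexx ler01. Qed.

(** A homotopy of loops in the torus, together with its lift.  The lift is
    constant on the two sides of the square on which the homotopy is. *)
Lemma lift_homotopy (a b : R -> W) : path_homotopic_in [set: W] a b ->
  exists (F : R * R -> W) (th : R * R -> int) (N : nat) (h : R * R -> T),
  [/\ {within I2, continuous F} /\ {within I2, continuous h},
      (forall t, 0 <= t <= 1 -> F (0, t) = a t /\ F (1, t) = b t) /\
      (forall s, 0 <= s <= 1 -> F (s, 0) = a 0 /\ F (s, 1) = a 1),
      forall s, 0 <= s <= 1 -> th (s, 0) = th (0, 0) /\ th (s, 1) = th (0, 1),
      forall v, I2 v -> has_level (F v) (th v - N%:Z) (h v) &
      forall v0, I2 v0 -> exists O lev crd (k : int),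
        [/\ chart O lev crd, O (F v0),
        (`|k| <= N)%N & \forall v \near v0, I2 v -> th v = lev (F v) + k]].
Proof.
move=> /homotopicP[F [cF _ Fab Fs]].
have [th [N [h [ch hTr HN]]]] := lift_position H cF.
exists F, th, N, h; split => // s s01.
have edge t w : 0 <= t <= 1 -> (forall s, 0 <= s <= 1 -> F (s, t) = w) ->
    th (s, t) = th (0, t).
  move=> t01 Fw; apply: (@locally_constant _ _ (rect 0 1 t t)).
  - by apply: rect_connected; right.
  - move=> v0 [v01 v02].
    have Iv0 : I2 v0 by apply/sq01; lra.
    have Fv v : rect 0 1 t t v -> F v = w.
      case: v => v1 v2 [/= ? ?]; have -> : v2 = t by lra.
      exact: Fw.
    have [O [lev [crd [k [C Ov _ n1]]]]] := HN _ Iv0.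
    have e0 := nbhs_singleton n1 Iv0.
    apply: filterS n1 => v n1 [v1 v2].
    by rewrite n1 ?e0 ?Fv//; apply/sq01; lra.
  - by split; rewrite /= ?lexx ?ler01.
  - by split; rewrite /= ?lexx.
split; first by apply: (edge 0 (a 0)) => // u /Fs[].
by apply: (edge 1 (a 1)) => // u /Fs[].
Qed.

Lemma edge_cont (h : R * R -> T) (s : R) : {within I2, continuous h} ->
  0 <= s <= 1 ->
  {within `[0, 1], continuous (fun t => h (s, t))}.
Proof.
move=> ch s01; apply: (sq_comp ch) => [t|t|t /itv01 t01]; last by [].
  exact: cvg_cst.
exact: cvg_id.
Qed.

(** The sides of the homotopy in the graph are lifts of the loops to [Ap]; once
    the homotopy is pushed into [Ap], it can be mapped to the boundary. *)
Lemma plus_injective (S : set W) :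
  (forall a b : R -> T,
    {within `[0, 1], continuous a} -> {within `[0, 1], continuous b} ->
    (forall t, 0 <= t <= 1 -> Ap (a t) /\ Ap (b t)) ->
    path_homotopic_in [set: T] a b -> exists (m : nat) (K : R * R -> T), [/\
      {within I2, continuous K},
      forall s t, 0 <= s <= 1 -> 0 <= t <= 1 -> Ap (K (s, t)),
      forall t, 0 <= t <= 1 -> K (0, t) = iter m g (a t) /\
        K (1, t) = iter m g (b t) &
      forall s, 0 <= s <= 1 -> K (s, 0) = iter m g (a 0) /\
        K (s, 1) = iter m g (a 1)]) ->
  component (range BdPlus) S -> pi1_injective_on R S (fun w : W => w).
Proof.
move=> push cS x a b Sx [ca /mem01 Sa a0 a1] [cb /mem01 Sb b0 b1] ab.
have SB w : S w -> range BdPlus w.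
  by case: cS => x0 _ ->; exact: connected_component_sub.
have [F [th [N [h [[cF ch] [Fab Fs] ths hTr _]]]]] :=
  lift_homotopy (ab : path_homotopic_in [set: W] a b).
have Ih s t : 0 <= s <= 1 -> 0 <= t <= 1 -> I2 (s, t) by move=> ? ?; apply/sq01.
have P0 t : 0 <= t <= 1 -> Ap (h (0, t)) /\ plus_end (h (0, t)) = a t.
  move=> t01; have := hTr _ (Ih _ _ z01 t01); have [-> _] := Fab _ t01.
  by apply: has_level_plus; apply: SB; exact: Sa.
have P1 t : 0 <= t <= 1 -> Ap (h (1, t)) /\ plus_end (h (1, t)) = b t.
  move=> t01; have := hTr _ (Ih _ _ o01 t01); have [_ ->] := Fab _ t01.
  by apply: has_level_plus; apply: SB; exact: Sb.
have hs s : 0 <= s <= 1 -> h (s, 0) = h (0, 0) /\ h (s, 1) = h (0, 1).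
  move=> s01; have [t0 t1] := ths _ s01.
  have [f0 f1] := Fs _ s01; have [g0 g1] := Fs _ z01.
  split.
    apply: (has_level_uniq H (hTr _ (Ih _ _ s01 z01))).
    by rewrite f0 t0 -g0; exact: hTr (Ih _ _ z01 z01).
  apply: (has_level_uniq H (hTr _ (Ih _ _ s01 o01))).
  by rewrite f1 t1 -g1; exact: hTr (Ih _ _ z01 o01).
have [||||m [K [cK AK K01 Ks]]] := push (fun t => h (0, t)) (fun t => h (1, t)).
- exact: edge_cont.
- exact: edge_cont.
- by move=> t t01; have [? _] := P0 _ t01; have [? _] := P1 _ t01.
- by apply/homotopicP; exists h; split.
have qg y : Ap y -> plus_end (iter m g y) = plus_end y.
  by move=> Ay; apply: (plus_end_flow R H (n := 0%N) (m := m)) => //; exact: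
    (iter_fwd H).
apply: (homotopy_to_component cS plus_end_cont plus_end_range _ cK AK).
- by rewrite a0.
- move=> t t01; have [-> ->] := K01 _ t01.
  by have [A0 e0] := P0 _ t01; have [A1 e1] := P1 _ t01; rewrite !qg.
- move=> s s01; have [-> ->] := Ks _ s01.
  by have [A0 e0] := P0 _ z01; have [A1 e1] := P0 _ o01; rewrite !qg.
Qed.

Lemma chart_minus O lev crd w : chart O lev crd -> O w -> range BdMinus w ->
  side_at w = Am /\ Am (crd w).
Proof.
move=> C Ow Bw; have sw : side_at w = Am by case: Bw => c _ <-.
split => //; rewrite -sw; apply: (chart_bd C) => //.
by case: Bw => c _ <-.
Qed.

(** Over the negative boundary a lift can be flowed back to level [- N], where
    it stays near the end. *)
Lemma lift_minus (F : R * R -> W) (th : R * R -> int) (N : nat) :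
  {within I2, continuous F} ->
  (forall v0, I2 v0 -> exists O lev crd (k : int),
    [/\ chart O lev crd, O (F v0),
     (`|k| <= N)%N & \forall v \near v0, I2 v -> th v = lev (F v) + k]) ->
  exists hm : R * R -> T, {within I2 `&` [set v | range BdMinus (F v)],
    continuous hm} /\
    forall v, I2 v -> range BdMinus (F v) ->
      [/\ Am (hm v), minus_end (hm v) = F v & has_level (F v) (th v + N%:Z)
        (hm v)].
Proof.
move=> cF HN.
pose hm v := xget (base_rep (F v)) [set y | has_level (F v) (th v + N%:Z) y].
have hE v y : has_level (F v) (th v + N%:Z) y -> hm v = y.
  move=> t; apply: (has_level_uniq H _ t).
  by apply: (@xgetPex _ (base_rep (F v)) [set y | has_level (F v) (th v + N%:Z)
    y]); exists y.
have key (O : set W) lev crd (k : int) v : chart O lev crd -> O (F v) ->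
  (`|k| <= N)%N ->
    range BdMinus (F v) -> th v = lev (F v) + k ->
    hm v = iter (absz (N%:Z + k)%R) ginv (crd (F v)) /\
    has_level (F v) (th v + N%:Z) (iter (absz (N%:Z + k)%R) ginv (crd (F v))).
  move=> C Ov kN Bv e; have [sv Ac] := chart_minus C Ov Bv.
  suff t : has_level (F v) (th v + N%:Z) (iter (absz (N%:Z + k)%R) ginv
    (crd (F v))).
    by split => //; exact: hE.
  have -> : th v + N%:Z = lev (F v) + (absz (N%:Z + k)%R)%:Z by rewrite e; lia.
  exact: (has_level_bwd_iter _ sv Ac (chart_level C Ov)).
exists hm; split.
- apply: near_within => v0 [Iv0 Bv0] B nB.
  have [O [lev [crd [k [C Ov kN n1]]]]] := HN _ Iv0.
  have [e0 _] := key _ _ _ _ _ C Ov kN Bv0 (nbhs_singleton n1 Iv0).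
  have n2 := within_near cF Iv0 (open_nbhs_nbhs (conj (chart_open C) Ov)).
  have [_ Ac] := chart_minus C Ov Bv0.
  have n3 : \forall v \near v0, I2 v ->
    B (iter (absz (N%:Z + k)%R) ginv (crd (F v))).
    rewrite e0 in nB.
    exact: (within_near cF Iv0 (chart_cont C Ov (iter_ginv_cont Ac nB))).
  apply: filterS3 n1 n2 n3 => v h1 h2 h3 [Iv Bv].
  by have [-> _] := key _ _ _ _ _ C (h2 Iv) kN Bv (h1 Iv); exact: h3.
- move=> v Iv Bv; have [O [lev [crd [k [C Ov kN n1]]]]] := HN _ Iv.
  have [-> t] := key _ _ _ _ _ C Ov kN Bv (nbhs_singleton n1 Iv).
  have [_ Ac] := chart_minus C Ov Bv.
  have Ai := iter_ginv_bwd H (absz (N%:Z + k)%R) Ac.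
  by split => //; exact: (has_level_minus Bv Ai t).
Qed.

(** At a low level the loops lift to paths [hm (0, _)] and [hm (1, _)] in [Am];
    a high power of [g] makes them homotopic in the graph, and since [g] is
    injective on fundamental groups they were so from the beginning. *)
Lemma minus_injective (S : set W) :
  pi1_injective_on R [set: T] g ->
  (forall a b : R -> T,
    {within `[0, 1], continuous a} -> {within `[0, 1], continuous b} ->
    (forall t, 0 <= t <= 1 -> Am (a t) /\ Am (b t)) ->
    path_homotopic_in [set: T] a b -> exists (m : nat) (K : R * R -> T), [/\
      {within I2, continuous K},
      forall s t, 0 <= s <= 1 -> 0 <= t <= 1 -> Am (K (s, t)),
      forall t, 0 <= t <= 1 -> K (0, t) = iter m ginv (a t) /\
        K (1, t) = iter m ginv (b t) &
      forall s, 0 <= s <= 1 -> K (s, 0) = iter m ginv (a 0) /\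
        K (s, 1) = iter m ginv (a 1)]) ->
  component (range BdMinus) S -> pi1_injective_on R S (fun w : W => w).
Proof.
move=> g1 push cS x a b Sx [ca /mem01 Sa a0 a1] [cb /mem01 Sb b0 b1] ab.
have SB w : S w -> range BdMinus w.
  by case: cS => x0 _ ->; exact: connected_component_sub.
have [F [th [N [h [[cF ch] [Fab Fs] ths hTr HN]]]]] :=
  lift_homotopy (ab : path_homotopic_in [set: W] a b).
have Ih s t : 0 <= s <= 1 -> 0 <= t <= 1 -> I2 (s, t) by move=> ? ?; apply/sq01.
have [hm [chm Hm]] := lift_minus cF HN.
have P0 t : 0 <= t <= 1 -> [/\ Am (hm (0, t)), minus_end (hm (0, t)) = a t &
    has_level (a t) (th (0, t) + N%:Z) (hm (0, t))].
  move=> t01; have [<- _] := Fab _ t01; apply: Hm; first exact: Ih.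
  by have [-> _] := Fab _ t01; apply: SB; exact: Sa.
have P1 t : 0 <= t <= 1 -> [/\ Am (hm (1, t)), minus_end (hm (1, t)) = b t &
    has_level (b t) (th (1, t) + N%:Z) (hm (1, t))].
  move=> t01; have [_ <-] := Fab _ t01; apply: Hm; first exact: Ih.
  by have [_ ->] := Fab _ t01; apply: SB; exact: Sb.
(* from level [-N], where [hm] lives, to level [N] *)
have hmh v : I2 v -> range BdMinus (F v) -> iter (N + N) g (hm v) = h v.
  move=> Iv Bv; have [_ _ t] := Hm v Iv Bv.
  apply: (has_level_uniq H _ (hTr v Iv)).
  have -> : th v - N%:Z = th v + N%:Z - (N + N)%N%:Z by lia.
  exact: (has_level_iter H).
have chm_edge s : 0 <= s <= 1 -> (forall t, 0 <= t <= 1 ->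
  range BdMinus (F (s, t))) ->
    {within `[0, 1], continuous (fun t => hm (s, t))}.
  move=> s01 Bs.
  have : {within `[0, 1], continuous (hm \o (fun t => (s, t)))}; last by [].
  apply: (within_comp _ chm).
    apply: continuous_subspaceT => t.
    by apply: (@cvg_pair _ _ _ _ (nbhs s) (nbhs t)); [exact: cvg_cst|exact:
      cvg_id].
  by move=> t /itv01 t01; split; [exact: Ih|exact: Bs].
have B0 t : 0 <= t <= 1 -> range BdMinus (F (0, t)).
  by move=> t01; have [-> _] := Fab _ t01; apply: SB; exact: Sa.
have B1 t : 0 <= t <= 1 -> range BdMinus (F (1, t)).
  by move=> t01; have [_ ->] := Fab _ t01; apply: SB; exact: Sb.
have c0 := chm_edge 0 z01 B0; have c1 := chm_edge 1 o01 B1.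
have e0 : hm (0, 0) = hm (1, 0).
  have [_ _ t] := P0 _ z01; have [_ _ t'] := P1 _ z01.
  have [th0 _] := ths _ o01; rewrite th0 b0 -a0 in t'.
  exact: (has_level_uniq H t t').
have e1 : hm (0, 1) = hm (1, 1).
  have [_ _ t] := P0 _ o01; have [_ _ t'] := P1 _ o01.
  have [_ th1] := ths _ o01; rewrite th1 b1 -a1 in t'.
  exact: (has_level_uniq H t t').
have hom : path_homotopic_in [set: T] (fun t => hm (0, t)) (fun t => hm (1, t)).
  apply: (pi1_injective_iter (n := (N + N)%N) (side_cont H) g1 c0 c1 e0 e1).
  apply/homotopicP; exists h; split => // [t t01|s s01].
    by rewrite /= (hmh _ (Ih _ _ z01 t01) (B0 _ t01)) (hmh _ (Ih _ _ o01 t01)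
      (B1 _ t01)).
  have [t0 t1] := ths _ s01.
  have [f0 f1] := Fs _ s01; have [g0 g1'] := Fs _ z01.
  rewrite /= (hmh _ (Ih _ _ z01 z01) (B0 _ z01)) (hmh _ (Ih _ _ z01 o01)
    (B0 _ o01)); split.
    apply: (has_level_uniq H (hTr _ (Ih _ _ s01 z01))).
    by rewrite f0 t0 -g0; exact: hTr (Ih _ _ z01 z01).
  apply: (has_level_uniq H (hTr _ (Ih _ _ s01 o01))).
  by rewrite f1 t1 -g1'; exact: hTr (Ih _ _ z01 o01).
have [|m [K [cK AK K01 Ks]]] := push _ _ c0 c1 _ hom.
  by move=> t t01; have [? _ _] := P0 _ t01; have [? _ _] := P1 _ t01.
have qi y : Am y -> minus_end (iter m ginv y) = minus_end y.
  move=> Ay; apply: (minus_end_flow R H (n := m)) => //; first exact: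
    (iter_ginv_bwd H).
  by rewrite (iter_g_ginv H).
apply: (homotopy_to_component cS minus_end_cont minus_end_range _ cK AK).
- by rewrite a0.
- move=> t t01; have [-> ->] := K01 _ t01.
  by have [A0 q0 _] := P0 _ t01; have [A1 q1 _] := P1 _ t01; rewrite !qi.
- move=> s s01; have [-> ->] := Ks _ s01.
  by have [A0 q0 _] := P0 _ z01; have [A1 q1 _] := P0 _ o01; rewrite !qi.
Qed.

End BoundaryInjective.

(** * End-periodic maps *)

Section EndPeriodicSides.
Context {R : realType} {T : topologicalType} (G : graph R T) (g : T -> T)
  (p : nat) (U : set (nat -> set T) -> set T).
Hypothesis g_cont : continuous g.
Hypothesis wc : well_chosen G g p U.
Hypothesis inv : sides_invariant g p U.

Let Ap := Gamma_plus g p U.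
Let Am := Gamma_minus g p U.
Let Jp := [set E | ends T E /\ attracting g p U E].
Let Jm := [set E | ends T E /\ repelling g p U E].

(** The inverse of [g] on the closures of the nesting neighborhoods. *)
Definition partial_inverse (y : T) : T := xget y [set x | g x = y].
Local Notation ginv := partial_inverse.

Let hT := graph_hausdorff G.
Let comp_open := @graph_component_open R T G.

Lemma nbhd_open E : ends T E -> open (U E).
Proof. by move=> EE; case: wc => -[_ /(_ E EE)[]]. Qed.

Lemma nbhd_disjoint E E' : ends T E -> ends T E' -> U E `&` U E' !=set0 ->
  E = E'.
Proof.
move=> EE EE' [x [Ux Ux']]; apply: contrapT => ne.
have [_ [dC _ _ _]] := wc; have := dC _ _ EE EE' ne.
by move=> /seteqP[/(_ x) + _]; apply; split; exact: subset_closure.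
Qed.

Lemma nbhd_subgraph E : ends T E -> subgraph G (closure (U E)).
Proof. by move=> EE; have [_ [_ sC _ _]] := wc; exact: sC. Qed.

(** Over the closure of a nesting neighborhood [g] is an isomorphism of
    graphs. *)
Lemma inverse_on_closure E : ends T E ->
  [/\ forall x, closure (U E) (g x) -> ginv (g x) = x,
      forall y, closure (U E) y -> g (ginv y) = y &
      {within closure (U E), continuous ginv}].
Proof.
move=> EE; have [_ [_ _ /(_ E EE)[_ iso] _]] := wc.
have [_ _ im [_ [h ch hK]] _] := iso.
have gK x : closure (U E) (g x) -> ginv (g x) = x.
  move=> cx; have e : g (ginv (g x)) = g x.
    by apply: (@xgetPex _ (g x) [set y | g y = g x]); exists x.
  have mx : x \in g @^-1` closure (U E) by rewrite inE.
  have my : ginv (g x) \in g @^-1` closure (U E) by rewrite inE /= e.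
  by rewrite -[LHS](hK _ my) e (hK _ mx).
have Kg y : closure (U E) y -> g (ginv y) = y.
  by rewrite -[X in X y -> _]im => -[x cx <-]; rewrite gK.
split => //; rewrite im in ch; apply: within_eq ch => y cy.
have mi : ginv y \in g @^-1` closure (U E) by rewrite inE /= Kg.
by rewrite -(hK _ mi) Kg.
Qed.

Lemma end_of E B : ends T E -> E B -> nbhd_basis B.
Proof. by move=> [C _ ->] []. Qed.

Let p0 : (0 < p)%N. Proof. by case: wc => -[]. Qed.

Let gK x : Am (g x) -> ginv (g x) = x.
Proof.
by move=> [E [EE _] Ux]; have [h _ _] := inverse_on_closure EE; apply: h; exact:
  subset_closure.
Qed.

Let Kg y : Am y -> g (ginv y) = y.
Proof.
by move=> [E [EE _] Ux]; have [_ h _] := inverse_on_closure EE; apply: h; exact: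
  subset_closure.
Qed.

Let bwd x : Am (g x) -> Am x.
Proof. by move=> h; apply: inv.2. Qed.

Let gi_bwd x : Am x -> Am (ginv x).
Proof. by move=> Ax; apply: bwd; rewrite Kg. Qed.

Let plus_basis E : Jp E -> nbhd_basis (fun n => iter (p * n) g @` U E).
Proof. by move=> [EE [_ aE]]; exact: end_of EE aE. Qed.

Let minus_basis E : Jm E -> nbhd_basis (fun n => iter (p * n) ginv @` U E).
Proof.
move=> JE; have [EE [_ rE]] := JE.
have iK n x : Am (iter n g x) -> iter n ginv (iter n g x) = x.
  elim: n => // n IH An; rewrite iterSr [iter n.+1 g x]/= gK//.
  exact/IH/bwd.
have Ki n x : Am x -> iter n g (iter n ginv x) = x.
  move=> Ax; elim: n => // n IH; rewrite iterSr [iter n.+1 ginv x]/= Kg//.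
  by elim: (n) => //= k; exact: gi_bwd.
rewrite (_ : (fun n => _) = (fun n => iter (p * n) g @^-1` U E)); first exact:
  end_of EE rE.
apply/funext => n; apply/seteqP; split => [_ [x Ux <-]|x Ux].
  by rewrite /= Ki//; exists E.
by exists (iter (p * n) g x) => //; apply: iK; exists E.
Qed.

Lemma sides_of_ends : sides g ginv Ap Am.
Proof.
have Acl y : (Ap `|` Am) y -> exists2 E, ends T E & U E y.
  by move=> [[E [EE _] Uy]|[E [EE _] Uy]]; exists E.
split.
- exact: g_cont.
- by apply: bigcup_open => E [EE _]; exact: nbhd_open.
- by apply: bigcup_open => E [EE _]; exact: nbhd_open.
- by move=> x Ax; apply: inv.1; exists x.
- exact: bwd.
- move=> x /Acl[E EE Ux]; have [h _ _] := inverse_on_closure EE.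
  by apply: h; exact: subset_closure.
- move=> x /Acl[E EE Ux]; have [_ h _] := inverse_on_closure EE.
  by apply: h; exact: subset_closure.
- move=> y /Acl[E EE Uy] B nB; have [_ _ ci] := inverse_on_closure EE.
  have n1 := within_near ci (subset_closure Uy) nB.
  have n2 : nbhs y (U E) by apply: open_nbhs_nbhs; split => //; exact:
    nbhd_open.
  by apply: filterS2 n1 n2 => z h /subset_closure; exact: h.
- move=> y [Ay|Ay].
    apply: (@end_wandering T _ Jp U g p) => //.
    + by move=> E [EE _]; exact: nbhd_open.
    + by move=> E E' [EE _] [EE' _]; exact: nbhd_disjoint.
    + by move=> x Ax; apply: inv.1; exists x.
    + by move=> E _; exact: continuous_subspaceT.
  have [||||V nV VP] := @end_wandering T _ Jm U ginv p hT _ _ _ _ p0 minus_basis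
    y Ay.
  + by move=> E [EE _]; exact: nbhd_open.
  + by move=> E E' [EE _] [EE' _]; exact: nbhd_disjoint.
  + by move=> x Ax; exact: gi_bwd.
  + by move=> E [EE _]; have [] := inverse_on_closure EE.
  have nA : nbhs y Am.
    apply: open_nbhs_nbhs; split => //.
    by apply: bigcup_open => E [EE _]; exact: nbhd_open.
  (* a return under [g] is a return under its inverse, in the other direction *)
  exists (V `&` Am); first exact: filterI.
  move=> x n [Vx _] n0 [Vn An]; apply: (VP _ _ Vn n0).
  suff -> : iter n ginv (iter n g x) = x by [].
  elim: (n) An => // k IH Ak; rewrite iterSr [iter k.+1 g x]/= gK//.
  exact/IH/bwd.
Qed.

Lemma push_plus (a b : R -> T) :
  {within `[0, 1], continuous a} -> {within `[0, 1], continuous b} ->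
  (forall t, 0 <= t <= 1 -> Ap (a t) /\ Ap (b t)) ->
  path_homotopic_in [set: T] a b ->
  exists (m : nat) (K : R * R -> T), [/\
    {within `[0, 1] `*` `[0, 1], continuous K},
    forall s t, 0 <= s <= 1 -> 0 <= t <= 1 -> Ap (K (s, t)),
    forall t, 0 <= t <= 1 -> K (0, t) = iter m g (a t) /\
      K (1, t) = iter m g (b t) &
    forall s, 0 <= s <= 1 -> K (s, 0) = iter m g (a 0) /\
      K (s, 1) = iter m g (a 1)].
Proof.
apply: (@end_push T _ Jp U g p) => //.
- by move=> E [EE _]; exact: nbhd_open.
- by move=> E E' [EE _] [EE' _]; exact: nbhd_disjoint.
- by move=> x Ax; apply: inv.1; exists x.
- by move=> E _; exact: continuous_subspaceT.
- by move=> E [EE _]; exact: nbhd_subgraph.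
Qed.

Lemma push_minus (a b : R -> T) :
  {within `[0, 1], continuous a} -> {within `[0, 1], continuous b} ->
  (forall t, 0 <= t <= 1 -> Am (a t) /\ Am (b t)) ->
  path_homotopic_in [set: T] a b ->
  exists (m : nat) (K : R * R -> T), [/\
    {within `[0, 1] `*` `[0, 1], continuous K},
    forall s t, 0 <= s <= 1 -> 0 <= t <= 1 -> Am (K (s, t)),
    forall t, 0 <= t <= 1 -> K (0, t) = iter m ginv (a t) /\
      K (1, t) = iter m ginv (b t) &
    forall s, 0 <= s <= 1 -> K (s, 0) = iter m ginv (a 0) /\
      K (s, 1) = iter m ginv (a 1)].
Proof.
apply: (@end_push T _ Jm U ginv p) => //.
- by move=> E [EE _]; exact: nbhd_open.
- by move=> E E' [EE _] [EE' _]; exact: nbhd_disjoint.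
- by move=> E [EE _]; have [] := inverse_on_closure EE.
- by move=> E [EE _]; exact: nbhd_subgraph.
Qed.

End EndPeriodicSides.

Theorem lemma4p10 (R : realType) (T : topologicalType) (G : graph R T)
    (g : T -> T) (p : nat) (U : set (nat -> set T) -> set T)
    (S : set (compactified_torus R g p U)) :
  infinite_graph G ->
  connected [set: T] ->
  finite_set (ends T) ->
  end_periodic G g ->
  pi1_injective_on R [set: T] g ->
  well_chosen G g p U ->
  sides_invariant g p U ->
  component (boundary_plus R g p U) S \/
    component (boundary_minus R g p U) S ->
  pi1_injective_on R S (fun w : compactified_torus R g p U => w).
Proof.
move=> _ _ _ [[g_cont _ _] _] g_inj wc inv comp.
have sd := sides_of_ends g_cont wc inv.
case: comp => comp.
- exact: (plus_injective sd (push_plus g_cont wc inv) comp).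
- exact: (minus_injective sd g_inj (push_minus wc inv) comp).
Qed.
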